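(* Let $N\ge 1$ be an integer, $1<p<m$ and $\sigma>0$. Then every bounded self-similar profile $f\not\equiv 0$ satisfies $$\lim_{\xi\to\infty}\xi^{\sigma/(p-1)}f(\xi)=c^*:=\left(\frac{1}{p-1}\right)^{1/(p-1)}.$$ Moreover, there is a unique $A^*>0$ and a unique self-similar profile $f^*$ such that $f^*(0)=A^*$, $(f^* )'(0)=0$ and $\lim_{\xi\to\infty}\xi^{\sigma/(p-1)}f^*(\xi)=c^*$. Furthermore, $f^*$ is decreasing on $(0,\infty)$.
   Context: Consider the equation $\partial_t u=\Delta u^m-|x|^{\sigma}u^p$ for $(x,t)\in\mathbb{R}^N\times(0,\infty)$, with $N\ge1$, $1<p<m$, $\sigma>0$, and its nonnegative self-similar solutions $u(x,t)=t^{-\alpha}f(|x|t^{\beta})$, where $$\alpha=\frac{\sigma+2}{\sigma(m-1)+2(p-1)},\qquad \beta=\frac{m-p}{\sigma(m-1)+2(p-1)}.$$ The profile $f=f(\xi)$, $\xi=|x|t^{\beta}\ge0$, solves $$(f^m)''(\xi)+\frac{N-1}{\xi}(f^m)'(\xi)+\alpha f(\xi)-\beta\xi f'(\xi)-\xi^{\sigma}f^p(\xi)=0. \qquad ( * )$$ A self-similar profile is a continuous function $f:[0,\infty)\to[0,\infty)$ such that $f^m\in C^1([0,\infty))$, $(f^m)'(0)=0$, $(f^m)'(\xi)=0$ at every zero $\xi$ of $f$, and $f$ satisfies $( * )$ classically on $\{\xi>0: f(\xi)>0\}$. A bounded self-similar solution is one whose profile $f$ is bounded on $[0,\infty)$.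 *)

(* Defs.v *)
From HB Require Import structures.
From mathcomp Require Import all_boot all_order all_algebra.
From mathcomp Require Import all_classical all_reals all_analysis.

Set Implicit Arguments.
Unset Strict Implicit.
Unset Printing Implicit Defensive.

Import Order.TTheory GRing.Theory Num.Theory.
Import numFieldNormedType.Exports.

Local Open Scope classical_set_scope.
Local Open Scope ring_scope.

(* Functions on the half-line [0, +oo) are represented by functions R -> R whose
   values at negative arguments are never used; hence derivatives at 0 are
   one-sided. *)

Section half_line.
Context {R : realType}.
Implicit Types F dF : R -> R.

Definition is_right_derive F (x l : R) : Prop :=
  h^-1 * (F (x + h) - F x) @[h --> 0^'+] --> l.

Definition is_half_line_derive F dF : Prop :=
  is_right_derive F 0 (dF 0) /\ (forall x : R, 0 < x -> is_derive x 1 F (dF x)).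

End half_line.

Section profiles.
Context {R : realType}.

Definition ss_alpha (m p sigma : R) : R :=
  (sigma + 2) / (sigma * (m - 1) + 2 * (p - 1)).

Definition ss_beta (m p sigma : R) : R :=
  (m - p) / (sigma * (m - 1) + 2 * (p - 1)).

Definition profile_ode (N : nat) (m p sigma : R) (f : R -> R) (xi : R) : Prop :=
  let fm := fun x => f x `^ m in
  fm^`()%classic^`()%classic xi + (N%:R - 1) / xi * fm^`()%classic xi
    + ss_alpha m p sigma * f xi - ss_beta m p sigma * xi * f^`()%classic xi
    - xi `^ sigma * f xi `^ p = 0.

Record self_similar_profile (N : nat) (m p sigma : R) (f : R -> R) : Prop := {
  profile_ge0 : forall xi : R, 0 <= xi -> 0 <= f xi ;
  profile_continuous : {within `[0, +oo[, continuous f} ;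
  profile_C1 : exists dfm : R -> R,
    [/\ is_half_line_derive (fun x => f x `^ m) dfm,
        {within `[0, +oo[, continuous dfm},
        dfm 0 = 0 &
        forall xi : R, 0 <= xi -> f xi = 0 -> dfm xi = 0] ;
  (* Continuity of (f^m)'' on the positivity set is not required separately:
     where f > 0, both f and f' = (f^m)' / (m f^(m-1)) are continuous, so it follows
     from the equation. *)
  profile_classical : forall xi : R, 0 < xi -> 0 < f xi ->
    [/\ derivable f xi 1,
        derivable (fun x => f x `^ m) xi 1,
        derivable ((fun x => f x `^ m)^`()%classic) xi 1 &
        profile_ode N m p sigma f xi]
}.

Definition bounded_on_half_line (f : R -> R) : Prop :=
  [bounded f xi | xi in `[0, +oo[].

Definition cstar (p : R) : R := (1 / (p - 1)) `^ (1 / (p - 1)).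

Definition has_cstar_decay (p sigma : R) (f : R -> R) : Prop :=
  xi `^ (sigma / (p - 1)) * f xi @[xi --> +oo] --> cstar p.

Definition decaying_profile_from
    (N : nat) (m p sigma A : R) (f : R -> R) : Prop :=
  [/\ self_similar_profile N m p sigma f, f 0 = A,
      is_right_derive f 0 0 & has_cstar_decay p sigma f].

End profiles.

(* Main.v *)
(* Write n = N - 1, w = f^m, s = sigma/(p-1) and v(xi) = xi^s f(xi). Since
   alpha + beta s = 1/(p-1), the zeroth-order terms of the equation balance exactly at
   v = c^*. Beyond a large xi, critical points of v above (below) c^* + e can only be
   minima (maxima), so v is eventually monotone there; integrating the equation excludes
   both monotone behaviours away from c^*, which gives the limit.

   Uniqueness: t |-> lam^(-2/(m-1)) f(lam t) is a strict subsolution for lam > 1, and two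
   profiles with the same tail can be ordered by decreasing lam to 1.

   Existence: shoot in w(0) = a. The values of a for which w eventually increases and
   those for which w reaches 0 with negative slope form disjoint open sets, each of which
   misses part of ]0, +oo[; a value in neither yields a positive nonincreasing solution
   on the whole half-line, to which the decay result applies. *)

Require Import Defs.
From HB Require Import structures.
From mathcomp Require Import all_boot all_order all_algebra.
From mathcomp Require Import all_classical all_reals all_analysis.
From mathcomp Require Import ring lra.

Set Implicit Arguments.
Unset Strict Implicit.
Unset Printing Implicit Defensive.

Import Order.TTheory GRing.Theory Num.Theory.
Import numFieldNormedType.Exports.

Local Open Scope classical_set_scope.
Local Open Scope ring_scope.

(** * Calculus on intervals *)

(** Two degeneracies shape the proof: the factor (N-1)/x is singular at the origin, and the root f =
    w^(1/m) is not Lipschitz at w = 0. Both are handled through Q = x^n w' - beta x^(n+1) f. Its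
    derivative contains no f', so it can be integrated from the origin, and up to a zero of f. With
    the root cut off below a small delta, (w, Q) solves a Lipschitz Volterra system, and shooting
    only uses solutions on which the cut-off is inactive.

    For the limit of v, the four cases need two mechanisms. Moving away from [cstar] (increasing
    above, decreasing below) is excluded by integrating the flux x^n w'. Moving towards [cstar] but
    stopping short of it is excluded by an energy whose derivative is comparable to 1/x, so that it
    diverges like ln x.

    The factor lam^(-2/(m-1)) is the one for which diffusion scales like the linear terms. Only the
    absorption coefficient then changes, to lam^(sigma + 2(p-1)/(m-1)), and this exceeds 1 for lam >
    1: hence the strictness of the subsolution. *)

Section calculus.
Context {R : realType}.
Implicit Types (F G f g : R -> R) (a b c x y : R).

Lemma is_derive_continuous F x d : is_derive x 1 F d -> {for x, continuous F}.
Proof.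
by move=> dF; apply/differentiable_continuous/derivable1_diffP; exact: ex_derive.
Qed.

Lemma continuous_for_within F a b :
  (forall x, a <= x <= b -> {for x, continuous F}) ->
  {within `[a, b], continuous F}.
Proof.
move=> cF; apply: continuous_in_subspaceT => x; rewrite inE /= in_itv /=.
exact: cF.
Qed.

Lemma MVT_for F a b : a < b ->
  (forall x, a <= x <= b -> {for x, continuous F}) ->
  (forall x, a < x < b -> exists d, is_derive x 1 F d) ->
  exists c d, [/\ a < c < b, is_derive c 1 F d & F b - F a = d * (b - a)].
Proof.
move=> ab cF dF.
have [|c] := MVT (f := F) (df := fun x => 'D_1 F x) ab _ (continuous_for_within cF).
  move=> x; rewrite in_itv /= => /dF[d Fd].
  by apply: DeriveDef => //; exact: ex_derive.
rewrite in_itv /= => acb E; exists c, ('D_1 F c); split => //.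
by have [d Fd] := dF _ acb; apply: DeriveDef => //; exact: ex_derive.
Qed.

Lemma is_derive_unique F x d1 d2 : is_derive x 1 F d1 -> is_derive x 1 F d2 -> d1 = d2.
Proof. by move=> [_ <-] [_ <-]. Qed.

Lemma nondecr_seg F a b : a <= b ->
  (forall x, a <= x <= b -> {for x, continuous F}) ->
  (forall x, a < x < b -> exists2 d, is_derive x 1 F d & 0 <= d) ->
  F a <= F b.
Proof.
rewrite le_eqVlt => /predU1P[-> //|ab] cF dF.
have [|c [d [cab Fd E]]] := MVT_for ab cF; first by move=> x /dF[d]; exists d.
have [d' Fd' d'0] := dF _ cab.
rewrite -subr_ge0 E mulr_ge0 ?subr_ge0 ?(ltW ab)//.
by rewrite (is_derive_unique Fd Fd').
Qed.

Lemma incr_seg F a b : a < b ->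
  (forall x, a <= x <= b -> {for x, continuous F}) ->
  (forall x, a < x < b -> exists2 d, is_derive x 1 F d & 0 < d) ->
  F a < F b.
Proof.
move=> ab cF dF.
have [|c [d [cab Fd E]]] := MVT_for ab cF; first by move=> x /dF[d]; exists d.
have [d' Fd' d'0] := dF _ cab.
by rewrite -subr_gt0 E mulr_gt0 ?subr_gt0// (is_derive_unique Fd Fd').
Qed.

Lemma is_deriveN1 F x d : is_derive x 1 F d -> is_derive x 1 (fun t => - F t) (- d).
Proof. by move=> dF; exact: is_deriveN. Qed.

Lemma is_deriveD1 F G x d e : is_derive x 1 F d -> is_derive x 1 G e ->
  is_derive x 1 (fun t => F t + G t) (d + e).
Proof. by move=> dF dG; exact: is_deriveD. Qed.

Lemma is_deriveB1 F G x d e : is_derive x 1 F d -> is_derive x 1 G e ->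
  is_derive x 1 (fun t => F t - G t) (d - e).
Proof. by move=> dF dG; exact: is_deriveB. Qed.

Lemma is_deriveM1 F G x d e : is_derive x 1 F d -> is_derive x 1 G e ->
  is_derive x 1 (fun t => F t * G t) (d * G x + F x * e).
Proof.
move=> dF dG; apply: (is_derive_eq (is_deriveM dF dG)).
by rewrite addrC [d * _]mulrC.
Qed.

Lemma is_deriveMl c F x d : is_derive x 1 F d ->
  is_derive x 1 (fun t => c * F t) (c * d).
Proof. by move=> dF; exact: is_deriveZ. Qed.

Lemma is_deriveXn n x : is_derive x 1 (fun t : R => t ^+ n) (n%:R * x ^+ n.-1).
Proof.
elim: n => [|n IH].
  by rewrite mul0r; under eq_fun do rewrite expr0; exact: is_derive_cst.
under eq_fun do rewrite exprS.
apply: (is_derive_eq (is_deriveM1 (is_derive_id x 1) IH)).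
case: n {IH} => [|n]; first by rewrite expr0 !mul1r mul0r mulr0 addr0.
by rewrite mulrCA -exprS mul1r -[in RHS]add1n natrD mulrDl mul1r.
Qed.

Lemma is_derive_powR F q x d : 0 < F x -> is_derive x 1 F d ->
  is_derive x 1 (fun t => F t `^ q) (q * F x `^ (q - 1) * d).
Proof. by move=> F0 dF; exact: (is_derive1_comp (is_derive1_powR q F0) dF). Qed.

Lemma is_derive_expR_comp F x d : is_derive x 1 F d ->
  is_derive x 1 (fun t => expR (F t)) (expR (F x) * d).
Proof. by move=> dF; exact: (is_derive1_comp (is_derive_expR (F x)) dF). Qed.

Lemma is_derive_idn x : is_derive x 1 (fun t : R => t) 1.
Proof. exact: is_derive_id. Qed.

Lemma is_derive_sqr F x d : is_derive x 1 F d ->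
  is_derive x 1 (fun t => F t ^+ 2) (2 * F x * d).
Proof.
move=> dF; under eq_fun do rewrite expr2.
by apply: (is_derive_eq (is_deriveM1 dF dF)); ring.
Qed.

Lemma is_derive_cstn c x : is_derive x 1 (fun _ : R => c) 0.
Proof. exact: is_derive_cst. Qed.

Lemma is_derive_near F G x d : (\near x, F x = G x) ->
  is_derive x 1 F d -> is_derive x 1 G d.
Proof. exact: near_eq_is_derive. Qed.

Lemma near_gt a x : a < x -> \forall t \near x, a < t.
Proof.
move=> ax; have : - x < - a by rewrite ltrN2.
by move=> /Nlt_nbhsl; apply: filterS => t; rewrite ltrN2.
Qed.

(* Integrating from -1 makes the derivative at 0 two-sided. *)
Lemma primitive_ex g : continuous g ->
  exists2 G, G 0 = 0 & forall x, 0 <= x -> is_derive x 1 G (g x).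
Proof.
move=> cg.
pose F x := (\int[lebesgue_measure]_(t in `[(-1)%R, x]) g t)%R.
exists (fun x => F x - F 0); first by rewrite subrr.
move=> x x0.
have ix : lebesgue_measure.-integrable `[(-1)%R, x + 1] (EFin \o g).
  apply: continuous_compact_integrable; first exact: segment_compact.
  exact: continuous_subspaceT.
have [||dF EF] := continuous_FTC1_closed _ ix _ (cg x); [by lra|by lra|].
rewrite derive1E in EF.
have /is_deriveB1 /(_ (is_derive_cstn (F 0) x)) := DeriveDef dF EF.
by rewrite subr0.
Qed.

Lemma right_pos F x d : is_derive x 1 F d -> 0 < d -> 0 <= F x ->
  exists2 e, 0 < e & forall y, x < y < x + e -> 0 < F y.
Proof.
move=> dF d0 Fx.
have /cvgrPdist_lt /(_ _ d0) [e /= e0 H] : h^-1 *: ((F \o shift x) h - F x) @[h --> 0^'] --> d.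
  have [dv <-] := dF.
  have := dv; rewrite /derivable /derive.
  by under eq_fun do rewrite /= /GRing.scale /= mulr1.
exists e => // y /andP[xy yx].
have := H (y - x); rewrite /= sub0r normrN gtr0_norm ?subr_gt0//.
rewrite ltrBlDr addrC => /(_ yx); rewrite gt_eqF ?subr_gt0// => /(_ isT).
rewrite /= subrK /GRing.scale /= ltr_norml => /andP[_].
rewrite ltrBlDr -ltrBlDl subrr pmulr_rgt0 ?invr_gt0 ?subr_gt0//.
by move=> h; exact: le_lt_trans h.
Qed.

Lemma first_zero F a b : a <= b ->
  (forall x, a <= x <= b -> {for x, continuous F}) ->
  0 < F a -> F b <= 0 ->
  exists c, [/\ a < c <= b, F c = 0 & forall x, a <= x < c -> 0 < F x].
Proof.
move=> ab cF Fa Fb.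
pose S := [set x | a <= x <= b /\ F x <= 0].
have Sb : S b by split; [rewrite ab lexx|].
have lbS : has_inf S.
  by split; [exists b | exists a => x [/andP[]]].
pose c := inf S.
have ac : a <= c by apply: lb_le_inf; [exists b|move=> x [/andP[]]].
have cb : c <= b by apply: ge_inf => //; case: lbS.
have cFc : {for c, continuous F} by apply: cF; rewrite ac.
have pos x : a <= x < c -> 0 < F x.
  move=> /andP[ax xc]; rewrite ltNge; apply/negP => Fx.
  have : c <= x by apply: ge_inf; [case: lbS|split => //; rewrite ax (le_trans (ltW xc))].
  by rewrite leNgt xc.
have Fc : F c <= 0.
  rewrite leNgt; apply/negP => Fc.
  have /cvgrPdist_lt /(_ _ Fc) [e /= e0 H] := cFc.
  have [x [/andP[ax xb] Fx] xc] := inf_adherent e0 lbS.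
  have cx : c <= x by apply: ge_inf; [case: lbS|split => //; rewrite ax xb].
  have := H x; rewrite /= ler0_norm ?subr_le0// opprB ltrBlDl => /(_ xc).
  by rewrite ltr_norml => /andP[_]; rewrite ltrBlDl => h; move: Fx h; lra.
have {}ac : a < c.
  by rewrite lt_neqAle ac andbT; apply/eqP => E; move: Fa Fc; rewrite E; lra.
exists c; split => //; first by rewrite ac.
apply/eqP; rewrite eq_le Fc /= leNgt; apply/negP => Fc'.
have Fc'' : 0 < - F c by lra.
have /cvgrPdist_lt /(_ _ Fc'') [e /= e0 H] := cFc.
pose x := Num.max a (c - e / 2).
have xc : a <= x < c by rewrite /x le_max lexx gt_max ac /=; lra.
have ex : c - e / 2 <= x by rewrite /x le_max lexx orbT.
have := pos _ xc; have := H x; rewrite /= gtr0_norm; last by move/andP: xc => []; lra.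
have -> : c - x < e by move: ex; lra.
by move=> /(_ isT); rewrite ltr_norml => /andP[]; lra.
Qed.

Lemma last_zero F a b : a <= b ->
  (forall x, a <= x <= b -> {for x, continuous F}) ->
  F a <= 0 -> 0 < F b ->
  exists c, [/\ a <= c < b, F c = 0 & forall x, c < x <= b -> 0 < F x].
Proof.
move=> ab cF Fa Fb.
have [||||c [cab Fc H]] := @first_zero (fun x => F (- x)) (- b) (- a).
- by rewrite lerN2.
- move=> x xab; apply: (@continuous_comp _ _ _ (fun x => - x) F).
    exact: opp_continuous.
  by apply: cF; move: xab => /andP[]; lra.
- by rewrite opprK.
- by rewrite opprK.
exists (- c); split => //; first by move/andP: cab; lra.
by move=> x xcb; rewrite -[x]opprK; apply: H; move/andP: xcb; lra.
Qed.

Lemma left_neg F x d : is_derive x 1 F d -> 0 < d -> F x <= 0 ->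
  exists2 e, 0 < e & forall y, x - e < y < x -> F y < 0.
Proof.
move=> dF d0 Fx.
have dG : is_derive (- x) 1 (fun t => - F (- t)) d.
  have dF' : is_derive (- - x) 1 F d by rewrite opprK.
  have := is_deriveN1 (is_derive1_comp dF' (is_deriveNid (- x) (1 : R))).
  by rewrite mulrN1 opprK.
have [|e e0 H] := right_pos dG d0; first by rewrite opprK oppr_ge0.
exists e => // y /andP[y1 y2]; rewrite -oppr_gt0 -[y]opprK; apply: H.
by apply/andP; split; lra.
Qed.

(** At a first zero after [a], positivity on the left forces a nonpositive derivative, against the
    crossing condition. That condition is also imposed at x = a, where its positivity premise is
    vacuous, so that F may start from zero. *)
Lemma stays_pos F (dF : R -> R) a :
  (forall x, a <= x -> is_derive x 1 F (dF x)) -> 0 <= F a ->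
  (forall x, a <= x -> (forall t, a < t < x -> 0 < F t) -> F x = 0 -> 0 < dF x) ->
  forall x, a < x -> 0 < F x.
Proof.
move=> HF Fa cross.
have cF x : a <= x -> {for x, continuous F} by move=> /HF /is_derive_continuous.
have [e e0 He] : exists2 e, 0 < e & forall y, a < y < a + e -> 0 < F y.
  move: Fa; rewrite le_eqVlt => /predU1P[Fa|Fa].
    apply: (right_pos (HF a (lexx a))); last by rewrite -Fa.
    by apply: cross => // t /andP[h1 h2]; have := lt_trans h1 h2; rewrite ltxx.
  have /cvgrPdist_lt /(_ _ Fa) [e /= e0 He] := cF _ (lexx a).
  exists e => // y /andP[ay ye]; have := He y; rewrite /= ltr0_norm ?subr_lt0//.
  by rewrite opprB ltrBlDl => /(_ ye); rewrite ltr_norml => /andP[_]; lra.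
move=> x ax; rewrite ltNge; apply/negP => Fx.
have ex : a + e / 2 <= x.
  rewrite leNgt; apply/negP => xe; have := He x; rewrite ax /=.
  by have -> : x < a + e; [lra|move=> /(_ isT); lra].
have [|||c [/andP[ac cx] Fc Hc]] := @first_zero F (a + e / 2) x ex.
- by move=> t /andP[at_ _]; apply: cF; lra.
- by apply: He; lra.
- by [].
have pos t : a < t < c -> 0 < F t.
  move=> /andP[at_ tc]; have [te|te] := ltP t (a + e / 2).
    by apply: He; rewrite at_ /=; lra.
  by apply: Hc; rewrite te.
have ac' : a <= c by lra.
have [e' e'0 H'] : exists2 e', 0 < e' & forall y, c - e' < y < c -> F y < 0.
  by apply: left_neg (HF c ac') (cross c ac' pos Fc) _; rewrite Fc.
pose y := Num.max ((a + c) / 2) (c - e' / 2).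
have [y1 y2] : (a + c) / 2 <= y /\ c - e' / 2 <= y by rewrite /y !le_max !lexx orbT.
have y3 : y < c by rewrite /y gt_max; apply/andP; split; lra.
have := pos y; have := H' y; rewrite y3 !andbT.
by have -> : c - e' < y; [lra|have -> : a < y; [lra|move=> /(_ isT) h /(_ isT); lra]].
Qed.

End calculus.

(** * A singular Volterra system *)

Section volterra.
Context {R : realType}.
Implicit Types (F G u v w Q : R -> R) (a b x X : R).

Lemma abs_le_seg F G a b : a <= b ->
  (forall x, a <= x <= b -> {for x, continuous F}) ->
  (forall x, a <= x <= b -> {for x, continuous G}) ->
  (forall x, a < x < b -> exists d e,
     [/\ is_derive x 1 F d, is_derive x 1 G e & `|d| <= e]) ->
  `|F b - F a| <= G b - G a.
Proof.
move=> ab cF cG dFG.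
have H1 : G a - F a <= G b - F b.
  apply: (nondecr_seg (F := fun x => G x - F x)) => // x xab.
    by apply: cvgB; [exact: cG|exact: cF].
  have [d [e [dF dG]]] := dFG _ xab; rewrite ler_norml => /andP[_ de].
  by exists (e - d); [exact: is_deriveB1|lra].
have H2 : G a + F a <= G b + F b.
  apply: (nondecr_seg (F := fun x => G x + F x)) => // x xab.
    by apply: cvgD; [exact: cG|exact: cF].
  have [d [e [dF dG]]] := dFG _ xab; rewrite ler_norml => /andP[de _].
  by exists (e + d); [exact: is_deriveD1|lra].
by rewrite ler_norml; apply/andP; split; lra.
Qed.

(** The intervals of radius 2 C / 2^k around u k are nested, and l is the supremum of their left
    ends; the rate comes with the construction. *)
Lemma geometric_limit (u : nat -> R) (C : R) :
  (forall k, `|u k.+1 - u k| <= C / 2 ^+ k) ->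
  exists l, forall k, `|l - u k| <= 2 * C / 2 ^+ k.
Proof.
move=> hu.
have p2 k : (2 : R) ^+ k.+1 = 2 * 2 ^+ k by rewrite exprS.
have p2p k : 0 < (2 : R) ^+ k by rewrite exprn_gt0.
have half k : C / 2 ^+ k = 2 * (C / 2 ^+ k.+1).
  by rewrite p2; field; exact: lt0r_neq0.
pose lo k := u k - 2 * (C / 2 ^+ k); pose hi k := u k + 2 * (C / 2 ^+ k).
have lo_S k : lo k <= lo k.+1.
  by have := hu k; rewrite ler_norml /lo (half k) => /andP[]; lra.
have hi_S k : hi k.+1 <= hi k.
  by have := hu k; rewrite ler_norml /hi (half k) => /andP[]; lra.
have lo_mono j k : (j <= k)%N -> lo j <= lo k.
  by apply: (homo_leq (r := <=%R)) => //; exact: le_trans.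
have hi_mono j k : (j <= k)%N -> hi k <= hi j.
  by apply: (homo_leq (r := fun x y : R => y <= x)) => // y x z xy yz; exact: le_trans yz xy.
have C0 k : 0 <= C / 2 ^+ k by apply: le_trans (hu k).
have lohi j k : lo j <= hi k.
  apply: (le_trans (lo_mono _ _ (leq_maxl j k))).
  apply: le_trans (hi_mono _ _ (leq_maxr j k)).
  by rewrite /lo /hi; have := C0 (maxn j k); lra.
have lo_sup : has_sup (range lo).
  by split; [exists (lo 0%N), 0%N|exists (hi 0%N) => _ [k _ <-]].
exists (sup (range lo)) => k; rewrite -mulrA ler_norml.
have : lo k <= sup (range lo) by apply: ub_le_sup; [case: lo_sup|exists k].
have : sup (range lo) <= hi k by apply: ge_sup; [case: lo_sup|move=> _ [j _ <-]].
by rewrite /lo /hi => ? ?; apply/andP; split; lra.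
Qed.

Lemma halving_small (C e : R) : 0 < e -> exists k, C / 2 ^+ k < e.
Proof.
move=> e0; exists (Num.bound `|C / e|).
rewrite ltr_pdivrMr ?exprn_gt0// mulrC -ltr_pdivrMr//.
apply: le_lt_trans (ler_norm _) _; apply: lt_le_trans (archi_boundP _) _ => //.
by rewrite -natrX ler_nat; apply/ltnW/ltn_expl.
Qed.

(* The Picard map halves distances in the sup norm weighted by this function. *)
Definition volterra_weight (L x : R) := expR (2 * L * x ^+ 2).

Variables (n : nat) (L : R) (h : R -> R -> R) (b : R -> R).
Hypothesis L0 : 0 < L.

Local Notation E := (volterra_weight L).

Let E0 x : 0 < E x. Proof. exact: expR_gt0. Qed.

Let dE x : is_derive x 1 E (4 * L * x * E x).
Proof.
apply: (is_derive_eq (is_derive_expR_comp (is_deriveMl (2 * L) (is_deriveXn 2 x)))).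
by rewrite -/(volterra_weight L x) /= expr1; ring.
Qed.

Let cE x : {for x, continuous E}.
Proof. exact: is_derive_continuous (dE x). Qed.

(* [v] is the Picard image of [u] for the Volterra system
   v' = Q / x^n + x b(u), Q' = x^n h(x, u), v(0) = a, Q(0) = 0. *)
Definition picard_image X u a Q v :=
  [/\ Q 0 = 0, v 0 = a,
      forall x, 0 <= x <= X -> {for x, continuous Q} /\ {for x, continuous v} &
      forall x, 0 < x < X -> is_derive x 1 Q (x ^+ n * h x (u x)) /\
                             is_derive x 1 v (Q x / x ^+ n + x * b (u x))].

(** The bound on Q carries a factor x^(n+1), which cancels the singular 1/x^n. Each of the two terms
    of v' then contributes L S x E, and 2 L S x E is the derivative of (S/2) E: this is what fixes
    the constant in the weight. *)
Lemma picard_contract X u1 a1 Q1 v1 u2 a2 Q2 v2 S :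
  (forall x, 0 < x < X -> `|h x (u1 x) - h x (u2 x)| <= L * `|u1 x - u2 x|) ->
  (forall x, 0 < x < X -> `|b (u1 x) - b (u2 x)| <= L * `|u1 x - u2 x|) ->
  picard_image X u1 a1 Q1 v1 -> picard_image X u2 a2 Q2 v2 ->
  0 <= S -> (forall x, 0 <= x <= X -> `|u1 x - u2 x| <= S * E x) ->
  forall x, 0 <= x <= X ->
    `|Q1 x - Q2 x| <= L * S * x ^+ n.+1 * E x /\
    `|v1 x - v2 x| <= `|a1 - a2| + S / 2 * (E x - 1).
Proof.
move=> Lh Lb [Q10 v10 c1 d1] [Q20 v20 c2 d2] S0 uS.
have HQ x : 0 <= x <= X -> `|Q1 x - Q2 x| <= L * S * x ^+ n.+1 * E x.
  move=> /andP[x0 xX].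
  have := @abs_le_seg (fun t => Q1 t - Q2 t) (fun t => L * S * t ^+ n.+1 * E t) 0 x x0.
  rewrite Q10 Q20 !subr0 expr0n /= mulr0 mul0r subr0; apply.
  - move=> t /andP[t0 tx]; have [|cQ1 _] := c1 t; first by rewrite t0 (le_trans tx).
    have [|cQ2 _] := c2 t; first by rewrite t0 (le_trans tx).
    exact: cvgB.
  - move=> t _; apply: is_derive_continuous.
    exact: is_deriveM1 (is_deriveMl _ (is_deriveXn n.+1 t)) (dE t).
  move=> t /andP[t0 tx]; have tX : 0 < t < X by rewrite t0 (lt_le_trans tx).
  have [dQ1 _] := d1 _ tX; have [dQ2 _] := d2 _ tX.
  exists (t ^+ n * h t (u1 t) - t ^+ n * h t (u2 t)).
  exists (L * S * (n.+1%:R * t ^+ n) * E t + L * S * t ^+ n.+1 * (4 * L * t * E t)).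
  split; first exact: is_deriveB1.
    exact: is_deriveM1 (is_deriveMl _ (is_deriveXn n.+1 t)) (dE t).
  have tn : 0 < t ^+ n by rewrite exprn_gt0.
  rewrite -mulrBr normrM (gtr0_norm tn).
  apply: (@le_trans _ _ (t ^+ n * (L * (S * E t)))).
    rewrite ler_pM2l//; apply: le_trans (Lh _ tX) _; rewrite ler_pM2l//.
    by apply: uS; rewrite (ltW t0) (le_trans (ltW tx)).
  have H1 : 0 <= L * S * t ^+ n * E t.
    by rewrite !mulr_ge0 // ?(ltW L0) ?(ltW tn) ?(ltW (E0 _)).
  have H2 : 0 <= L * S * t ^+ n.+1 * (4 * L * t * E t).
    by rewrite !mulr_ge0 // ?(ltW L0) ?exprn_ge0 ?(ltW t0) ?(ltW (E0 _)).
  have H3 : 0 <= (n%:R : R) * (L * S * t ^+ n * E t) by rewrite mulr_ge0.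
  rewrite -[n.+1]addn1 natrD addn1; move: H1 H2 H3; nra.
move=> x xX; split; first exact: HQ.
move: xX => /andP[x0 xX].
have := @abs_le_seg (fun t => v1 t - v2 t) (fun t => S / 2 * E t) 0 x x0.
have -> : E 0 = 1 by rewrite /volterra_weight expr0n mulr0 expR0.
rewrite v10 v20 => H.
suff : `|v1 x - v2 x - (a1 - a2)| <= S / 2 * (E x - 1).
  move=> K; have := ler_normD (v1 x - v2 x - (a1 - a2)) (a1 - a2).
  by rewrite subrK; move: K; lra.
have -> : S / 2 * (E x - 1) = S / 2 * E x - S / 2 * 1 by ring.
apply: H.
- move=> t /andP[t0 tx]; have [|_ cQ1] := c1 t; first by rewrite t0 (le_trans tx).
  have [|_ cQ2] := c2 t; first by rewrite t0 (le_trans tx).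
  exact: cvgB.
- by move=> t _; apply: is_derive_continuous; exact: is_deriveMl (dE t).
move=> t /andP[t0 tx]; have tX : 0 < t < X by rewrite t0 (lt_le_trans tx).
have [_ dv1] := d1 _ tX; have [_ dv2] := d2 _ tX.
do 2 eexists; split; [exact: is_deriveB1 dv1 dv2|exact: is_deriveMl (dE t)|].
have tX' : 0 <= t <= X by rewrite (ltW t0) (le_trans (ltW tx)).
have tn : 0 < t ^+ n by rewrite exprn_gt0.
have -> : Q1 t / t ^+ n + t * b (u1 t) - (Q2 t / t ^+ n + t * b (u2 t)) =
    (Q1 t - Q2 t) / t ^+ n + t * (b (u1 t) - b (u2 t)) by ring.
apply: le_trans (ler_normD _ _) _.
have A1 : `|(Q1 t - Q2 t) / t ^+ n| <= L * S * t * E t.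
  rewrite normrM normfV (gtr0_norm tn) ler_pdivrMr//.
  by apply: le_trans (HQ _ tX') _; rewrite exprS le_eqVlt; apply/orP; left; apply/eqP; ring.
have A2 : `|t * (b (u1 t) - b (u2 t))| <= t * (L * (S * E t)).
  rewrite normrM (gtr0_norm t0) ler_pM2l//; apply: le_trans (Lb _ tX) _.
  by rewrite ler_pM2l//; exact: uS.
have -> : S / 2 * (4 * L * t * E t) = L * S * t * E t + t * (L * (S * E t)) by field.
exact: lerD.
Qed.

(** Let S be the attained maximum of the weighted distance. Both solutions are their own Picard
    images, so the contraction bounds S by the initial gap plus about half of S. Uniqueness and
    continuous dependence both follow from this. *)
Lemma picard_stable X w1 a1 Q1 w2 a2 Q2 : 0 <= X ->
  (forall x, 0 < x < X -> `|h x (w1 x) - h x (w2 x)| <= L * `|w1 x - w2 x|) ->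
  (forall x, 0 < x < X -> `|b (w1 x) - b (w2 x)| <= L * `|w1 x - w2 x|) ->
  picard_image X w1 a1 Q1 w1 -> picard_image X w2 a2 Q2 w2 ->
  forall x, 0 <= x <= X ->
    `|Q1 x - Q2 x| <= L * (2 * `|a1 - a2|) * x ^+ n.+1 * E x /\
    `|w1 x - w2 x| <= 2 * `|a1 - a2| * E x.
Proof.
move=> X0 Lh Lb i1 i2.
have [c cX cmax] : exists2 c, c \in `[0, X]%R &
    forall t, t \in `[0, X]%R -> `|w1 t - w2 t| / E t <= `|w1 c - w2 c| / E c.
  apply: EVT_max => //; apply: continuous_for_within => x xX.
  have [_ _ /(_ _ xX)[_ c1] _] := i1; have [_ _ /(_ _ xX)[_ c2] _] := i2.
  apply: cvgM; last by apply: cvgV; [exact: lt0r_neq0|exact: cE].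
  apply: cvg_norm; exact: cvgB.
set S := `|w1 c - w2 c| / E c in cmax.
have S0 : 0 <= S by rewrite divr_ge0// ltW.
have wS x : 0 <= x <= X -> `|w1 x - w2 x| <= S * E x.
  by move=> xX; rewrite -ler_pdivrMr//; apply: cmax; rewrite in_itv.
have H := picard_contract Lh Lb i1 i2 S0 wS.
rewrite in_itv /= in cX.
have Sle : S <= 2 * `|a1 - a2|.
  have [_] := H _ cX; have -> : `|w1 c - w2 c| = S * E c by rewrite divfK// lt0r_neq0.
  have E1 : 1 <= E c by rewrite /volterra_weight -expR0 ler_expR mulr_ge0 ?sqr_ge0// mulr_ge0// ltW.
  have a0 := normr_ge0 (a1 - a2).
  by move: S0 E1 a0; set e := E c; set a := `|a1 - a2|; nra.
move=> x xX; have [HQ _] := H _ xX; split.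
  apply: le_trans HQ _; move: xX => /andP[x0 _].
  by rewrite !ler_wpM2r ?(ltW (E0 _)) ?exprn_ge0// ler_pM2l.
by apply: le_trans (wS _ xX) _; rewrite ler_pM2r.
Qed.

Hypothesis hL : forall x y : R, `|h x y| <= L.
Hypothesis bL : forall y : R, `|b y| <= L.
Hypothesis hlip : forall x y z : R, `|h x y - h x z| <= L * `|y - z|.
Hypothesis blip : forall y z : R, `|b y - b z| <= L * `|y - z|.
Hypothesis h_cont : forall u, continuous u -> continuous (fun x => h x (u x)).

Let b_cont u : continuous u -> continuous (fun x => b (u x)).
Proof.
move=> cu x; apply/cvgrPdist_le => e e0.
have /cvgrPdist_le /(_ (e / L)) := cu x.
rewrite divr_gt0// => /(_ isT); apply: filterS => y H.
by apply: le_trans (blip _ _) _; rewrite mulrC -ler_pdivlMr.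
Qed.

Let abs_cont (F : R -> R) : (forall x, 0 <= x -> {for x, continuous F}) ->
  continuous (fun x => F `|x|).
Proof.
move=> cF x; apply: (@continuous_comp _ _ _ (fun x => `|x|) F).
  exact: norm_continuous.
exact: cF.
Qed.

Let near_abs (F : R -> R) x d : 0 < x -> is_derive x 1 F d ->
  is_derive x 1 (fun t => F `|t|) d.
Proof.
move=> x0; apply: is_derive_near; near=> t.
rewrite gtr0_norm//; near: t; exact: near_gt.
Unshelve. all: by end_near. Qed.

(** All integrands are read at |x|: they become continuous on the whole line, and the even
    extensions of the primitives give a globally continuous iterate to which the step applies
    again. *)
Lemma picard_step_ex u a : continuous u ->
  exists Q v, continuous v /\ forall X, picard_image X u a Q v.
Proof.
move=> cu; pose g x := `|x| ^+ n * h `|x| (u `|x|).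
have cu' : continuous (fun x : R => u `|x|) by apply: (@abs_cont u) => y _; exact: cu.
have cpow : continuous (fun x : R => `|x| ^+ n).
  by apply: (@abs_cont (fun x => x ^+ n)) => x _; exact: is_derive_continuous (is_deriveXn n x).
have cg : continuous g.
  move=> x; apply: cvgM; first exact: cpow.
  apply: (@abs_cont (fun x => h x (u x))) => // y _; exact: h_cont.
have [Q Q0 dQ] := primitive_ex cg.
have QL x : 0 <= x -> `|Q x| <= L * x ^+ n * x.
  move=> x0; rewrite -[Q x]subr0 -{1}Q0.
  have -> : L * x ^+ n * x = L * x ^+ n * x - L * x ^+ n * 0 by rewrite mulr0 subr0.
  apply: (@abs_le_seg Q (fun t => L * x ^+ n * t)) => //.
  - by move=> t /andP[t0 _]; exact: is_derive_continuous (dQ _ t0).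
  - move=> t _; apply: is_derive_continuous; exact: is_deriveMl (is_derive_idn t).
  move=> t /andP[t0 tx]; exists (g t), (L * x ^+ n * 1); split.
  - exact/dQ/ltW.
  - exact: is_deriveMl (is_derive_idn t).
  rewrite mulr1 /g normrM normrX normr_id (gtr0_norm t0) mulrC.
  apply: ler_pM => //; first by rewrite exprn_ge0// ltW.
  by rewrite lerXn2r// ?nnegrE ltW.
(* Since |Q x| <= L x^(n+1), the quotient is at most L |x|, so it is continuous with value 0 at the
   origin. *)
pose J x := Q `|x| / `|x| ^+ n.
have JL x : `|J x| <= L * `|x|.
  rewrite /J; have [->|x0] := eqVneq x 0; first by rewrite normr0 Q0 mul0r normr0 mulr0.
  rewrite normrM normfV normrX normr_id ler_pdivrMr ?exprn_gt0 ?normr_gt0//.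
  by apply: le_trans (QL _ (normr_ge0 x)) _; rewrite -!mulrA [_ ^+ _ * _]mulrC.
have cJ : continuous J.
  move=> x; have [->|x0] := eqVneq x 0.
    have J0 : J 0 = 0 by apply/eqP; rewrite -normr_le0; have := JL 0; rewrite normr0 mulr0.
    apply/cvgrPdist_le => e e0; rewrite J0.
    exists (e / L); first by rewrite /= divr_gt0.
    move=> t /=; rewrite !sub0r !normrN => te; apply: le_trans (JL t) _.
    by rewrite mulrC -ler_pdivlMr// ltW.
  apply: cvgM.
    apply: (@abs_cont Q) => y y0; exact: is_derive_continuous (dQ _ y0).
  apply: cvgV; last exact: cpow.
  by rewrite expf_neq0// normr_eq0.
have [|V V0 dV] := @primitive_ex R (fun x => J x + x * b (u `|x|)).
  move=> x; apply: cvgD; first exact: cJ.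
  apply: cvgM; first exact: cvg_id.
  exact: (b_cont cu').
exists (fun x => Q `|x|), (fun x => a + V `|x|); split.
  move=> x; apply: cvgD; first exact: cvg_cst.
  apply: (@abs_cont V) => y y0; exact: is_derive_continuous (dV _ y0).
move=> X; split.
- by rewrite normr0.
- by rewrite normr0 V0 addr0.
- move=> x _; split.
    apply: (@abs_cont Q) => y y0; exact: is_derive_continuous (dQ _ y0).
  apply: cvgD; first exact: cvg_cst.
  apply: (@abs_cont V) => y y0; exact: is_derive_continuous (dV _ y0).
move=> x /andP[x0 _]; have := dQ _ (ltW x0); have := dV _ (ltW x0).
rewrite /g /J (gtr0_norm x0) => dVx dQx; split; first exact: near_abs.
rewrite -[X in is_derive _ _ _ X]add0r.
exact: is_deriveD1 (is_derive_cstn a x) (near_abs x0 dVx).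
Qed.

Lemma picard_fixpoint_ex a :
  exists Q w, continuous w /\ forall X, picard_image X w a Q w.
Proof.
(* The value on discontinuous functions is a default that the iteration never meets. *)
pose step u := if pselect (continuous u) is left cu
  then sval (cid (svalP (cid (picard_step_ex a cu)))) else u.
have stepP u : continuous u -> continuous (step u) /\
    exists Q, forall X, picard_image X u a Q (step u).
  move=> cu; rewrite /step; case: pselect => // cu'.
  case: cid => Q /= HQ; case: cid => v /= [cv Hv]; split => //; by exists Q.
pose W k := iter k step (fun=> a).
have cW k : continuous (W k).
  by elim: k => [|k IH] /=; [exact: cst_continuous|exact: (stepP _ IH).1].
have lipW X u1 u2 (x : R) : 0 < x < X -> `|h x (u1 x) - h x (u2 x)| <= L * `|u1 x - u2 x|.
  by move=> _; exact: hlip.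
have blipW X u1 u2 (x : R) : 0 < x < X -> `|b (u1 x) - b (u2 x)| <= L * `|u1 x - u2 x|.
  by move=> _; exact: blip.
have contract u1 u2 S v1 v2 Q1 Q2 : 0 <= S ->
    (forall X, picard_image X u1 a Q1 v1) -> (forall X, picard_image X u2 a Q2 v2) ->
    (forall x, 0 <= x -> `|u1 x - u2 x| <= S * E x) ->
    (forall x, 0 <= x -> `|v1 x - v2 x| <= S / 2 * E x).
  move=> S0 i1 i2 H x x0.
  have xx : 0 <= x <= x by rewrite x0 lexx.
  have Hx t : 0 <= t <= x -> `|u1 t - u2 t| <= S * E t by move=> /andP[t0 _]; exact: H.
  have [_] := picard_contract (@lipW x u1 u2) (@blipW x u1 u2) (i1 x) (i2 x) S0 Hx xx.
  by rewrite subrr normr0 add0r mulrBr => K; apply: le_trans K _; lra.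
have first x : 0 <= x -> `|W 1%N x - W 0%N x| <= 1 * E x.
  move=> x0; have [_ [Q HQ]] := stepP _ (cW 0%N); have [Q0 W0 cQ dQ] := HQ x.
  have HQt t : 0 < t < x -> `|Q t| <= L * t ^+ n * t.
    move=> /andP[t0 tx]; have := @abs_le_seg Q (fun r => L * t ^+ n * r) 0 t (ltW t0).
    rewrite Q0 subr0 mulr0 subr0; apply.
    - by move=> r /andP[r0 rt]; have [] := cQ r; rewrite // r0 (le_trans rt)// ltW.
    - by move=> r _; exact: is_derive_continuous (is_deriveMl (L * t ^+ n) (is_derive_idn r)).
    move=> r /andP[r0 rt]; have [|dQr _] := dQ r; first by rewrite r0 (lt_trans rt).
    do 2 eexists; split; [exact: dQr|exact: is_deriveMl (is_derive_idn r)|].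
    rewrite mulr1 normrM normrX (gtr0_norm r0) mulrC.
    apply: ler_pM => //; first by rewrite exprn_ge0// ltW.
    by rewrite lerXn2r// ?nnegrE ltW.
  have := @abs_le_seg (W 1%N) (fun t => L * t ^+ 2) 0 x x0.
  rewrite [W 1%N 0]W0 expr0n mulr0 subr0 => /(_ _ _ _)/le_trans; apply.
  - by move=> t _; exact: cW.
  - by move=> t _; exact: is_derive_continuous (is_deriveMl L (is_deriveXn 2 t)).
  - move=> t tx; have [dQt dWt] := dQ _ tx.
    do 2 eexists; split; [exact: dWt|exact: is_deriveMl (is_deriveXn 2 t)|].
    have t0 : 0 < t by case/andP: tx.
    have tn : 0 < t ^+ n by rewrite exprn_gt0.
    apply: le_trans (ler_normD _ _) _.
    have A1 : `|Q t / t ^+ n| <= L * t.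
      rewrite normrM normfV (gtr0_norm tn) ler_pdivrMr//.
      by apply: le_trans (HQt _ tx) _; rewrite mulrAC.
    have A2 : `|t * b a| <= t * L by rewrite normrM (gtr0_norm t0) ler_pM2l.
    by rewrite expr1; apply: le_trans (lerD A1 A2) _; lra.
  (* The first increment is at most L x^2, and exp(y) >= 1 + y with y = 2 L x^2 puts it below the
     weight. *)
  rewrite mul1r; apply: le_trans _ (expR_ge1Dx _).
  by have : 0 <= L * x ^+ 2; [rewrite mulr_ge0 ?sqr_ge0// ltW|lra].
have geo k x : 0 <= x -> `|W k.+1 x - W k x| <= E x / 2 ^+ k.
  elim: k x => [|k IH] x x0; first by rewrite expr0 divr1 -[E x]mul1r; exact: first.
  have [_ [Q1 H1]] := stepP _ (cW k); have [_ [Q2 H2]] := stepP _ (cW k.+1).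
  have := contract (W k.+1) (W k) (2 ^- k) _ _ _ _ _ H2 H1 _ x x0.
  rewrite invr_ge0 exprn_ge0// => /(_ isT).
  have -> : 2 ^- k / 2 * E x = E x / 2 ^+ k.+1 by rewrite exprS invfM; ring.
  by apply => t t0; rewrite mulrC; exact: IH.
have lim x : exists l, 0 <= x -> forall k, `|l - W k x| <= 2 * E x / 2 ^+ k.
  have [x0|] := boolP (0 <= x); last by exists 0.
  by have [l Hl] := geometric_limit (fun k => geo k x x0); exists l.
(* The limit is chosen at |x|, so [w] is even and its continuity at 0 is two-sided. *)
pose w x := sval (cid (lim `|x|)).
have wW x k : 0 <= x -> `|w x - W k x| <= 2 * E x / 2 ^+ k.
  by move=> x0; rewrite /w (ger0_norm x0); case: cid => l /= Hl; exact: Hl.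
have wabs x : w x = w `|x| by rewrite /w normr_id.
have cw : continuous w.
  move=> x; apply/cvgrPdist_lt => e e0.
  have [k Hk] : exists k, 2 * E (`|x| + 1) / 2 ^+ k < e / 3.
    by apply: halving_small; rewrite divr_gt0.
  have WE y : `|y| <= `|x| + 1 -> `|w y - W k `|y| | < e / 3.
    move=> yx; rewrite wabs; apply: le_lt_trans (wW _ _ (normr_ge0 y)) _.
    apply: le_lt_trans Hk; rewrite ler_pM2r ?invr_gt0 ?exprn_gt0// ler_pM2l//.
    rewrite /volterra_weight ler_expR ler_pM2l ?mulr_gt0//.
    by apply: lerXn2r; rewrite ?nnegrE ?addr_ge0.
  have /cvgrPdist_lt /(_ (e / 3)) := @abs_cont (W k) (fun y _ => @cW k y) x.
  rewrite divr_gt0// => /(_ isT) HW; near=> y.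
  have yx : `|y| <= `|x| + 1.
    have : `|x - y| < 1 by near: y; exists 1 => //=.
    by have := ler_normB x (x - y); rewrite opprB addrC subrK; lra.
  have -> : w x - w y = (w x - W k `|x|) + (W k `|x| - W k `|y|) - (w y - W k `|y|) by ring.
  apply: le_lt_trans (ler_normB _ _) _.
  have xx : `|x| <= `|x| + 1 by rewrite lerDl.
  have := WE y yx; have := WE x xx; have : `|W k `|x| - W k `|y| | < e / 3 by near: y.
  by have := ler_normD (w x - W k `|x|) (W k `|x| - W k `|y|); lra.
(* The Picard image [v] of the limit coincides with the limit, because both lie within a multiple of
   2^(-k) of the same iterate. *)
have [Q [v [cv Hv]]] := picard_step_ex a cw.
have vw x : 0 <= x -> v x = w x.
  move=> x0; apply/eqP; rewrite -subr_eq0 -normr_le0 leNgt; apply/negP => vw0.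
  have [k Hk] := halving_small (2 * E x) vw0.
  have [_ [Q' HQ']] := stepP _ (cW k).
  have C1 : `|v x - W k.+1 x| <= 2 / 2 ^+ k / 2 * E x.
    have S0 : 0 <= 2 / 2 ^+ k :> R by rewrite divr_ge0// exprn_ge0.
    apply: (contract w (W k) _ _ _ _ _ S0 Hv HQ') => // t t0.
    by rewrite mulrAC; exact: wW.
  have C2 := wW x k.+1 x0.
  have C3 : 2 / 2 ^+ k / 2 * E x = 2 * E x / 2 ^+ k.+1.
    by rewrite exprS invfM; ring.
  have C4 : 2 * E x / 2 ^+ k = 2 * (2 * E x / 2 ^+ k.+1).
    by rewrite exprS; field; rewrite expf_neq0.
  have := ler_normB (v x - W k.+1 x) (w x - W k.+1 x).
  have -> : v x - W k.+1 x - (w x - W k.+1 x) = v x - w x by ring.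
  by move: C1 C2 Hk; rewrite C3 C4; lra.
exists Q, w; split => // X; have [Q0 v0 cQ dQ] := Hv X; split => //.
- by rewrite -vw.
- by move=> x xX; split; [exact: (cQ _ xX).1|exact: cw].
move=> x xX; have [d1 d2] := dQ _ xX; split => //.
apply: is_derive_near d2; near=> t; apply: vw; apply: ltW; near: t.
by apply: near_gt; move/andP: xX => [].
Unshelve. all: by end_near. Qed.

End volterra.

(** * The profile equation and its tail variable *)

Section profile_equation.
Context {R : realType}.
Variables (n : nat) (m p sigma : R).
Hypotheses (p1 : 1 < p) (pm : p < m) (sigma0 : 0 < sigma).

Local Notation N := (n.+1%:R : R).
Local Notation alpha := (ss_alpha m p sigma).
Local Notation beta := (ss_beta m p sigma).
Local Notation s := (sigma / (p - 1)).
Local Notation k := (1 / (p - 1)).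

Lemma ss_den_gt0 : 0 < sigma * (m - 1) + 2 * (p - 1).
Proof. by move: p1 pm => h1 h2; apply: addr_gt0; apply: mulr_gt0 => //; lra. Qed.

Lemma ss_alpha_gt0 : 0 < alpha.
Proof. by apply: divr_gt0; [have := sigma0; have := pm; lra|exact: ss_den_gt0]. Qed.

Lemma ss_beta_gt0 : 0 < beta.
Proof. by apply: divr_gt0; [have := sigma0; have := pm; lra|exact: ss_den_gt0]. Qed.

Lemma ss_alphaD_beta : alpha + beta * s = k.
Proof.
have D := ss_den_gt0; have p0 : 0 < p - 1 by move: p1; lra.
by rewrite /ss_alpha /ss_beta; field; rewrite !lt0r_neq0.
Qed.

(* [z] stands for (f^m)'; the coefficient [kap] of the absorption term is 1 for the
   equation itself and differs from 1 for rescaled profiles. *)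
Record ode_at (kap : R) (f z : R -> R) (x : R) : Prop := {
  ode_pos : 0 < f x ;
  ode_df : is_derive x 1 f (f x * z x / (m * f x `^ m)) ;
  ode_dz : is_derive x 1 z (beta * x * (f x * z x / (m * f x `^ m)) - alpha * f x
             + kap * x `^ sigma * f x `^ p - (N - 1) / x * z x) }.

Section at_point.
Variables (kap : R) (f z : R -> R) (x : R).
Hypotheses (x0 : 0 < x) (ode : ode_at kap f z x).

Let f0 : 0 < f x := ode_pos ode.

Lemma ode_dw : is_derive x 1 (fun t => f t `^ m) (z x).
Proof.
apply: (is_derive_eq (is_derive_powR m f0 (ode_df ode))).
have w0 : 0 < f x `^ m by exact: powR_gt0.
have -> : m * f x `^ (m - 1) * (f x * z x / (m * f x `^ m)) =
   (f x * f x `^ (m - 1)) * (m * z x / (m * f x `^ m)) by ring.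
rewrite mulr_powRB1 ?(ltW f0)//; last by move: p1 pm; lra.
by field; rewrite lt0r_neq0//= lt0r_neq0//; move: p1 pm; lra.
Qed.

Lemma ode_dflux : is_derive x 1 (fun t => t ^+ n * z t)
  (x ^+ n * (beta * x * (f x * z x / (m * f x `^ m)) - alpha * f x
             + kap * x `^ sigma * f x `^ p)).
Proof.
apply: (is_derive_eq (is_deriveM1 (is_deriveXn n x) (ode_dz ode))).
have -> : N - 1 = n%:R by rewrite -addn1 natrD addrK.
have -> : n%:R * x ^+ n.-1 * z x = x ^+ n * (n%:R / x * z x).
  case: n => [|j]; first by rewrite !mul0r mulr0.
  by rewrite /= exprS; field; rewrite lt0r_neq0.
by ring.
Qed.

(** Divergence form: subtracting beta x^(n+1) f absorbs the convection term, so only f itself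
    remains on the right. It gives the sign information where f tends to 0 and where two solutions
    touch at the origin. *)
Lemma ode_dQ : is_derive x 1 (fun t => t ^+ n * z t - beta * (t ^+ n.+1 * f t))
  (x ^+ n * (kap * x `^ sigma * f x `^ p - (alpha + beta * N) * f x)).
Proof.
apply: (is_derive_eq (is_deriveB1 ode_dflux
  (is_deriveMl beta (is_deriveM1 (is_deriveXn n.+1 x) (ode_df ode))))).
by rewrite /= exprS; ring.
Qed.

End at_point.

Section rescaled.
Variables (f z : R -> R) (x : R).
Hypotheses (x0 : 0 < x) (ode : ode_at 1 f z x).
Let f0 : 0 < f x := ode_pos ode.
Let w0 : 0 < f x `^ m. Proof. exact: powR_gt0. Qed.
Let m0 : 0 < m. Proof. by move: p1 pm; lra. Qed.

Definition tail (f : R -> R) (t : R) := t `^ s * f t.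
(* (t^s f)' has the sign of this quantity. *)
Definition tail_sgn (f z : R -> R) (t : R) := t * z t + s * m * f t `^ m.

Lemma tail_gt0 : 0 < tail f x.
Proof. by rewrite mulr_gt0// powR_gt0. Qed.

Lemma tail_powR : tail f x `^ (p - 1) = x `^ sigma * f x `^ (p - 1).
Proof.
rewrite powRM ?powR_ge0 ?(ltW f0)// -powRrM divfK// lt0r_neq0//; move: p1; lra.
Qed.

Lemma tail_derive : is_derive x 1 (tail f)
  (tail f x * tail_sgn f z x / (m * x * f x `^ m)).
Proof.
apply: (is_derive_eq (is_deriveM1 (is_derive_powR s x0 (is_derive_idn x)) (ode_df ode))).
have -> : x `^ (s - 1) = x `^ s / x by rewrite powRB ?powRr1 ?(ltW x0)//; apply/implyP; rewrite (lt0r_neq0 x0).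
rewrite /tail /tail_sgn; field.
have p0 : 0 < p - 1 by move: p1; lra.
by rewrite !lt0r_neq0.
Qed.

(* The equation in terms of t^s f: since alpha + beta s = 1/(p-1), the zeroth-order
   terms balance exactly when t^s f = c^*. *)
Lemma laplacian_tail :
  beta * x * (f x * z x / (m * f x `^ m)) - alpha * f x + 1 * x `^ sigma * f x `^ p =
  f x * (beta * tail_sgn f z x / (m * f x `^ m) + (tail f x `^ (p - 1) - k)).
Proof.
rewrite tail_powR -ss_alphaD_beta.
have -> : f x `^ p = f x * f x `^ (p - 1) by rewrite mulr_powRB1 ?(ltW f0)//; move: p1; lra.
rewrite /tail_sgn; field.
have p0 : 0 < p - 1 by move: p1; lra.
by rewrite !lt0r_neq0.
Qed.

Lemma ode_dflux_tail : is_derive x 1 (fun t => t ^+ n * z t)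
  (x ^+ n * (f x * (beta * tail_sgn f z x / (m * f x `^ m) + (tail f x `^ (p - 1) - k)))).
Proof. by rewrite -laplacian_tail; exact: ode_dflux. Qed.

Lemma tail_sgn_derive : is_derive x 1 (tail_sgn f z)
  ((s * m + 2 - N) * z x +
   x * (f x * (beta * tail_sgn f z x / (m * f x `^ m) + (tail f x `^ (p - 1) - k)))).
Proof.
rewrite -laplacian_tail.
apply: (is_derive_eq (is_deriveD1 (is_deriveM1 (is_derive_idn x) (ode_dz ode))
   (is_deriveMl (s * m) (ode_dw ode)))).
field.
have p0 : 0 < p - 1 by move: p1; lra.
by rewrite !lt0r_neq0.
Qed.

(* The correction makes the second-order terms cancel up to an error O(t^(-3)). *)
Definition tail_energy (f z : R -> R) (t : R) :=
  beta * tail f t - t `^ s * (z t / t + (N - s) * (f t `^ m / t ^+ 2)).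

(** Multiplied by x^(s-1), the equation reads beta v' - x^(s-1) (z' + (N-1) z / x) = -(v/x) (v^(p-1)
    - k). The correction in the energy makes the left side an exact derivative up to a multiple of
    x^(s-3) f^m. *)
Lemma tail_energy_derive : is_derive x 1 (tail_energy f z)
  (- (tail f x / x) * ((tail f x `^ (p - 1) - k) +
     (N - s) * (s - 2) * f x `^ (m - 1) / x ^+ 2)).
Proof.
have dV : is_derive x 1 (fun t : R => t^-1) (- x ^- 2).
  by apply: (is_derive_eq (is_deriveV (lt0r_neq0 x0) (is_derive_idn x))); rewrite /GRing.scale /= mulr1.
have dV2 : is_derive x 1 (fun t : R => t ^- 2) (- (2 / x ^+ 3)).
  apply: (is_derive_eq (is_deriveV (f := fun t => t ^+ 2) _ (is_deriveXn 2 x))).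
    by rewrite expf_neq0// lt0r_neq0.
  by rewrite /GRing.scale /= expr1; field; rewrite lt0r_neq0.
apply: (is_derive_eq (is_deriveB1 (is_deriveMl beta tail_derive)
   (is_deriveM1 (is_derive_powR s x0 (is_derive_idn x))
     (is_deriveD1 (is_deriveM1 (ode_dz ode) dV)
        (is_deriveMl (N - s) (is_deriveM1 (ode_dw ode) dV2)))))).
rewrite laplacian_tail.
have -> : x `^ (s - 1) = x `^ s / x by rewrite powRB ?powRr1 ?(ltW x0)//; apply/implyP; rewrite (lt0r_neq0 x0).
have -> : f x `^ (m - 1) = f x `^ m / f x by rewrite powRB ?powRr1 ?(ltW f0)//; apply/implyP; rewrite (lt0r_neq0 f0).
rewrite /tail /tail_sgn; field.
have p0 : 0 < p - 1 by move: p1; lra.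
by rewrite !lt0r_neq0.
Qed.

End rescaled.
End profile_equation.

(** * Decay of bounded positive solutions *)

Section tail_behaviour.
Context {R : realType}.
Variables (n : nat) (m p sigma : R).
Hypotheses (p1 : 1 < p) (pm : p < m) (sigma0 : 0 < sigma).

Local Notation N := (n.+1%:R : R).
Local Notation beta := (ss_beta m p sigma).
Local Notation s := (sigma / (p - 1)).
Local Notation k := (1 / (p - 1)).

Variables (f z : R -> R) (X0 M : R).
Hypothesis X0_ge1 : 1 <= X0.
Hypothesis ode : forall x, X0 <= x -> ode_at n m p sigma 1 f z x.
Hypothesis fM : forall x, X0 <= x -> f x <= M.

Local Notation v := (tail p sigma f).
Local Notation Y := (tail_sgn m p sigma f z).

Let p10 : 0 < p - 1. Proof. by move: p1; lra. Qed.
Let m0 : 0 < m. Proof. by move: p1 pm; lra. Qed.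
Let m10 : 0 < m - 1. Proof. by move: p1 pm; lra. Qed.
Let s0 : 0 < s. Proof. exact: divr_gt0. Qed.
Let x_ge1 x : X0 <= x -> 1 <= x. Proof. exact: le_trans. Qed.
Let x_gt0 x : X0 <= x -> 0 < x. Proof. by move/x_ge1; exact: lt_le_trans. Qed.
Let f0 x : X0 <= x -> 0 < f x. Proof. by move/ode => []. Qed.
Let w0 x : X0 <= x -> 0 < f x `^ m. Proof. by move/f0/powR_gt0. Qed.
Let M0 : 0 < M. Proof. exact: lt_le_trans (f0 (lexx X0)) (fM (lexx X0)). Qed.
Let beta0 : 0 < beta. Proof. exact: ss_beta_gt0. Qed.

Let wE x : X0 <= x -> f x `^ m = f x * f x `^ (m - 1).
Proof. by move=> Xx; rewrite mulr_powRB1// ltW// f0. Qed.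

Let fm1M x : X0 <= x -> f x `^ (m - 1) <= M `^ (m - 1).
Proof.
by move=> Xx; apply: ge0_ler_powR; rewrite ?nnegrE ?(ltW m10) ?(ltW M0) ?fM// ltW// f0.
Qed.

Let dv x : X0 <= x -> is_derive x 1 v (v x * Y x / (m * x * f x `^ m)).
Proof. by move=> Xx; exact: tail_derive (x_gt0 Xx) (ode Xx). Qed.

Let dflux x : X0 <= x -> is_derive x 1 (fun t => t ^+ n * z t)
  (x ^+ n * (f x * (beta * Y x / (m * f x `^ m) + (v x `^ (p - 1) - k)))).
Proof. by move=> Xx; exact: ode_dflux_tail (x_gt0 Xx) (ode Xx). Qed.

Let v0 x : X0 <= x -> 0 < v x.
Proof. by move=> Xx; exact: tail_gt0 (x_gt0 Xx) (ode Xx). Qed.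

Let U_mono x y : X0 <= x -> X0 <= y -> v x <= v y -> v x `^ (p - 1) <= v y `^ (p - 1).
Proof.
move=> Xx Xy xy; apply: ge0_ler_powR => //; first exact: ltW.
  by rewrite nnegrE ltW// v0.
by rewrite nnegrE ltW// v0.
Qed.

Let dv_coef x : X0 <= x -> 0 < v x / (m * x * f x `^ m).
Proof. by move=> Xx; rewrite divr_gt0 ?(v0 Xx)// !mulr_gt0 ?(x_gt0 Xx) ?(w0 Xx). Qed.

Lemma tail_nondecr a b : X0 <= a -> a <= b ->
  (forall t, a < t < b -> 0 <= Y t) -> v a <= v b.
Proof.
move=> Xa ab HY; apply: nondecr_seg => // t /andP[at_ tb].
  exact: is_derive_continuous (dv (le_trans Xa at_)).
have Xt : X0 <= t by rewrite (le_trans Xa)// ltW.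
eexists; first exact: dv Xt.
by rewrite mulrAC mulr_ge0 ?HY ?(ltW (dv_coef Xt))// at_.
Qed.

Lemma tail_nonincr a b : X0 <= a -> a <= b ->
  (forall t, a < t < b -> Y t <= 0) -> v b <= v a.
Proof.
move=> Xa ab HY; rewrite -lerN2; apply: (@nondecr_seg _ (fun t => - v t)) => // t /andP[at_ tb].
  exact: is_derive_continuous (is_deriveN1 (dv (le_trans Xa at_))).
have Xt : X0 <= t by rewrite (le_trans Xa)// ltW.
eexists; first exact: is_deriveN1 (dv Xt).
by rewrite oppr_ge0 mulrAC mulr_ge0_le0 ?HY ?(ltW (dv_coef Xt))// at_.
Qed.

(** Boundedness of f makes every error term f^(m-1)/x^2 vanish at infinity, before any decay of f is
    known. *)
Lemma small_correction C e : 0 < e ->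
  exists2 X1, X0 <= X1 & forall x, X1 <= x -> `|C * f x `^ (m - 1) / x ^+ 2| <= e.
Proof.
move=> e0; exists (Num.max X0 (`|C| * M `^ (m - 1) / e)); first by rewrite le_max lexx.
move=> x; rewrite ge_max => /andP[Xx]; rewrite ler_pdivrMr// => Cx.
rewrite !normrM (ger0_norm (powR_ge0 _ _)) normfV normrX (gtr0_norm (x_gt0 Xx)).
rewrite ler_pdivrMr ?exprn_gt0 ?(x_gt0 Xx)//.
apply: (@le_trans _ _ (`|C| * M `^ (m - 1))); first by rewrite ler_wpM2l// fm1M.
apply: le_trans Cx _; by rewrite mulrC ler_pM2l// expr2 ler_peMr ?x_ge1// ltW// x_gt0.
Qed.

Let a := s * m + 2 - N.

Let dY x := a * z x + x * (f x * (beta * Y x / (m * f x `^ m) + (v x `^ (p - 1) - k))).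

Let dYP x : X0 <= x -> is_derive x 1 Y (dY x).
Proof. by move=> Xx; exact: tail_sgn_derive (x_gt0 Xx) (ode Xx). Qed.

Let dY_at0 x : X0 <= x -> Y x = 0 ->
  dY x = x * f x * ((v x `^ (p - 1) - k) - a * (s * m) * f x `^ (m - 1) / x ^+ 2).
Proof.
move=> Xx Yx; rewrite /dY Yx mulr0 mul0r add0r.
have x0 := x_gt0 Xx.
have -> : z x = - (s * m * f x `^ m) / x.
  apply: (mulfI (lt0r_neq0 x0)); rewrite mulrCA mulfV ?mulr1 ?lt0r_neq0//.
  by move: Yx; rewrite /tail_sgn; lra.
rewrite (wE Xx); field.
by rewrite !lt0r_neq0.
Qed.

(** While Y > 0, v increases and stays above the level; there Y' > 0 at any zero of Y, so Y cannot
    return to zero. Half of [e] pays for the correction term. *)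
Lemma tail_increasing_region e : 0 < e -> exists2 X1, X0 <= X1 & forall x1, X1 <= x1 ->
  k + e <= v x1 `^ (p - 1) -> 0 <= Y x1 ->
  forall x, x1 < x -> 0 < Y x /\ k + e <= v x `^ (p - 1).
Proof.
move=> e0; have e20 : 0 < e / 2 by lra.
have [X1 X01 HX1] := small_correction (a * (s * m)) e20.
exists X1 => // x1 X1x1 Ux1 Yx1.
have X0x1 : X0 <= x1 := le_trans X01 X1x1.
have U_up x : x1 <= x -> (forall t, x1 < t < x -> 0 < Y t) -> k + e <= v x `^ (p - 1).
  move=> x1x HY; apply: le_trans Ux1 _; apply: U_mono => //; first exact: le_trans x1x.
  by apply: tail_nondecr => // t /HY/ltW.
have pos : forall x, x1 < x -> 0 < Y x.
  apply: (stays_pos (dF := dY)) => // [x x1x|x x1x HY Yx].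
    by apply: dYP; exact: le_trans x1x.
  have Xx : X0 <= x by exact: le_trans x1x.
  rewrite dY_at0// pmulr_rgt0 ?mulr_gt0 ?(x_gt0 Xx) ?(f0 Xx)//.
  have := U_up _ x1x HY; have := HX1 _ (le_trans X1x1 x1x).
  by rewrite ler_norml => /andP[_]; lra.
by move=> x x1x; split; [exact: pos|apply: U_up; [exact: ltW|by move=> t /andP[/pos]]].
Qed.

Lemma tail_decreasing_region e : 0 < e -> exists2 X1, X0 <= X1 & forall x1, X1 <= x1 ->
  v x1 `^ (p - 1) <= k - e -> Y x1 <= 0 ->
  forall x, x1 < x -> Y x < 0 /\ v x `^ (p - 1) <= k - e.
Proof.
move=> e0; have e20 : 0 < e / 2 by lra.
have [X1 X01 HX1] := small_correction (a * (s * m)) e20.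
exists X1 => // x1 X1x1 Ux1 Yx1.
have X0x1 : X0 <= x1 := le_trans X01 X1x1.
have U_dn x : x1 <= x -> (forall t, x1 < t < x -> 0 < - Y t) -> v x `^ (p - 1) <= k - e.
  move=> x1x HY; apply: le_trans _ Ux1; apply: U_mono => //; first exact: le_trans x1x.
  by apply: tail_nonincr => // t /HY; rewrite oppr_gt0 => /ltW.
have pos : forall x, x1 < x -> 0 < - Y x.
  apply: (stays_pos (F := fun t => - Y t) (dF := fun t => - dY t)) => [x x1x| |x x1x HY Yx].
  - by apply/is_deriveN1/dYP; exact: le_trans x1x.
  - by rewrite oppr_ge0.
  have Xx : X0 <= x by exact: le_trans x1x.
  move/eqP: Yx; rewrite oppr_eq0 => /eqP Yx.
  rewrite dY_at0// -mulrN pmulr_rgt0 ?mulr_gt0 ?(x_gt0 Xx) ?(f0 Xx)//.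
  have := U_dn _ x1x HY; have := HX1 _ (le_trans X1x1 x1x).
  by rewrite ler_norml => /andP[]; lra.
move=> x x1x; split; first by rewrite -oppr_gt0; exact: pos.
by apply: U_dn; [exact: ltW|by move=> t /andP[/pos]].
Qed.

Let big_square (C c : R) : 0 < c -> exists2 y : R, 0 <= y & C < c * y ^+ 2.
Proof.
move=> c0; exists (1 + `|C| / c); first by rewrite addr_ge0// divr_ge0// ltW.
have q0 : 0 <= `|C| / c by rewrite divr_ge0// ltW.
have qC : C <= c * (`|C| / c) by rewrite mulrC divfK ?ler_norm// lt0r_neq0.
rewrite expr2; set q := `|C| / c in q0 qC *.
have h1 : 0 <= c * q by rewrite mulr_ge0// ltW.
have h2 : 0 <= c * q * q by rewrite mulr_ge0.
lra.
Qed.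

Let pow_split (x1 x : R) : 0 <= x1 -> x1 <= x -> x1 ^+ n.+1 <= x1 * x ^+ n.
Proof.
by move=> x10 x1x; rewrite exprS ler_wpM2l// lerXn2r// nnegrE (le_trans x10).
Qed.

Let f_mono x1 x2 : X0 <= x1 -> x1 <= x2 ->
  (forall t, x1 < t < x2 -> 0 <= z t) -> f x1 <= f x2.
Proof.
move=> Xx1 x12 Hz; apply: nondecr_seg => // t /andP[at_ tb].
  exact: is_derive_continuous (ode_df (ode (le_trans Xx1 at_))).
have Xt : X0 <= t by rewrite (le_trans Xx1)// ltW.
eexists; first exact: ode_df (ode Xt).
by rewrite divr_ge0 ?mulr_ge0 ?(ltW (f0 Xt)) ?(ltW (w0 Xt)) ?(ltW m0) ?Hz ?at_.
Qed.

Let f_anti x1 x2 : X0 <= x1 -> x1 <= x2 ->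
  (forall t, x1 < t < x2 -> z t <= 0) -> f x2 <= f x1.
Proof.
move=> Xx1 x12 Hz; rewrite -lerN2; apply: (@nondecr_seg _ (fun t => - f t)) => // t /andP[at_ tb].
  exact: is_derive_continuous (is_deriveN1 (ode_df (ode (le_trans Xx1 at_)))).
have Xt : X0 <= t by rewrite (le_trans Xx1)// ltW.
eexists; first exact: is_deriveN1 (ode_df (ode Xt)).
rewrite oppr_ge0 mulr_le0_ge0 ?invr_ge0 ?mulr_ge0 ?(ltW (w0 Xt)) ?(ltW m0)//.
by rewrite mulr_ge0_le0 ?(ltW (f0 Xt))// Hz ?at_.
Qed.

Let flux_lower x1 x c : X0 <= x1 -> x1 <= x ->
  (forall t, x1 < t < x -> c <= f t * (beta * Y t / (m * f t `^ m) + (v t `^ (p - 1) - k))) ->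
  x1 ^+ n * z x1 + c / N * (x ^+ n.+1 - x1 ^+ n.+1) <= x ^+ n * z x.
Proof.
move=> Xx1 x1x H.
suff : x1 ^+ n * z x1 - c / N * x1 ^+ n.+1 <= x ^+ n * z x - c / N * x ^+ n.+1.
  by set q := c / N; rewrite mulrBr; lra.
have D t : X0 <= t -> is_derive t 1 (fun t => t ^+ n * z t - c / N * t ^+ n.+1)
    (t ^+ n * (f t * (beta * Y t / (m * f t `^ m) + (v t `^ (p - 1) - k))) -
     c / N * (N * t ^+ n)).
  by move=> Xt; exact: is_deriveB1 (dflux Xt) (is_deriveMl _ (is_deriveXn n.+1 t)).
apply: (@nondecr_seg _ (fun t => t ^+ n * z t - c / N * t ^+ n.+1)) => // t /andP[x1t tx].
  exact: is_derive_continuous (D _ (le_trans Xx1 x1t)).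
have Xt : X0 <= t by rewrite (le_trans Xx1)// ltW.
eexists; first exact: D.
have -> : c / N * (N * t ^+ n) = t ^+ n * c by field; rewrite lt0r_neq0.
by rewrite -mulrBr mulr_ge0 ?exprn_ge0 ?subr_ge0 ?(ltW (x_gt0 Xt))// H// x1t.
Qed.

Let flux_upper x1 x c : X0 <= x1 -> x1 <= x ->
  (forall t, x1 < t < x -> f t * (beta * Y t / (m * f t `^ m) + (v t `^ (p - 1) - k)) <= c) ->
  x ^+ n * z x <= x1 ^+ n * z x1 + c / N * (x ^+ n.+1 - x1 ^+ n.+1).
Proof.
move=> Xx1 x1x H.
suff : c / N * x1 ^+ n.+1 - x1 ^+ n * z x1 <= c / N * x ^+ n.+1 - x ^+ n * z x.
  by set q := c / N; rewrite mulrBr; lra.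
have D t : X0 <= t -> is_derive t 1 (fun t => c / N * t ^+ n.+1 - t ^+ n * z t)
    (c / N * (N * t ^+ n) - 
     t ^+ n * (f t * (beta * Y t / (m * f t `^ m) + (v t `^ (p - 1) - k)))).
  by move=> Xt; exact: is_deriveB1 (is_deriveMl _ (is_deriveXn n.+1 t)) (dflux Xt).
apply: (@nondecr_seg _ (fun t => c / N * t ^+ n.+1 - t ^+ n * z t)) => // t /andP[x1t tx].
  exact: is_derive_continuous (D _ (le_trans Xx1 x1t)).
have Xt : X0 <= t by rewrite (le_trans Xx1)// ltW.
eexists; first exact: D.
have -> : c / N * (N * t ^+ n) = t ^+ n * c by field; rewrite lt0r_neq0.
by rewrite -mulrBr mulr_ge0 ?exprn_ge0 ?subr_ge0 ?(ltW (x_gt0 Xt))// H// x1t.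
Qed.

Let Y_coef_ge0 t : X0 <= t -> 0 <= Y t -> 0 <= beta * Y t / (m * f t `^ m).
Proof.
move=> Xt Yt; apply: divr_ge0; first by rewrite mulr_ge0// ltW.
by rewrite mulr_ge0 ?(ltW m0) ?(ltW (w0 Xt)).
Qed.

Let Y_coef_le0 t : X0 <= t -> Y t <= 0 -> beta * Y t / (m * f t `^ m) <= 0.
Proof.
move=> Xt Yt; apply: mulr_le0_ge0; first by rewrite mulr_ge0_le0// ltW.
by rewrite invr_ge0 mulr_ge0 ?(ltW m0) ?(ltW (w0 Xt)).
Qed.

(** Here (x^n z)' >= e x^n f. If z is positive once, it stays positive, f is bounded below by a
    positive constant, z grows at least linearly and f^m quadratically, against the bound M. *)
Lemma no_increasing_above x1 e : 0 < e -> X0 <= x1 ->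
  ~ (forall x, x1 <= x -> 0 <= Y x /\ k + e <= v x `^ (p - 1)).
Proof.
move=> e0 Xx1 H.
have lap t : x1 <= t -> e * f t <= f t * (beta * Y t / (m * f t `^ m) + (v t `^ (p - 1) - k)).
  move=> x1t; have [Yt Ut] := H _ x1t; have Xt := le_trans Xx1 x1t.
  rewrite mulrC ler_wpM2l ?(ltW (f0 Xt))//; have := Y_coef_ge0 Xt Yt; lra.
have [[x2 [x12 zx2]]|nz] := pselect (exists x2, x1 <= x2 /\ 0 < z x2).
  have Xx2 := le_trans Xx1 x12; have x20 := x_gt0 Xx2.
  have zpos x : x2 <= x -> 0 < z x.
    move=> x2x; have x0 : 0 < x := lt_le_trans x20 x2x.
    have := @flux_lower x2 x 0 Xx2 x2x; rewrite mul0r mul0r addr0.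
    have K1 : 0 < x2 ^+ n * z x2 by rewrite mulr_gt0// exprn_gt0.
    move=> K2; have := lt_le_trans K1 (K2 _); rewrite pmulr_rgt0 ?exprn_gt0//; apply.
    move=> t /andP[x2t _]; have x1t : x1 <= t by rewrite (le_trans x12)// ltW.
    by apply: le_trans (lap _ x1t); rewrite mulr_ge0 ?(ltW e0) ?(ltW (f0 (le_trans Xx1 x1t))).
  have fx2 x : x2 <= x -> f x2 <= f x.
    by move=> x2x; apply: f_mono => // t /andP[/ltW/zpos/ltW].
  pose c := e * f x2 / N.
  have c0 : 0 < c by rewrite divr_gt0// mulr_gt0// f0.
  have zlow x : x2 <= x -> c * (x - x2) <= z x.
    move=> x2x; have x0 : 0 < x := lt_le_trans x20 x2x.
    have xn0 : 0 < x ^+ n by rewrite exprn_gt0.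
    rewrite -(ler_pM2l xn0).
    apply: le_trans _ (@flux_lower x2 x (e * f x2) Xx2 x2x _); last first.
      move=> t /andP[x2t _]; have x1t : x1 <= t by rewrite (le_trans x12)// ltW.
      by apply: le_trans (lap _ x1t); rewrite ler_pM2l// fx2// ltW.
    have := mulr_gt0 (exprn_gt0 n x20) (zpos _ (lexx _)).
    rewrite -/c => h1; have := pow_split (ltW x20) x2x; rewrite exprS => h2.
    have : c * (x2 * x2 ^+ n) <= c * (x2 * x ^+ n) by rewrite ler_pM2l.
    rewrite [x ^+ n.+1]exprS; lra.
  have [y y0 Hy] := big_square (M `^ m) (divr_gt0 c0 (ltr0n R 2)).
  have x2y : x2 <= x2 + y by rewrite lerDl.
  have D t : x2 <= t -> is_derive t 1 (fun t => f t `^ m - c / 2 * (t - x2) ^+ 2)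
     (z t - c * (t - x2)).
    move=> x2t.
    apply: (is_derive_eq (is_deriveB1 (ode_dw p1 pm (ode (le_trans Xx2 x2t)))
      (is_deriveMl (c / 2) (is_derive_sqr
        (is_deriveB1 (is_derive_idn t) (is_derive_cstn x2 t)))))).
    by field.
  have := @nondecr_seg _ (fun t => f t `^ m - c / 2 * (t - x2) ^+ 2) x2 (x2 + y) x2y.
  rewrite subrr expr0n mulr0 subr0 [x2 + y - x2]addrAC subrr add0r.
  have := w0 Xx2 => h1.
  have : f (x2 + y) `^ m <= M `^ m.
    apply: ge0_ler_powR; rewrite ?nnegrE ?(ltW m0) ?(ltW M0) ?fM// ?(le_trans Xx2)//.
    by rewrite ltW// f0// (le_trans Xx2).
  move=> h2 /(_ _ _)h3; suff : f x2 `^ m <= f (x2 + y) `^ m - c / 2 * y ^+ 2 by lra.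
  apply: h3 => t /andP[x2t _]; first exact: is_derive_continuous (D _ x2t).
  by eexists; [exact: D (ltW x2t)|rewrite subr_ge0 zlow// ltW].
(* Remaining case: f is nonincreasing while v is nondecreasing, hence f x <= 2^s f (2x). Integrating
   the flux over [x, 2x] gives -z x >= c x f x, whereas Y >= 0 gives -x z x <= s m (f x)^m. So c x^2
   is bounded by s m M^(m-1), which fails for large x. *)
have zneg x : x1 <= x -> z x <= 0.
  by move=> x1x; rewrite leNgt; apply/negP => zx; apply: nz; exists x.
pose c := e / N / 2 `^ s.
have c0 : 0 < c by rewrite !divr_gt0// powR_gt0.
have [y y0 Hy] := big_square (s * m * M `^ (m - 1)) c0.
pose x := Num.max x1 y.
have x1x : x1 <= x by rewrite le_max lexx.
have yx : y <= x by rewrite le_max lexx orbT.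
have Xx := le_trans Xx1 x1x; have x0 := x_gt0 Xx.
have x2x : x <= 2 * x by lra.
have X2x := le_trans Xx x2x.
have K1 := @flux_lower x (2 * x) (e * f (2 * x)) Xx x2x.
have {}K1 : x ^+ n * z x + e * f (2 * x) / N * ((2 * x) ^+ n.+1 - x ^+ n.+1) <= (2 * x) ^+ n * z (2 * x).
  apply: K1 => t /andP[xt t2x]; have x1t : x1 <= t by rewrite (le_trans x1x)// ltW.
  apply: le_trans (lap _ x1t); rewrite ler_pM2l//.
  apply: f_anti; [exact: le_trans x1t|exact: ltW|].
  by move=> r /andP[tr _]; apply: zneg; rewrite (le_trans x1t)// ltW.
have K2 : (2 * x) ^+ n * z (2 * x) <= 0.
  by rewrite mulr_ge0_le0 ?exprn_ge0 ?zneg ?(le_trans x1x)// mulr_ge0// ltW.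
have K3 : 2 * x ^+ n.+1 <= (2 * x) ^+ n.+1.
  rewrite exprMn ler_wpM2r ?exprn_ge0 ?(ltW x0)// exprS ler_peMr//.
  by rewrite exprn_ege1// ler1n.
have K4 : f x <= 2 `^ s * f (2 * x).
  have := @tail_nondecr x (2 * x) Xx x2x; rewrite /tail powRM ?(ltW x0)// => h.
  have xs : 0 < x `^ s by rewrite powR_gt0.
  rewrite -(ler_pM2l xs) mulrCA mulrA; apply: h => t /andP[xt _].
  by case: (H t) => //; rewrite (le_trans x1x)// ltW.
have K5 : - (s * m * f x `^ m) <= x * z x by have [+ _] := H _ x1x; rewrite /tail_sgn; lra.
have xn0 : 0 < x ^+ n by rewrite exprn_gt0.
have K6 : c * f x * x <= - z x.
  have g0 : 0 < 2 `^ s :> R by rewrite powR_gt0.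
  have h1 : c * f x <= e / N * f (2 * x).
    rewrite /c mulrAC ler_pdivrMr// -[X in _ <= X]mulrA ler_pM2l ?divr_gt0//.
    by apply: le_trans K4 _; rewrite mulrC.
  apply: (@le_trans _ _ (e / N * f (2 * x) * x)); first by rewrite ler_pM2r.
  rewrite -(ler_pM2l xn0).
  have h2 : e * f (2 * x) / N * x ^+ n.+1 <= e * f (2 * x) / N * ((2 * x) ^+ n.+1 - x ^+ n.+1).
    by rewrite ler_wpM2l ?divr_ge0 ?mulr_ge0 ?(ltW e0) ?(ltW (f0 X2x))//; lra.
  have -> : x ^+ n * (e / N * f (2 * x) * x) = e * f (2 * x) / N * x ^+ n.+1 by rewrite exprS; ring.
  by apply: (le_trans h2); rewrite mulrN; have := le_trans K1 K2; set u := _ / N * (_ - _); lra.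
have K7 : c * f x * x ^+ 2 <= s * m * M `^ (m - 1) * f x.
  apply: (@le_trans _ _ (s * m * f x `^ m)).
    have : c * f x * x * x <= - z x * x by rewrite ler_pM2r.
    by rewrite expr2; lra.
  by rewrite (wE Xx) [f x * _]mulrC mulrA ler_pM2r ?(f0 Xx)// ler_pM2l ?fm1M// mulr_gt0.
have : c * x ^+ 2 <= s * m * M `^ (m - 1).
  by rewrite -(ler_pM2r (f0 Xx)); apply: le_trans K7; rewrite le_eqVlt; apply/orP; left; apply/eqP; ring.
have : c * y ^+ 2 <= c * x ^+ 2.
  by rewrite ler_pM2l// lerXn2r// nnegrE ltW.
lra.
Qed.

Let z_le0 x : X0 <= x -> Y x <= 0 -> z x <= 0.
Proof.
move=> Xx Yx; rewrite -(pmulr_rle0 _ (x_gt0 Xx)).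
have : 0 < s * m * f x `^ m by rewrite mulr_gt0 ?(w0 Xx)// mulr_gt0.
by move: Yx; rewrite /tail_sgn; lra.
Qed.

(** The flux gives z <= -c f (x - x1). Dividing by f, the derivative of f^(m-1) is at most a
    negative multiple of x - x1, so f would vanish at a finite distance: the opposite of its
    positivity. *)
Lemma no_decreasing_below x1 e : 0 < e -> X0 <= x1 ->
  ~ (forall x, x1 <= x -> Y x <= 0 /\ v x `^ (p - 1) <= k - e).
Proof.
move=> e0 Xx1 H; have x10 := x_gt0 Xx1.
have zle x : x1 <= x -> z x <= 0.
  by move=> x1x; apply: z_le0; [exact: le_trans x1x|exact: (H _ x1x).1].
pose c := e / N.
have c0 : 0 < c by rewrite divr_gt0.
have zup x : x1 <= x -> z x <= - (c * f x * (x - x1)).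
  move=> x1x; have Xx := le_trans Xx1 x1x; have x0 := x_gt0 Xx.
  have xn0 : 0 < x ^+ n by rewrite exprn_gt0.
  rewrite -(ler_pM2l xn0).
  have := @flux_upper x1 x (- (e * f x)) Xx1 x1x.
  have -> : - (e * f x) / N = - (c * f x) by rewrite /c; ring.
  move=> K; apply: le_trans (K _) _.
    move=> t /andP[x1t tx]; have Xt : X0 <= t by rewrite (le_trans Xx1)// ltW.
    have [Yt Ut] := H _ (ltW x1t).
    have ft : f x <= f t.
      apply: f_anti => //; first exact: ltW.
      by move=> r /andP[tr _]; apply: zle; rewrite ltW// (lt_trans x1t).
    apply: (@le_trans _ _ (f t * - e)); last by rewrite mulrN lerN2 mulrC ler_pM2r.
    by rewrite ler_pM2l ?(f0 Xt)//; have := Y_coef_le0 Xt Yt; lra.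
  have h1 : x1 ^+ n * z x1 <= 0 by rewrite mulr_ge0_le0 ?zle// exprn_ge0// ltW.
  have h2 := pow_split (ltW x10) x1x.
  have h3 : c * f x * x1 ^+ n.+1 <= c * f x * (x1 * x ^+ n).
    by rewrite ler_pM2l ?mulr_gt0 ?(f0 Xx).
  rewrite [x ^+ n.+1]exprS; set u := c * f x in h3 *; lra.
(* The derivative of f^(m-1) is ((m-1)/m) z / f, and the one of c2 (x - x1)^2 is ((m-1)/m) c (x -
   x1). *)
pose c2 := (m - 1) / m * c / 2.
have c20 : 0 < c2 by rewrite divr_gt0// mulr_gt0// divr_gt0.
have D t : x1 <= t -> is_derive t 1 (fun t => - (f t `^ (m - 1) + c2 * (t - x1) ^+ 2))
    (- ((m - 1) * z t / (m * f t) + c2 * (2 * (t - x1)))).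
  move=> x1t; have Xt := le_trans Xx1 x1t.
  apply: (is_derive_eq (is_deriveN1 (is_deriveD1 (is_derive_powR (m - 1) (f0 Xt) (ode_df (ode Xt)))
    (is_deriveMl c2 (is_derive_sqr
      (is_deriveB1 (is_derive_idn t) (is_derive_cstn x1 t))))))).
  have E1 : f t `^ (m - 1 - 1) = f t `^ (m - 1) / f t.
    by rewrite powRB ?powRr1 ?(ltW (f0 Xt))//; apply/implyP; rewrite (lt0r_neq0 (f0 Xt)).
  rewrite E1 (wE Xt); field.
  by rewrite !lt0r_neq0 ?powR_gt0 ?(f0 Xt).
have [y y0 Hy] := big_square (f x1 `^ (m - 1)) c20.
have x1y : x1 <= x1 + y by rewrite lerDl.
have := @nondecr_seg _ (fun t => - (f t `^ (m - 1) + c2 * (t - x1) ^+ 2)) x1 (x1 + y) x1y.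
rewrite subrr expr0n mulr0 addr0 [x1 + y - x1]addrAC subrr add0r.
have := powR_ge0 (f (x1 + y)) (m - 1).
suff : - f x1 `^ (m - 1) <= - (f (x1 + y) `^ (m - 1) + c2 * y ^+ 2) -> False.
  move=> F _ h'; apply: F; apply: h' => t /andP[x1t _].
    exact: is_derive_continuous (D _ x1t).
  have Xt : X0 <= t by rewrite (le_trans Xx1)// ltW.
  eexists; first exact: D (ltW x1t).
  have ft := f0 Xt; have := zup _ (ltW x1t).
  have K0 : 0 < (m - 1) / (m * f t) by rewrite divr_gt0// mulr_gt0.
  rewrite -(ler_pM2l K0) => K; rewrite oppr_ge0.
  have -> : (m - 1) * z t / (m * f t) = (m - 1) / (m * f t) * z t by ring.
  apply: (@le_trans _ _ ((m - 1) / (m * f t) * - (c * f t * (t - x1)) + c2 * (2 * (t - x1)))).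
    by rewrite lerD2r.
  rewrite le_eqVlt; apply/orP; left; apply/eqP; rewrite /c2; field.
  by rewrite !lt0r_neq0.
have := powR_ge0 (f (x1 + y)) (m - 1); lra.
Qed.

Let no_log_bound q C x3 : 0 < q -> X0 <= x3 ->
  ~ (forall x, x3 <= x -> q * ln x <= C).
Proof.
move=> q0 Xx3 H.
have := H (Num.max x3 (expR ((C + 1) / q))); rewrite le_max lexx => /(_ isT).
have h : (C + 1) / q <= ln (Num.max x3 (expR ((C + 1) / q))).
  rewrite -[X in X <= _]expRK ler_ln ?posrE ?expR_gt0 ?lt_max ?expR_gt0 ?orbT//.
  by rewrite le_max lexx orbT.
move: h; rewrite -(ler_pM2l q0) mulrCA divff ?mulr1 ?lt0r_neq0//; lra.
Qed.

Local Notation G := (tail_energy n m p sigma f z).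

Let dG t : X0 <= t -> is_derive t 1 G (- (v t / t) * ((v t `^ (p - 1) - k) +
     (N - s) * (s - 2) * f t `^ (m - 1) / t ^+ 2)).
Proof. by move=> Xt; exact: tail_energy_derive (x_gt0 Xt) (ode Xt). Qed.

Let dln t q : X0 <= t -> is_derive t 1 (fun t => q * ln t) (q * t^-1).
Proof. by move=> Xt; apply: is_deriveMl; apply: is_derive1_ln; exact: x_gt0. Qed.

Let G_E t : X0 <= t ->
  G t = beta * v t - v t * ((N - s) * f t `^ (m - 1) / t ^+ 2) - t `^ s * (z t / t).
Proof.
move=> Xt; rewrite /tail_energy (wE Xt) /tail; ring.
Qed.

(** Since v is bounded below, the energy G decreases at rate at least q/x, hence like -q ln x. But Y
    <= 0 forces z <= 0, which keeps G above -v x2. *)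
Lemma no_decreasing_above x1 e : 0 < e -> X0 <= x1 ->
  ~ (forall x, x1 <= x -> Y x <= 0 /\ k + e <= v x `^ (p - 1)).
Proof.
move=> e0 Xx1 H; have e20 : 0 < e / 2 by lra.
have [X1 _ HX1] := small_correction ((N - s) * (s - 2)) e20.
have [X2 _ HX2] := small_correction (N - s) ltr01.
pose x2 := Num.max x1 (Num.max X1 X2).
have [x12 X1x2 X2x2] : [/\ x1 <= x2, X1 <= x2 & X2 <= x2].
  by rewrite /x2 !le_max !lexx !orbT.
have Xx2 := le_trans Xx1 x12.
pose c := k `^ (1 / (p - 1)).
have k0 : 0 < k by rewrite divr_gt0.
have c0 : 0 < c by rewrite powR_gt0.
have cv x : x1 <= x -> c <= v x.
  move=> x1x; have Xx := le_trans Xx1 x1x; have [_ Ux] := H _ x1x.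
  have -> : v x = (v x `^ (p - 1)) `^ (1 / (p - 1)).
    by rewrite -powRrM mulrC divfK ?powRr1 ?(ltW (v0 Xx))// lt0r_neq0.
  by apply: ge0_ler_powR; rewrite ?nnegrE ?powR_ge0 ?(ltW k0)//; lra.
have vle x : x2 <= x -> v x <= v x2.
  move=> x2x; apply: tail_nonincr => // t /andP[x2t _].
  by apply: (H _ _).1; rewrite (le_trans x12)// ltW.
pose q := c * (e / 2).
have q0 : 0 < q by rewrite mulr_gt0.
apply: (@no_log_bound q (G x2 + q * ln x2 + v x2) x2 q0 Xx2) => x x2x.
have Xx := le_trans Xx2 x2x.
have dGq t : X0 <= t -> is_derive t 1 (fun t => - (G t + q * ln t))
   (- (- (v t / t) * ((v t `^ (p - 1) - k) + (N - s) * (s - 2) * f t `^ (m - 1) / t ^+ 2)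
     + q * t^-1)).
  by move=> Xt; exact: is_deriveN1 (is_deriveD1 (dG Xt) (dln q Xt)).
have : G x + q * ln x <= G x2 + q * ln x2.
  rewrite -lerN2; apply: (@nondecr_seg _ (fun t => - (G t + q * ln t))) => // t /andP[x2t tx].
    exact: is_derive_continuous (dGq _ (le_trans Xx2 x2t)).
  have Xt : X0 <= t by rewrite (le_trans Xx2)// ltW.
  have x1t : x1 <= t by rewrite (le_trans x12)// ltW.
  eexists; first exact: dGq.
  set r := _ - k + _; have rge : e / 2 <= r.
    have [_ Ut] := H _ x1t; rewrite /r.
    have := HX1 _ (le_trans X1x2 (ltW x2t)); rewrite ler_norml => /andP[+ _]; lra.
  have -> : - (- (v t / t) * r + q * t^-1) = (v t * r - q) / t by ring.
  rewrite divr_ge0 ?(ltW (x_gt0 Xt))// subr_ge0; apply: ler_pM => //.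
  - exact: ltW.
  - by rewrite ltW.
  exact: cv.
suff : - v x2 <= G x by lra.
have zx : z x <= 0 by apply: z_le0 => //; apply: (H _ _).1; exact: le_trans x2x.
rewrite (G_E Xx).
have h1 : 0 <= beta * v x by rewrite mulr_ge0 ?(ltW (v0 Xx)) ?ltW.
have h2 : x `^ s * (z x / x) <= 0.
  by rewrite mulr_ge0_le0 ?powR_ge0// mulr_le0_ge0// invr_ge0 ltW// x_gt0.
have h3 : v x * ((N - s) * f x `^ (m - 1) / x ^+ 2) <= v x * 1.
  rewrite ler_pM2l ?(v0 Xx)//; have := HX2 _ (le_trans X2x2 x2x).
  by rewrite ler_norml => /andP[].
have := vle _ x2x; lra.
Qed.

(** Now G grows at least like q ln x with q proportional to v x2, while Y >= 0 bounds -z from above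
    by s m f^m / x and so keeps G bounded. *)
Lemma no_increasing_below x1 e : 0 < e -> X0 <= x1 ->
  ~ (forall x, x1 <= x -> 0 <= Y x /\ v x `^ (p - 1) <= k - e).
Proof.
move=> e0 Xx1 H; have e20 : 0 < e / 2 by lra.
have [X1 _ HX1] := small_correction ((N - s) * (s - 2)) e20.
have [X2 _ HX2] := small_correction (N - s) ltr01.
have [X3 _ HX3] := small_correction (s * m) ltr01.
pose x2 := Num.max x1 (Num.max X1 (Num.max X2 X3)).
have [x12 X1x2 X2x2 X3x2] : [/\ x1 <= x2, X1 <= x2, X2 <= x2 & X3 <= x2].
  by rewrite /x2 !le_max !lexx !orbT.
have Xx2 := le_trans Xx1 x12.
pose c := k `^ (1 / (p - 1)).
have k0 : 0 < k by rewrite divr_gt0.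
have vc x : x1 <= x -> v x <= c.
  move=> x1x; have Xx := le_trans Xx1 x1x; have [_ Ux] := H _ x1x.
  have -> : v x = (v x `^ (p - 1)) `^ (1 / (p - 1)).
    by rewrite -powRrM mulrC divfK ?powRr1 ?(ltW (v0 Xx))// lt0r_neq0.
  by apply: ge0_ler_powR; rewrite ?nnegrE ?powR_ge0 ?(ltW k0)//; lra.
have vge x : x2 <= x -> v x2 <= v x.
  move=> x2x; apply: tail_nondecr => // t /andP[x2t _].
  by apply: (H _ _).1; rewrite (le_trans x12)// ltW.
pose q := v x2 * (e / 2).
have q0 : 0 < q by rewrite mulr_gt0// v0.
apply: (@no_log_bound q (beta * c + 2 * c - (G x2 - q * ln x2)) x2 q0 Xx2) => x x2x.
have Xx := le_trans Xx2 x2x; have x0 := x_gt0 Xx.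
have dGq t : X0 <= t -> is_derive t 1 (fun t => G t - q * ln t)
   (- (v t / t) * ((v t `^ (p - 1) - k) + (N - s) * (s - 2) * f t `^ (m - 1) / t ^+ 2)
     - q * t^-1).
  by move=> Xt; exact: is_deriveB1 (dG Xt) (dln q Xt).
have : G x2 - q * ln x2 <= G x - q * ln x.
  apply: (@nondecr_seg _ (fun t => G t - q * ln t)) => // t /andP[x2t tx].
    exact: is_derive_continuous (dGq _ (le_trans Xx2 x2t)).
  have Xt : X0 <= t by rewrite (le_trans Xx2)// ltW.
  have x1t : x1 <= t by rewrite (le_trans x12)// ltW.
  eexists; first exact: dGq.
  set r := _ - k + _; have rge : e / 2 <= - r.
    have [_ Ut] := H _ x1t; rewrite /r.
    have := HX1 _ (le_trans X1x2 (ltW x2t)); rewrite ler_norml => /andP[_]; lra.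
  have -> : - (v t / t) * r - q * t^-1 = (v t * (- r) - q) / t by ring.
  rewrite divr_ge0 ?(ltW (x_gt0 Xt))// subr_ge0; apply: ler_pM => //.
  - by rewrite ltW// v0.
  - by rewrite ltW.
  by apply: vge; exact: ltW.
suff : G x <= beta * c + 2 * c by lra.
have x1x := le_trans x12 x2x.
have Yx : 0 <= Y x := (H _ x1x).1.
rewrite (G_E Xx).
have h1 : beta * v x <= beta * c by rewrite ler_pM2l// vc.
have h2 : - (x `^ s * (z x / x)) <= v x * (s * m * f x `^ (m - 1) / x ^+ 2).
  have -> : - (x `^ s * (z x / x)) = x `^ s / x ^+ 2 * - (x * z x).
    by field; rewrite lt0r_neq0.
  have -> : v x * (s * m * f x `^ (m - 1) / x ^+ 2) = x `^ s / x ^+ 2 * (s * m * f x `^ m).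
    by rewrite (wE Xx) /tail; field; rewrite !lt0r_neq0.
  rewrite ler_pM2l; last by rewrite divr_gt0 ?powR_gt0 ?exprn_gt0.
  by move: Yx; rewrite /tail_sgn; lra.
have h3 : - (v x * 1) <= v x * ((N - s) * f x `^ (m - 1) / x ^+ 2).
  rewrite -mulrN ler_pM2l ?(v0 Xx)//; have := HX2 _ (le_trans X2x2 x2x).
  by rewrite ler_norml => /andP[].
have h4 : v x * (s * m * f x `^ (m - 1) / x ^+ 2) <= v x * 1.
  rewrite ler_pM2l ?(v0 Xx)//; have := HX3 _ (le_trans X3x2 x2x).
  by rewrite ler_norml => /andP[].
have := vc _ x1x; lra.
Qed.

Let cstar_powR : cstar p `^ (p - 1) = k.
Proof.
rewrite /cstar -powRrM divfK ?lt0r_neq0// powRr1// ltW// divr_gt0//.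
Qed.

Let cv x : X0 <= x -> {for x, continuous v}.
Proof. by move/dv/is_derive_continuous. Qed.

(** Far out, v > c1 forces Y < 0, for otherwise v would increase forever above [cstar]. It cannot
    decrease forever above c1 either, so it reaches c1; after a last crossing of c1 it would have to
    be nonincreasing, so it never exceeds c1 again. *)
Lemma tail_eventually_le c1 : cstar p < c1 ->
  exists2 X, X0 <= X & forall x, X <= x -> v x <= c1.
Proof.
move=> cc1; have c10 : 0 < c1 by apply: le_lt_trans cc1; exact: powR_ge0.
pose e := c1 `^ (p - 1) - k.
have e0 : 0 < e.
  rewrite subr_gt0 -cstar_powR; apply: gt0_ltr_powR => //; rewrite nnegrE ?powR_ge0//.
  exact: ltW.
have Ue x : X0 <= x -> c1 < v x -> k + e <= v x `^ (p - 1).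
  move=> Xx /ltW c1v; rewrite addrC subrK; apply: ge0_ler_powR => //; first exact: ltW.
    by rewrite nnegrE ltW.
  by rewrite nnegrE ltW// v0.
have [X1 X01 HX1] := tail_increasing_region e0.
have Yneg x : X1 <= x -> c1 < v x -> Y x < 0.
  move=> X1x c1v; have Xx := le_trans X01 X1x; rewrite ltNge; apply/negP => Yx.
  apply: (@no_increasing_above x e e0 Xx) => t; rewrite le_eqVlt => /predU1P[<-|xt].
    by split=> //; exact: Ue.
  have [Yt Ut] := HX1 _ X1x (Ue _ Xx c1v) Yx _ xt; split=> //; exact: ltW.
have [[x2 [X1x2 v2]]|nx] := pselect (exists x, X1 <= x /\ v x <= c1); last first.
  have above x : X1 <= x -> c1 < v x.
    by move=> X1x; rewrite ltNge; apply/negP => vx; apply: nx; exists x.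
  exfalso; apply: (@no_decreasing_above X1 e e0 X01) => x X1x; split.
    by apply/ltW/Yneg => //; exact: above.
  by apply: Ue; [exact: le_trans X1x|exact: above].
exists x2; first exact: le_trans X1x2.
move=> x x2x; rewrite leNgt; apply/negP => c1v.
have Xt t : x2 <= t -> X0 <= t by move=> x2t; rewrite (le_trans X01)// (le_trans X1x2).
have [|||c [/andP[x2c cx] vc pos]] := @last_zero _ (fun t => v t - c1) x2 x x2x.
- by move=> t /andP[x2t _]; apply: cvgB; [exact/cv/Xt|exact: cvg_cst].
- by rewrite subr_le0.
- by rewrite subr_gt0.
have : v x <= v c.
  apply: tail_nonincr; [exact: Xt|exact: ltW|].
  move=> t /andP[ct tx]; apply/ltW/Yneg.
    by rewrite (le_trans X1x2)// (le_trans x2c)// ltW.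
  by rewrite -subr_gt0; apply: pos; rewrite ct ltW.
by move: vc c1v; lra.
Qed.

Lemma tail_eventually_ge c2 : 0 < c2 -> c2 < cstar p ->
  exists2 X, X0 <= X & forall x, X <= x -> c2 <= v x.
Proof.
move=> c20 cc2.
pose e := k - c2 `^ (p - 1).
have e0 : 0 < e.
  rewrite subr_gt0 -cstar_powR; apply: gt0_ltr_powR => //; rewrite nnegrE ?powR_ge0//.
  exact: ltW.
have Ue x : X0 <= x -> v x < c2 -> v x `^ (p - 1) <= k - e.
  have -> : k - e = c2 `^ (p - 1) by rewrite /e; ring.
  move=> Xx /ltW c1v; apply: ge0_ler_powR => //; first exact: ltW.
    by rewrite nnegrE ltW// v0.
  by rewrite nnegrE ltW.
have [X1 X01 HX1] := tail_decreasing_region e0.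
have Ypos x : X1 <= x -> v x < c2 -> 0 < Y x.
  move=> X1x c1v; have Xx := le_trans X01 X1x; rewrite ltNge; apply/negP => Yx.
  apply: (@no_decreasing_below x e e0 Xx) => t; rewrite le_eqVlt => /predU1P[<-|xt].
    by split=> //; exact: Ue.
  have [Yt Ut] := HX1 _ X1x (Ue _ Xx c1v) Yx _ xt; split=> //; exact: ltW.
have [[x2 [X1x2 v2]]|nx] := pselect (exists x, X1 <= x /\ c2 <= v x); last first.
  have below x : X1 <= x -> v x < c2.
    by move=> X1x; rewrite ltNge; apply/negP => vx; apply: nx; exists x.
  exfalso; apply: (@no_increasing_below X1 e e0 X01) => x X1x; split.
    by apply/ltW/Ypos => //; exact: below.
  by apply: Ue; [exact: le_trans X1x|exact: below].
exists x2; first exact: le_trans X1x2.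
move=> x x2x; rewrite leNgt; apply/negP => c1v.
have Xt t : x2 <= t -> X0 <= t by move=> x2t; rewrite (le_trans X01)// (le_trans X1x2).
have [|||c [/andP[x2c cx] vc pos]] := @last_zero _ (fun t => c2 - v t) x2 x x2x.
- by move=> t /andP[x2t _]; apply: cvgB; [exact: cvg_cst|exact/cv/Xt].
- by rewrite subr_le0.
- by rewrite subr_gt0.
have : v c <= v x.
  apply: tail_nondecr; [exact: Xt|exact: ltW|].
  move=> t /andP[ct tx]; apply/ltW/Ypos.
    by rewrite (le_trans X1x2)// (le_trans x2c)// ltW.
  by rewrite -subr_gt0; apply: pos; rewrite ct ltW.
by move: vc c1v; lra.
Qed.

Lemma bounded_positive_decay : has_cstar_decay p sigma f.
Proof.
apply/cvgrPdist_le => e e0.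
have c0 : 0 < cstar p by rewrite powR_gt0// divr_gt0.
have [|X1 _ H1] := @tail_eventually_le (cstar p + e); first by rewrite ltrDl.
(* The maximum keeps the level positive when [e] is large. *)
have [||X2 _ H2] := @tail_eventually_ge (Num.max (cstar p / 2) (cstar p - e)).
- by rewrite lt_max (divr_gt0 c0).
- by rewrite gt_max; apply/andP; split; lra.
near=> x.
have x1 : X1 <= x by near: x; apply: nbhs_pinfty_ge; exact: num_real.
have x2 : X2 <= x by near: x; apply: nbhs_pinfty_ge; exact: num_real.
have := H1 _ x1; have := H2 _ x2; rewrite ge_max => /andP[_] h1 h2.
by rewrite distrC ler_norml; apply/andP; move: h1 h2; rewrite /tail; split; lra.
Unshelve. all: by end_near. Qed.

End tail_behaviour.

(** * Positivity of profiles and decay of bounded profiles *)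

Section profile_positivity.
Context {R : realType}.
Variables (n : nat) (m p sigma : R).
Hypotheses (p1 : 1 < p) (pm : p < m) (sigma0 : 0 < sigma).

Local Notation N := (n.+1%:R : R).
Local Notation alpha := (ss_alpha m p sigma).
Local Notation beta := (ss_beta m p sigma).

(** Even extension turns one-sided continuity at 0 into ordinary continuity, so that the lemmas on
    the whole line apply. *)
Lemma half_line_abs_continuous (g : R -> R) :
  {within `[0, +oo[, continuous g} -> continuous (fun x : R => g `|x|).
Proof.
move=> /(continuous_within_itvcyP 0 g) [cg g0] x.
have [->|x0] := eqVneq x 0.
  apply/cvgrPdist_lt => e e0; rewrite normr0.
  have /cvgrPdist_lt /(_ _ e0) [d /= d0 H] := g0.
  exists d => // y; rewrite /ball_ /= sub0r normrN => yd.
  have [->|y0] := eqVneq y 0; first by rewrite normr0 subrr normr0.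
  by apply: H; rewrite /= ?normr_gt0// sub0r normrN normr_id.
apply: (@continuous_comp _ _ _ (fun x : R => `|x|) g); first exact: norm_continuous.
by apply: cg; rewrite in_itv /= andbT normr_gt0.
Qed.

Lemma profile_ode_at (f dfm : R -> R) x :
  self_similar_profile n.+1 m p sigma f ->
  is_half_line_derive (fun t => f t `^ m) dfm ->
  0 < x -> 0 < f x -> ode_at n m p sigma 1 f dfm x.
Proof.
move=> prf [_ dw] x0 f0.
have [df _ ddw] := profile_classical prf x0 f0.
rewrite /profile_ode; set fm := fun t => f t `^ m => eqn.
have D1 : is_derive x 1 f (f^`()%classic x) by exact: DeriveDef df (esym (derive1E f x)).
have fmE t : 0 < t -> fm^`()%classic t = dfm t.
  by move=> t0; rewrite derive1E; have [_] := dw _ t0.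
have f'E : f^`()%classic x = f x * dfm x / (m * f x `^ m).
  have -> : dfm x = m * f x `^ (m - 1) * f^`()%classic x.
    exact: is_derive_unique (dw _ x0) (is_derive_powR m f0 D1).
  have <- : f x * f x `^ (m - 1) = f x `^ m by rewrite mulr_powRB1 ?(ltW f0)//; move: p1 pm; lra.
  by field; rewrite !lt0r_neq0 ?powR_gt0//; move: p1 pm; lra.
have D3 : is_derive x 1 dfm (fm^`()^`()%classic x).
  have : is_derive x 1 (fm^`()%classic) (fm^`()^`()%classic x).
    exact: DeriveDef ddw (esym (derive1E _ x)).
  apply: is_derive_near; near=> t; apply: fmE; near: t; exact: near_gt.
split; [exact: f0|by rewrite -f'E|].
apply: (is_derive_eq D3); move: eqn; rewrite f'E fmE// mul1r; lra.
Unshelve. all: by end_near. Qed.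

(** Just before a first zero c, f is so small that absorption loses against (alpha + beta N) f, and
    Q is nonincreasing. As f and (f^m)' both vanish at c, Q c = 0, so Q >= 0 before c and (f^m)' >=
    beta x f > 0 there: f increases towards its zero, which is absurd. *)
Lemma profile_pos_right (f : R -> R) x1 x2 :
  self_similar_profile n.+1 m p sigma f ->
  0 <= x1 -> x1 <= x2 -> 0 < f x1 -> 0 < f x2.
Proof.
move=> prf x10 x12 fx1; rewrite ltNge; apply/negP => fx2.
have [dfm [hd cdfm _ dfm0]] := profile_C1 prf.
have cf := half_line_abs_continuous (profile_continuous prf).
have cd := half_line_abs_continuous cdfm.
have [|||c [/andP[x1c cx2] fc pos]] := @first_zero _ (fun x => f `|x|) x1 x2 x12.
- by move=> x _; exact: cf.
- by rewrite ger0_norm.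
- by rewrite ger0_norm// (le_trans x10).
have c0 : 0 < c := le_lt_trans x10 x1c.
have fpos t : x1 <= t < c -> 0 < f t.
  by move=> /andP[x1t tc]; have := pos t; rewrite x1t tc ger0_norm ?(le_trans x10)//; exact.
rewrite (gtr0_norm c0) in fc.
have al0 := ss_alpha_gt0 p1 pm sigma0; have be0 := ss_beta_gt0 p1 pm sigma0.
have N0 : 0 < N by rewrite ltr0n.
(* The value at which c^sigma eta^(p-1) = alpha + beta N, that is, where Q' changes sign at x =
   c. *)
pose eta := ((alpha + beta * N) / c `^ sigma) `^ (1 / (p - 1)).
have q0 : 0 < (alpha + beta * N) / c `^ sigma.
  by rewrite divr_gt0 ?powR_gt0// addr_gt0// mulr_gt0.
have eta0 : 0 < eta by rewrite powR_gt0.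
have p10 : 0 < p - 1 by move: p1; lra.
have [a [x1a ac fsmall]] : exists a, [/\ x1 < a, a < c & forall t, a < t < c -> f t <= eta].
  have /cvgrPdist_lt /(_ _ eta0) [e /= e0 He] := cf c.
  exists (Num.max ((x1 + c) / 2) (c - e / 2)); split.
  - by rewrite lt_max; apply/orP; left; lra.
  - by rewrite gt_max; apply/andP; split; lra.
  move=> t /andP[]; rewrite gt_max => /andP[t1 t2 tc].
  have t0 : 0 < t by lra.
  have ct : 0 < c - t by lra.
  have := He t; rewrite /= (gtr0_norm c0) fc sub0r normrN (gtr0_norm ct) (gtr0_norm t0).
  have -> : c - t < e by lra.
  by move=> /(_ isT); rewrite ltr_norml => /andP[_ /ltW].
have a0 : 0 < a := le_lt_trans x10 x1a.
pose Q t := t ^+ n * dfm t - beta * (t ^+ n.+1 * f t).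
pose Qa t := t ^+ n * dfm `|t| - beta * (t ^+ n.+1 * f `|t|).
have QE t : 0 <= t -> Q t = Qa t by move=> t0; rewrite /Q /Qa ger0_norm.
have cQ : continuous Qa.
  have cpow j : continuous (fun t : R => t ^+ j).
    by move=> t; exact: is_derive_continuous (is_deriveXn j t).
  move=> t; apply: cvgB; first by apply: cvgM; [exact: cpow|exact: cd].
  by apply: cvgM; [exact: cvg_cst|apply: cvgM; [exact: cpow|exact: cf]].
have ode t : a < t < c -> ode_at n m p sigma 1 f dfm t.
  move=> /andP[at_ tc]; apply: profile_ode_at => //; first exact: lt_trans at_.
  by apply: fpos; rewrite tc andbT ltW// (lt_trans x1a).
have dQa t : a < t < c -> is_derive t 1 Qa
   (t ^+ n * (1 * t `^ sigma * f t `^ p - (alpha + beta * N) * f t)).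
  move=> tac; have t0 : 0 < t by case/andP: tac => h _; exact: lt_trans h.
  apply: is_derive_near (ode_dQ t0 (ode _ tac)); near=> r.
  by rewrite -/(Q r) QE// ltW//; near: r; exact: near_gt.
have Qneg t : a <= t -> t <= c -> Qa c <= Qa t.
  move=> at_ tc; rewrite -lerN2; apply: (@nondecr_seg _ (fun r => - Qa r) t c tc) => [r _|r /andP[tr rc]].
    by apply: cvgN; exact: cQ.
  have rac : a < r < c by rewrite rc (le_lt_trans at_).
  have r0 : 0 < r by rewrite (lt_trans a0)// (le_lt_trans at_).
  eexists; first exact: is_deriveN1 (dQa _ rac).
  have fr := ode_pos (ode _ rac).
  rewrite -mulrN mulr_ge0 ?exprn_ge0 ?(ltW r0)// opprB subr_ge0 mul1r.
  have -> : f r `^ p = f r * f r `^ (p - 1) by rewrite mulr_powRB1 ?(ltW fr)//; move: p1; lra.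
  rewrite mulrCA mulrC ler_pM2r//.
  have h1 : f r `^ (p - 1) <= (alpha + beta * N) / c `^ sigma.
    have <- : eta `^ (p - 1) = (alpha + beta * N) / c `^ sigma.
      by rewrite /eta -powRrM divfK ?powRr1 ?(ltW q0)// lt0r_neq0.
    by apply: ge0_ler_powR; rewrite ?nnegrE ?(ltW p10) ?(ltW fr) ?(ltW eta0) ?fsmall.
  have h2 : r `^ sigma <= c `^ sigma.
    by apply: ge0_ler_powR; rewrite ?nnegrE ?(ltW sigma0) ?(ltW r0) ?(ltW c0) ?(ltW rc).
  apply: (le_trans (ler_pM _ _ h2 h1)); rewrite ?powR_ge0//.
  by rewrite mulrCA divff ?mulr1// lt0r_neq0// powR_gt0.
have Qc : Qa c = 0.
  by rewrite /Qa (gtr0_norm c0) fc dfm0 ?(ltW c0)// !mulr0 subr0.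
have : f `|a| <= f `|c|.
  apply: (@nondecr_seg _ (fun t => f `|t|)) => [|t _|t tac]; [exact: ltW|exact: cf|].
  have t0 : 0 < t by case/andP: tac => h _; exact: lt_trans h.
  have ft := ode_pos (ode _ tac).
  exists (f t * dfm t / (m * f t `^ m)).
    apply: is_derive_near (ode_df (ode _ tac)); near=> r.
    by rewrite ger0_norm// ltW//; near: r; exact: near_gt.
  have m0 : 0 < m by move: p1 pm; lra.
  rewrite divr_ge0 ?mulr_ge0 ?(ltW ft) ?(ltW m0) ?powR_ge0//.
  have tn : 0 < t ^+ n by rewrite exprn_gt0.
  rewrite -(pmulr_rge0 _ tn).
  have := Qneg t; case/andP: tac => h1 h2; rewrite (ltW h1) (ltW h2) Qc => /(_ isT isT).
  rewrite -QE ?(ltW t0)// /Q.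
  have : 0 <= beta * (t ^+ n.+1 * f t).
    by rewrite mulr_ge0 ?(ltW be0)// mulr_ge0 ?(ltW ft)// exprn_ge0// ltW.
  lra.
rewrite (gtr0_norm c0) (gtr0_norm a0) fc leNgt fpos// (ltW x1a) ac//.
Unshelve. all: by end_near. Qed.

Lemma bounded_profile_decay (f : R -> R) :
  self_similar_profile n.+1 m p sigma f -> bounded_on_half_line f ->
  (exists2 xi : R, 0 <= xi & f xi <> 0) -> has_cstar_decay p sigma f.
Proof.
move=> prf [B [_ HB]] [x0 x00 fx0].
have [dfm [hd _ _ _]] := profile_C1 prf.
have fx0_gt0 : 0 < f x0.
  by rewrite lt_neqAle (profile_ge0 prf x00) andbT eq_sym; apply/eqP.
have fB x : 0 <= x -> f x <= B + 1.
  move=> xge0; apply: le_trans (ler_norm _) _; apply: (HB (B + 1) _ x).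
    by rewrite ltrDl.
  by rewrite /= in_itv /= xge0.
apply: (@bounded_positive_decay _ n m p sigma p1 pm sigma0 f dfm (x0 + 1) (B + 1)).
- by rewrite lerDr.
- move=> x xx; apply: profile_ode_at => //; first by move: xx x00; lra.
  by apply: (profile_pos_right prf x00 _ fx0_gt0); move: xx; lra.
- by move=> x xx; apply: fB; move: xx x00; lra.
Qed.

End profile_positivity.

(** * Comparison of decaying solutions *)

Section comparison.
Context {R : realType}.
Variables (n : nat) (m p sigma : R).
Implicit Types (t x y : R).
Hypotheses (p1 : 1 < p) (pm : p < m) (sigma0 : 0 < sigma).

Local Notation N := (n.+1%:R : R).
Local Notation alpha := (ss_alpha m p sigma).
Local Notation beta := (ss_beta m p sigma).
Local Notation ode_at := (ode_at n m p sigma).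

Let m0 : 0 < m. Proof. by move: p1 pm; lra. Qed.
Let m10 : 0 < m - 1. Proof. by move: p1 pm; lra. Qed.

(** The relation r^m lam^2 = r makes diffusion scale by r like the linear terms; the whole mismatch
    goes into the absorption coefficient. *)
Lemma ode_at_rescale (lam r : R) (f z : R -> R) x :
  0 < lam -> 0 < r -> r `^ m * lam ^+ 2 = r -> 0 < x -> ode_at 1 f z (lam * x) ->
  ode_at (lam `^ sigma * r `^ (1 - p))
    (fun t => r * f (lam * t)) (fun t => r `^ m * lam * z (lam * t)) x.
Proof.
move=> lam0 r0 rlam x0 [f0 df dz].
have dl : is_derive x 1 (fun t => lam * t) lam.
  by apply: (is_derive_eq (is_deriveMl lam (is_derive_idn x))); rewrite mulr1.
have w0 : 0 < f (lam * x) `^ m by exact: powR_gt0.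
have rm0 : 0 < r `^ m by exact: powR_gt0.
have fE : r * f (lam * x) * (r `^ m * lam * z (lam * x)) / (m * (r * f (lam * x)) `^ m) =
   r * (lam * (f (lam * x) * z (lam * x) / (m * f (lam * x) `^ m))).
  rewrite powRM ?(ltW r0) ?(ltW f0)//; field.
  by rewrite !lt0r_neq0.
split.
- exact: mulr_gt0.
- apply: (is_derive_eq (is_deriveMl r (is_derive1_comp (g := fun t => lam * t) df dl))).
  by rewrite fE; ring.
apply: (is_derive_eq (is_deriveMl (r `^ m * lam) (is_derive1_comp (g := fun t => lam * t) dz dl))).
rewrite fE powRM ?(ltW lam0) ?(ltW x0)// powRM ?(ltW r0) ?(ltW f0)//.
have rp : r `^ (1 - p) * r `^ p = r.
  by rewrite -powRD ?subrK ?powRr1 ?(ltW r0)//; apply/implyP; rewrite (lt0r_neq0 r0).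
have -> : lam `^ sigma * r `^ (1 - p) * x `^ sigma * (r `^ p * f (lam * x) `^ p) =
   (r `^ (1 - p) * r `^ p) * (lam `^ sigma * x `^ sigma * f (lam * x) `^ p) by ring.
rewrite rp; set F := f (lam * x) * z (lam * x) / _; set FP := f (lam * x) `^ p.
set ls := lam `^ sigma; set xs := x `^ sigma; set rm := r `^ m in rlam *.
have -> : rm * lam * ((beta * (lam * x) * F - alpha * f (lam * x) + 1 * (ls * xs) * FP -
     (N - 1) / (lam * x) * z (lam * x)) * lam) =
   (rm * lam ^+ 2) * (beta * (lam * x) * F - alpha * f (lam * x) + 1 * (ls * xs) * FP) -
     (N - 1) / x * (rm * lam * z (lam * x)).
  by field; rewrite !lt0r_neq0.
by rewrite rlam; ring.
Qed.

(** At the touching point u^m - f^m has a maximum, so zu = z. All terms of the two equations then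
    cancel except (kap - 1) x^sigma f^p > 0 in (zu - z)', so u^m - f^m would increase to the
    right. *)
Lemma no_interior_touching kap (u zu f z : R -> R) x : 1 < kap -> 0 < x ->
  (forall t, 0 < t -> ode_at kap u zu t) -> (forall t, 0 < t -> ode_at 1 f z t) ->
  (forall t, 0 < t -> u t <= f t) -> u x = f x -> False.
Proof.
move=> kap1 x0 ou of_ uf ufx.
pose g t := u t `^ m - f t `^ m.
have dg t : 0 < t -> is_derive t 1 g (zu t - z t).
  by move=> t0; exact: is_deriveB1 (ode_dw p1 pm (ou t t0)) (ode_dw p1 pm (of_ t t0)).
have gx : g x = 0 by rewrite /g ufx subrr.
have gle t : 0 < t -> g t <= 0.
  move=> t0; rewrite subr_le0; apply: ge0_ler_powR; rewrite ?nnegrE ?uf ?(ltW m0)//.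
    exact/ltW/(ode_pos (ou t t0)).
  exact/ltW/(ode_pos (of_ t t0)).
have gxge : 0 <= g x by rewrite gx.
have zx : zu x - z x = 0.
  apply/eqP; rewrite eq_le; apply/andP; split; rewrite leNgt; apply/negP => zz.
    have [e e0 He] := right_pos (dg x x0) zz gxge.
    have := He (x + e / 2); have := gle (x + e / 2); have -> : 0 < x + e / 2 by lra.
    have -> : x < x + e / 2 < x + e by apply/andP; split; lra.
    by move=> /(_ isT) h /(_ isT); lra.
  have zz' : 0 < - (zu x - z x) by lra.
  have gx' : - g x <= 0 by rewrite gx oppr0.
  have [e e0 He] := left_neg (is_deriveN1 (dg x x0)) zz' gx'.
  pose y := Num.max (x / 2) (x - e / 2).
  have [y1 y2] : x / 2 <= y /\ x - e / 2 <= y by rewrite /y !le_max !lexx orbT.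
  have y3 : y < x by rewrite /y gt_max; apply/andP; split; lra.
  have y0 : 0 < y by lra.
  have := He y; have := gle y y0; rewrite y3 andbT.
  have -> : x - e < y by lra.
  by move=> h /(_ isT); lra.
have dz := is_deriveB1 (ode_dz (ou x x0)) (ode_dz (of_ x x0)).
have zuz : zu x = z x by lra.
move: dz; rewrite ufx zuz => dz.
have fp : 0 < x `^ sigma * f x `^ p.
  by rewrite mulr_gt0 ?powR_gt0//; exact: ode_pos (of_ x x0).
have pos : 0 < (kap - 1) * (x `^ sigma * f x `^ p) by rewrite mulr_gt0// subr_gt0.
have zxge : 0 <= zu x - z x by rewrite zx.
have [|e e0 He] := right_pos dz _ zxge.
  apply: lt_le_trans pos _; rewrite le_eqVlt; apply/orP; left; apply/eqP; ring.
have : g x < g (x + e / 2).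
  apply: incr_seg => [|t /andP[xt _]|t /andP[xt te]]; first by lra.
    exact: is_derive_continuous (dg t (lt_le_trans x0 xt)).
  eexists; first exact: dg (lt_trans x0 xt).
  by apply: He; rewrite xt /=; lra.
have := gle (x + e / 2); have -> : 0 < x + e / 2 by lra.
by move=> /(_ isT); rewrite gx; lra.
Qed.

(** The equation cannot be evaluated at 0, so the difference D of the quantities Q is integrated
    from there: D' > 0 because u <= f and, by continuity, kap u^p > f^p nearby. D > 0 gives a linear
    differential inequality for g = u^m - f^m with g 0 = 0, whose integrating factor yields g >
    0. *)
Lemma no_origin_touching kap (u zu f z : R -> R) : 1 < kap ->
  continuous u -> continuous zu -> continuous f -> continuous z ->
  zu 0 = 0 -> z 0 = 0 ->
  (forall t, 0 < t -> ode_at kap u zu t) -> (forall t, 0 < t -> ode_at 1 f z t) ->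
  (forall t, 0 < t -> u t <= f t) -> 0 < u 0 -> u 0 = f 0 -> False.
Proof.
move=> kap1 cu czu cf cz zu0 z0 ou of_ uf u0 uf0.
have be0 := ss_beta_gt0 p1 pm sigma0; have al0 := ss_alpha_gt0 p1 pm sigma0.
have cpowR (g : R -> R) q t : continuous g -> 0 < g t -> {for t, continuous (fun t => g t `^ q)}.
  move=> cg gt0; apply: (@continuous_comp _ _ _ g (fun y => y `^ q)); first exact: cg.
  exact: is_derive_continuous (is_derive1_powR q gt0).
have cpow j : continuous (fun t : R => t ^+ j).
  by move=> t; exact: is_derive_continuous (is_deriveXn j t).
have [eta eta0 Heta] : exists2 eta, 0 < eta & forall t, 0 < t <= eta ->
    u 0 / 2 <= u t /\ f t `^ p < kap * u t `^ p.
  have A : \forall t \near (0 : R), u 0 / 2 <= u t.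
    have u02 : 0 < u 0 / 2 by rewrite divr_gt0.
    have := cu 0; move=> /cvgrPdist_lt /(_ _ u02); apply: filterS => t.
    by rewrite ltr_norml => /andP[_]; lra.
  have B : \forall t \near (0 : R), 0 < kap * u t `^ p - f t `^ p.
    have f0 : 0 < f 0 by rewrite -uf0.
    have c1 : {for 0, continuous (fun t => kap * u t `^ p - f t `^ p)}.
      apply: cvgB; last exact: cpowR.
      by apply: cvgM; [exact: cvg_cst|exact: cpowR].
    have pos : 0 < kap * u 0 `^ p - f 0 `^ p.
      have up : 0 < u 0 `^ p by rewrite powR_gt0.
      rewrite -uf0 -[X in _ - X]mul1r -mulrBl mulr_gt0// subr_gt0//.
    move: c1 => /cvgrPdist_lt /(_ _ pos); apply: filterS => t.
    by rewrite ltr_norml => /andP[_]; lra.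
  have [e /= e0 He] := filterI A B.
  exists (e / 2); first by rewrite divr_gt0.
  move=> t /andP[t0 te]; have := He t; rewrite /ball_ /= sub0r normrN gtr0_norm//.
  have -> : t < e by lra.
  by move=> /(_ isT)[h1 h2]; split=> //; rewrite -subr_gt0.
pose D t := t ^+ n * zu t - beta * (t ^+ n.+1 * u t) - (t ^+ n * z t - beta * (t ^+ n.+1 * f t)).
have cmono j (h : R -> R) : continuous h -> continuous (fun t => t ^+ j * h t).
  by move=> ch t; apply: cvgM; [exact: cpow|exact: ch].
have cD : continuous D.
  move=> t; apply: cvgB; (apply: cvgB; first exact: cmono);
    by apply: cvgM; [exact: cvg_cst|exact: cmono].
have D0 : D 0 = 0 by rewrite /D zu0 z0 !expr0n /= !mul0r !mulr0 !subrr.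
have Dpos t : 0 < t <= eta -> 0 < D t.
  move=> /andP[t0 te]; rewrite -D0; apply: (@incr_seg _ D 0 t t0) => [r _|r /andP[r0 rt]].
    exact: cD.
  have reta : 0 < r <= eta by rewrite r0 ltW// (lt_le_trans rt).
  eexists; first exact: is_deriveB1 (ode_dQ r0 (ou r r0)) (ode_dQ r0 (of_ r r0)).
  have [_ Hp] := Heta _ reta; have ufr := uf _ r0.
  rewrite -mulrBr mulr_gt0 ?exprn_gt0//.
  have rs : 0 < r `^ sigma by rewrite powR_gt0.
  have h1 : 0 < r `^ sigma * (kap * u r `^ p - f r `^ p) by rewrite mulr_gt0// subr_gt0.
  have h2 : 0 <= (alpha + beta * N) * (f r - u r).
    by rewrite mulr_ge0 ?subr_ge0// addr_ge0 ?(ltW al0)// mulr_ge0// ltW.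
  lra.
(* A lower bound for u^(m-1) near 0; it gives f^m - u^m >= C (f - u). *)
pose C := (u 0 / 2) `^ (m - 1).
have C0 : 0 < C by rewrite powR_gt0// divr_gt0.
pose g t := u t `^ m - f t `^ m.
have ug t : 0 < t <= eta -> g t / C <= u t - f t.
  move=> te; have [ut _] := Heta t te; have /andP[t0 _] := te.
  have uft := uf _ t0; have ut0 : 0 < u t by have := u0; lra.
  have ft0 : 0 < f t := lt_le_trans ut0 uft.
  rewrite ler_pdivrMr//.
  have K1 : C <= u t `^ (m - 1).
    by apply: ge0_ler_powR; rewrite ?nnegrE ?(ltW m10) ?(ltW ut0)// divr_ge0 ?(ltW u0).
  have K2 : u t `^ (m - 1) <= f t `^ (m - 1).
    by apply: ge0_ler_powR; rewrite ?nnegrE ?(ltW m10) ?(ltW ut0) ?(ltW ft0).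
  rewrite /g -(mulr_powRB1 (ltW ut0) m0) -(mulr_powRB1 (ltW ft0) m0).
  have h1 : 0 <= (f t - u t) * (u t `^ (m - 1) - C) by rewrite mulr_ge0// subr_ge0.
  have h2 : 0 <= f t * (f t `^ (m - 1) - u t `^ (m - 1)) by rewrite mulr_ge0 ?(ltW ft0)// subr_ge0.
  lra.
(* The exponential has logarithmic derivative -2 q t = -beta t / C, which compensates beta t (u - f)
   >= beta t g / C. *)
pose q := beta / C / 2.
pose G t := g t * expR (- (q * t ^+ 2)).
have cg t : 0 <= t <= eta -> {for t, continuous g}.
  move=> /andP[t0 te]; apply: cvgB; apply: cpowR => //.
    by move: t0; rewrite le_eqVlt => /predU1P[<-//|/ou[]].
  by move: t0; rewrite le_eqVlt => /predU1P[<-|/of_[]]//; rewrite -uf0.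
have dE t : is_derive t 1 (fun t => expR (- (q * t ^+ 2))) (expR (- (q * t ^+ 2)) * - (q * (2 * t))).
  apply: (is_derive_eq (is_derive_expR_comp (is_deriveN1 (is_deriveMl q (is_deriveXn 2 t))))).
  by rewrite /= expr1.
have : G 0 < G eta.
  apply: incr_seg => // [t teta|t /andP[t0 te]].
    by apply: cvgM; [exact: cg|exact: is_derive_continuous (dE t)].
  have teta : 0 < t <= eta by rewrite t0 ltW.
  eexists.
    exact: is_deriveM1 (is_deriveB1 (ode_dw p1 pm (ou t t0)) (ode_dw p1 pm (of_ t t0))) (dE t).
  rewrite -/(g t); set E := expR _; have E0 : 0 < E by exact: expR_gt0.
  have -> : (zu t - z t) * E + g t * (E * - (q * (2 * t))) =
     E * (zu t - z t - beta * t * (g t / C)).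
    by rewrite /q; field; rewrite lt0r_neq0.
  rewrite mulr_gt0// subr_gt0.
  apply: (@le_lt_trans _ _ (beta * t * (u t - f t))).
    by rewrite ler_pM2l ?ug// mulr_gt0.
  have tn : 0 < t ^+ n by rewrite exprn_gt0.
  rewrite -(ltr_pM2l tn); have := Dpos _ teta; rewrite /D [t ^+ n.+1]exprS; lra.
rewrite /G {1}/g uf0 subrr mul0r pmulr_lgt0 ?expR_gt0// /g subr_gt0.
have uf' := uf _ eta0.
have : u eta `^ m <= f eta `^ m.
  apply: ge0_ler_powR; rewrite ?nnegrE ?(ltW m0)//.
    exact/ltW/(ode_pos (ou _ eta0)).
  exact/ltW/(ode_pos (of_ _ eta0)).
lra.
Qed.

End comparison.

(** * Ordering of two positive solutions with the same tail *)

Section decaying_comparison.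
Context {R : realType}.
Variables (n : nat) (m p sigma : R).
Implicit Types (t x y mu : R).
Hypotheses (p1 : 1 < p) (pm : p < m) (sigma0 : 0 < sigma).

Local Notation s := (sigma / (p - 1)).
Local Notation ode_at := (ode_at n m p sigma).

Let m10 : 0 < m - 1. Proof. by move: p1 pm; lra. Qed.
Let p10 : 0 < p - 1. Proof. by move: p1; lra. Qed.
Let s0 : 0 < s. Proof. exact: divr_gt0. Qed.

(* Sliding method: t |-> lam^(-2/(m-1)) g1(lam t) is a strict subsolution for lam > 1,
   and it lies below g2 for large lam; the largest lam = exp(mu) > 1 at which it touches
   g2 contradicts the maximum principle. *)
Lemma decaying_le (g1 z1 g2 z2 : R -> R) :
  continuous g1 -> continuous z1 -> continuous g2 -> continuous z2 ->
  z1 0 = 0 -> z2 0 = 0 ->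
  (forall t, 0 <= t -> 0 < g1 t) -> (forall t, 0 <= t -> 0 < g2 t) ->
  (forall t, 0 < t -> ode_at 1 g1 z1 t) -> (forall t, 0 < t -> ode_at 1 g2 z2 t) ->
  has_cstar_decay p sigma g1 -> has_cstar_decay p sigma g2 ->
  forall x, 0 <= x -> g1 x <= g2 x.
Proof.
move=> cg1 cz1 cg2 cz2 z10 z20 g1p g2p o1 o2 d1 d2 x0 x00.
rewrite leNgt; apply/negP => g21.
pose a := 2 / (m - 1); have a0 : 0 < a by rewrite divr_gt0.
pose r mu := expR (- (a * mu)).
pose U mu x := r mu * g1 (expR mu * x).
pose F (q : R * R) := U q.1 q.2 - g2 q.2.
have cF : continuous F.
  have c1 : continuous (@fst R R) by move=> q; exact: cvg_fst.
  have c2 : continuous (@snd R R) by move=> q; exact: cvg_snd.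
  have cc (h : R -> R) (k : R * R -> R) : continuous h -> continuous k -> continuous (fun q => h (k q)).
    by move=> ch ck q; apply: (@continuous_comp _ _ _ k h); [exact: ck|exact: ch].
  have cr : continuous r.
    move=> mu; apply: (@continuous_comp _ _ _ (fun mu => - (a * mu)) expR).
      exact: is_derive_continuous (is_deriveN1 (is_deriveMl a (is_derive_idn mu))).
    exact: continuous_expR.
  have c3 := cc _ _ cr c1; have c4 := cc _ _ (@continuous_expR R) c1.
  have c5 : continuous (fun q : R * R => expR q.1 * q.2).
    by move=> q; apply: cvgM; [exact: c4|exact: c2].
  have c6 := cc _ _ cg1 c5; have c7 := cc _ _ cg2 c2.
  by move=> q; apply: cvgB; [apply: cvgM; [exact: c3|exact: c6]|exact: c7].
have cFx x : continuous (fun mu => F (mu, x)).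
  move=> mu; apply: (@continuous_comp _ _ _ (fun mu => (mu, x)) F); last exact: cF.
  exact: (cvg_pair cvg_id (cvg_cst x)).
(* The violation at [x0] survives a small dilation, which keeps the critical mu away from 0, where
   the subsolution would not be strict. *)
have [mu1 mu10 F1] : exists2 mu1, 0 < mu1 & 0 < F (mu1, x0).
  have F0 : 0 < F (0, x0).
    by rewrite /F /U /r /= mulr0 oppr0 expR0 !mul1r subr_gt0.
  have /cvgrPdist_lt /(_ _ F0) [e /= e0 He] := cFx x0 0.
  exists (e / 2); first by rewrite divr_gt0.
  have := He (e / 2); rewrite /ball_ /= sub0r normrN gtr0_norm ?divr_gt0//.
  by have -> : e / 2 < e; [lra|move=> /(_ isT); rewrite ltr_norml => /andP[_]; lra].
have c0 : 0 < cstar p by rewrite powR_gt0// divr_gt0.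
have r1 mu : 0 <= mu -> r mu <= 1.
  by move=> mu0; rewrite /r -expR0 ler_expR oppr_le0 mulr_ge0// ltW.
pose th := expR (- (s * mu1)).
have th1 : th < 1 by rewrite /th expR_lt1 oppr_lt0 mulr_gt0.
have th0 : 0 < th by exact: expR_gt0.
(* Dilation multiplies the tail by r mu exp(-s mu) <= th < 1 for mu >= mu1. This eps satisfies th
   (cstar + eps) < cstar - eps, which separates the tails of U mu and g2 uniformly in mu. *)
pose eps := cstar p * (1 - th) / 4.
have eps0 : 0 < eps by rewrite divr_gt0// mulr_gt0// subr_gt0.
have [X [X1 HX1 HX2]] : exists X, [/\ 1 <= X,
    forall x, X <= x -> x `^ s * g1 x <= cstar p + eps &
    forall x, X <= x -> cstar p - eps <= x `^ s * g2 x].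
  move: d1 => /cvgrPdist_le /(_ _ eps0) [M1 [_ H1]].
  move: d2 => /cvgrPdist_le /(_ _ eps0) [M2 [_ H2]].
  exists (Num.max 1 (Num.max (M1 + 1) (M2 + 1))); split; first by rewrite le_max lexx.
    move=> x; rewrite !ge_max => /and3P[_ xM1 _].
    by have := H1 x; rewrite (lt_le_trans _ xM1) ?ltrDl// => /(_ isT); rewrite /= ler_norml => /andP[]; lra.
  move=> x; rewrite !ge_max => /and3P[_ _ xM2].
  by have := H2 x; rewrite (lt_le_trans _ xM2) ?ltrDl// => /(_ isT); rewrite /= ler_norml => /andP[]; lra.
have X0 : 0 < X by lra.
have tail_lt mu x : mu1 <= mu -> X <= x -> U mu x < g2 x.
  move=> mumu1 Xx; have x_gt0 : 0 < x := lt_le_trans X0 Xx.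
  have mu0 : 0 < mu := lt_le_trans mu10 mumu1.
  have xs0 : 0 < x `^ s by rewrite powR_gt0.
  have lam1 : 1 <= expR mu by rewrite -expR0 ler_expR ltW.
  have lx : X <= expR mu * x by apply: le_trans Xx _; rewrite ler_peMl// ltW.
  rewrite -(ltr_pM2l xs0); apply: lt_le_trans (HX2 _ Xx).
  apply: (@le_lt_trans _ _ (th * (cstar p + eps))); last first.
    have : eps * 4 = cstar p * (1 - th) by rewrite /eps divfK.
    have : th * eps < eps by rewrite -[X in _ < X]mul1r ltr_pM2r.
    lra.
  have -> : x `^ s * U mu x = r mu * (expR (- (s * mu)) * ((expR mu * x) `^ s * g1 (expR mu * x))).
    rewrite powRM ?expR_ge0 ?(ltW x_gt0)// -expRM /U.
    have e1 : expR (- (s * mu)) * expR (mu * s) = 1.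
      by rewrite -expRD [mu * s]mulrC addNr expR0.
    by rewrite -[LHS]mul1r -[X in X * _ = _]e1; ring.
  rewrite -[X in _ <= X]mul1r; apply: ler_pM; rewrite ?expR_ge0 ?r1 ?(ltW mu0)//.
    by rewrite !mulr_ge0 ?expR_ge0 ?powR_ge0 ?(ltW (g1p _ _))// (le_trans (ltW X0)).
  apply: ler_pM; rewrite ?expR_ge0 ?HX1//.
    by rewrite mulr_ge0 ?powR_ge0 ?(ltW (g1p _ _))// (le_trans (ltW X0)).
  by rewrite ler_expR lerN2 ler_pM2l.
have [B B0 g1B] : exists2 B, 0 < B & forall x, 0 <= x -> g1 x <= B.
  have [c _ Hc] := @EVT_max _ g1 0 X (ltW X0) (continuous_subspaceT cg1).
  exists (Num.max (g1 c) (cstar p + eps)); first by rewrite lt_max (addr_gt0 c0 eps0) orbT.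
  move=> x x_ge0; rewrite le_max; have [xX|Xx] := leP x X.
    by rewrite Hc ?in_itv /= ?x_ge0.
  apply/orP; right; apply: le_trans (HX1 _ (ltW Xx)).
  rewrite ler_peMl ?(ltW (g1p _ x_ge0))//.
  rewrite -[X in X <= _](powRr0 x); apply: ler_powR; last exact: ltW.
  by rewrite (le_trans X1)// ltW.
have [b b0 g2b] : exists2 b, 0 < b & forall x, 0 <= x <= X -> b <= g2 x.
  have [c] := @EVT_min _ g2 0 X (ltW X0) (continuous_subspaceT cg2).
  rewrite in_itv /= => /andP[cge0 _] Hc; exists (g2 c); first exact: g2p.
  by move=> x xX; apply: Hc; rewrite in_itv.
(* From exp(a mu) >= 1 + a mu > B / b one gets r mu B < b. *)
pose mu0 := B / b / a.
have large mu x : mu0 <= mu -> 0 <= x <= X -> U mu x < g2 x.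
  move=> mumu0 xX; apply: lt_le_trans (g2b _ xX).
  have Bb : B / b < expR (a * mu).
    apply: (@lt_le_trans _ _ (1 + B / b)); first by rewrite ltrDr.
    apply: le_trans (expR_ge1Dx (B / b)) _; rewrite ler_expR.
    by rewrite -ler_pdivrMl// mulrC.
  apply: (@le_lt_trans _ _ (r mu * B)).
    rewrite ler_pM2l ?expR_gt0// g1B// mulr_ge0 ?expR_ge0//; by case/andP: xX.
  rewrite /r expRN mulrC ltr_pdivrMr ?expR_gt0// mulrC -ltr_pdivrMr//.
(* All violations with mu >= mu1 lie in this compact set, so a largest mu is attained; beyond it U
   mu < g2, and by continuity U mu <= g2 at it. *)
pose C := (`[mu1, mu0] `*` `[0, X]) `&` [set q | 0 <= F q].
have cptC : compact C.
  apply: compact_closedI; first by apply: compact_setX; exact: segment_compact.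
  apply: (@preimage_closed _ _ F [set y | 0 <= y]); first by move=> q _; exact: cF.
  exact: closed_ge.
have x0X : x0 <= X.
  rewrite leNgt; apply/negP => /ltW /(tail_lt mu1 x0 (lexx _)).
  by rewrite -subr_lt0 -/(F (mu1, x0)); have := F1; lra.
have mu10' : mu1 <= mu0.
  rewrite leNgt; apply/negP => /ltW /(large mu1 x0).
  by rewrite x00 x0X => /(_ isT); rewrite -subr_lt0; move: F1; rewrite /F /=; lra.
have C_ne : C !=set0.
  exists (mu1, x0); split; last by rewrite /= ltW.
  by split; rewrite /= in_itv /= ?lexx ?x00.
have cfst : {within C, continuous (@fst R R)}.
  by apply: continuous_subspaceT => q; exact: cvg_fst.
have [[mum xm]] := compact_EVT_max C_ne cptC cfst.
rewrite inE => -[[]] /=; rewrite !in_itv /= => /andP[mu1m mum0] /andP[xm0 xmX] Fm Hmax.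
have beyond mu x : mum < mu -> 0 <= x -> U mu x < g2 x.
  move=> mummu xge0; have mu1mu : mu1 <= mu by rewrite (le_trans mu1m)// ltW.
  have [xX|/ltW Xx] := leP x X; last exact: tail_lt.
  have [mu0mu|mumu0] := leP mu0 mu; first by apply: large; rewrite ?xge0.
  rewrite ltNge; apply/negP => Ug; have := Hmax (mu, x).
  rewrite inE /= leNgt mummu => /(_ _)/negP; apply; rewrite //.
  split; last by rewrite /= subr_ge0.
  by split; rewrite /= in_itv /= ?mu1mu ?xge0// ltW.
have below x : 0 <= x -> U mum x <= g2 x.
  move=> xge0; rewrite leNgt; apply/negP; rewrite -subr_gt0 => Fx.
  have /cvgrPdist_lt /(_ _ Fx) [e /= e0 He] := cFx x mum.
  have := He (mum + e / 2); rewrite /ball_ /= opprD addNKr normrN gtr0_norm ?divr_gt0//.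
  have -> : e / 2 < e by lra.
  move=> /(_ isT); rewrite ltr_norml => /andP[_]; rewrite /F /=.
  by have := beyond (mum + e / 2) x; rewrite ltrDl divr_gt0// => /(_ isT xge0); lra.
have touch : U mum xm = g2 xm.
  by apply/eqP; rewrite eq_le below//= -subr_ge0.
have mum_gt0 : 0 < mum := lt_le_trans mu10 mu1m.
have r0 : 0 < r mum by exact: expR_gt0.
have rlam : r mum `^ m * expR mum ^+ 2 = r mum.
  rewrite /r -expRM -expRM_natl -expRD; congr expR.
  by rewrite /a; field; rewrite lt0r_neq0.
have ou t : 0 < t -> ode_at (expR mum `^ sigma * r mum `^ (1 - p)) (U mum)
   (fun t => r mum `^ m * expR mum * z1 (expR mum * t)) t.
  move=> t0; apply: (ode_at_rescale p1 pm (expR_gt0 _) r0 rlam t0).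
  by apply: o1; rewrite mulr_gt0 ?expR_gt0.
have kap1 : 1 < expR mum `^ sigma * r mum `^ (1 - p).
  rewrite /r -!expRM -expRD -[X in X < _]expR0 ltr_expR.
  have h1 : 0 < mum * sigma by rewrite mulr_gt0.
  have h2 : 0 < a * mum * (p - 1) by rewrite mulr_gt0// mulr_gt0.
  lra.
have uf t : 0 < t -> U mum t <= g2 t by move=> /ltW; exact: below.
have cscale (g : R -> R) c : continuous g -> continuous (fun t => c * g (expR mum * t)).
  move=> cg t; apply: cvgM; first exact: cvg_cst.
  apply: (@continuous_comp _ _ _ (fun t => expR mum * t) g); last exact: cg.
  exact: is_derive_continuous (is_deriveMl (expR mum) (is_derive_idn t)).
move: xm0; rewrite le_eqVlt => /predU1P[xm0|xm0]; last first.
  exact: (no_interior_touching p1 pm kap1 xm0 ou o2 uf touch).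
rewrite -xm0 in touch.
apply: (no_origin_touching p1 pm sigma0 kap1 _ _ cg2 cz2 _ z20 ou o2 uf _ touch).
- exact: cscale.
- exact: cscale.
- by rewrite mulr0 z10 mulr0.
- by rewrite touch g2p.
Qed.

End decaying_comparison.

(** * The truncated initial value problem *)

Section truncation.
Context {R : realType}.
Variables (n : nat) (m p sigma : R).
Implicit Types (x y t X M delta : R).
Hypotheses (p1 : 1 < p) (pm : p < m) (sigma0 : 0 < sigma).

Local Notation N := (n.+1%:R : R).
Local Notation alpha := (ss_alpha m p sigma).
Local Notation beta := (ss_beta m p sigma).

Let m0 : 0 < m. Proof. by move: p1 pm; lra. Qed.
Let al0 : 0 < alpha. Proof. exact: ss_alpha_gt0. Qed.
Let be0 : 0 < beta. Proof. exact: ss_beta_gt0. Qed.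

Definition clamp delta M y := Num.max delta (Num.min y M).

Lemma clamp_ge delta M y : delta <= clamp delta M y.
Proof. by rewrite le_max lexx. Qed.

Lemma clamp_le delta M y : delta <= M -> clamp delta M y <= M.
Proof. by move=> dM; rewrite ge_max dM ge_min lexx orbT. Qed.

Lemma clamp_id delta M y : delta <= y -> y <= M -> clamp delta M y = y.
Proof. by move=> dy yM; rewrite /clamp min_l// max_r. Qed.

Lemma clamp_lower delta M y : delta <= y -> delta <= M -> clamp delta M y = Num.min y M.
Proof. by move=> dy dM; rewrite /clamp max_r// le_min dy. Qed.

Lemma clamp_mono delta M y t : y <= t -> clamp delta M y <= clamp delta M t.
Proof.
move=> yt; rewrite ge_max le_max lexx /= le_max; apply/orP; right.
by rewrite le_min !ge_min yt lexx orbT.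
Qed.

Lemma clamp_lip delta M y t : `|clamp delta M y - clamp delta M t| <= `|y - t|.
Proof.
wlog yt : y t / t <= y.
  move=> H; have [|/ltW ty] := leP t y; first exact: H.
  by rewrite distrC [leRHS]distrC; exact: H.
have cm := clamp_mono delta M yt.
rewrite !ger0_norm ?subr_ge0// lerBlDr ge_max; apply/andP; split.
  by have := clamp_ge delta M t; move: yt; lra.
have [yM|My] := leP y M.
  have : Num.min t M <= clamp delta M t by rewrite le_max lexx orbT.
  by rewrite (min_l (le_trans yt yM)); lra.
have : Num.min t M <= clamp delta M t by rewrite le_max lexx orbT.
have [tM|Mt] := leP t M; move: yt My; lra.
Qed.

Lemma powR_lipschitz q a b : 0 < a -> a <= b -> exists2 K, 0 <= K &
  forall y t : R, a <= y <= b -> a <= t <= b -> `|y `^ q - t `^ q| <= K * `|y - t|.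
Proof.
move=> a0 ab.
have cf y : a <= y <= b -> {for y, continuous (fun y => q * y `^ (q - 1))}.
  move=> /andP[ay _]; apply: cvgM; first exact: cvg_cst.
  exact: is_derive_continuous (is_derive1_powR (q - 1) (lt_le_trans a0 ay)).
have cnf y : a <= y <= b -> {for y, continuous (fun y => `|q * y `^ (q - 1)|)}.
  by move=> /cf; exact: cvg_norm.
have [c _ Hc] := EVT_max ab (continuous_for_within cnf).
exists `|q * c `^ (q - 1)|; first exact: normr_ge0.
have key y t : a <= y -> y < t -> t <= b -> `|y `^ q - t `^ q| <= `|q * c `^ (q - 1)| * `|y - t|.
  move=> ay yt tb.
  have pos r : y <= r -> 0 < r by move=> yr; rewrite (lt_le_trans a0)// (le_trans ay).
  have [r /andP[yr _]|r /andP[yr rt]|r [d [/andP[yr rt] dr E]]] := @MVT_for _ (fun r => r `^ q) y t yt.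
  - exact: is_derive_continuous (is_derive1_powR q (pos _ yr)).
  - by exists (q * r `^ (q - 1)); apply: is_derive1_powR; exact/pos/ltW.
  rewrite distrC E normrM [`|t - y|]distrC ler_wpM2r//.
  have r0 : 0 < r by exact/pos/ltW.
  rewrite (is_derive_unique dr (is_derive1_powR q r0)).
  by apply: Hc; rewrite in_itv /= (le_trans ay (ltW yr)) (le_trans (ltW rt)).
move=> y t /andP[ay yb] /andP[at_ tb].
have [yt|ty|->] := ltgtP y t; first exact: key.
  by rewrite distrC [`|y - t|]distrC; exact: key.
by rewrite !subrr normr0 mulr0.
Qed.

(** The root y^(1/m) that recovers f from w, made Lipschitz by the cut-off at [delta] and bounded by
    the one at [M]. *)
Definition root_clamp delta M y := clamp delta M y `^ (1 / m).

Section fixed_clamp.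
Variables (delta M : R).
Hypotheses (d0 : 0 < delta) (dM : delta <= M).
Local Notation phi := (root_clamp delta M).

Let cl0 y : 0 < clamp delta M y. Proof. exact: lt_le_trans d0 (clamp_ge _ _ _). Qed.

Lemma root_clamp_gt0 y : 0 < phi y.
Proof. exact: powR_gt0. Qed.

Lemma root_clamp_mono y t : y <= t -> phi y <= phi t.
Proof.
move=> yt; apply: ge0_ler_powR; rewrite ?nnegrE ?(ltW (cl0 _)) ?clamp_mono//.
by rewrite divr_ge0// ltW.
Qed.

Lemma root_clamp_le y : phi y <= M `^ (1 / m).
Proof.
apply: ge0_ler_powR; rewrite ?nnegrE ?(ltW (cl0 _)) ?clamp_le//.
  by rewrite divr_ge0// ltW.
by rewrite ltW// (lt_le_trans d0).
Qed.

Lemma root_clamp_powR q y : phi y `^ q = clamp delta M y `^ (q / m).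
Proof. by rewrite /root_clamp -powRrM mulrAC mul1r. Qed.

Lemma root_clamp_lip q : exists2 K, 0 <= K &
  forall y t : R, `|phi y `^ q - phi t `^ q| <= K * `|y - t|.
Proof.
have [K K0 HK] := powR_lipschitz (q / m) d0 dM.
exists K => // y t; rewrite !root_clamp_powR; apply: le_trans (HK _ _ _ _) _.
- by rewrite clamp_ge clamp_le.
- by rewrite clamp_ge clamp_le.
by rewrite ler_wpM2l// clamp_lip.
Qed.

Lemma root_clamp_continuous q : continuous (fun y => phi y `^ q).
Proof.
have [K K0 HK] := root_clamp_lip q; move=> y; apply/cvgrPdist_lt => e e0.
have K1 : 0 < K + 1 by lra.
exists (e / (K + 1)); first by rewrite /= divr_gt0.
move=> t; rewrite /ball_ /= ltr_pdivlMr// => yt; apply: le_lt_trans (HK _ _) _.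
apply: le_lt_trans yt; rewrite mulrC ler_wpM2l//; lra.
Qed.

Lemma root_clamp_cont : continuous phi.
Proof.
have <- : (fun y => phi y `^ 1) = phi.
  by apply/funext => y; rewrite powRr1// ltW// root_clamp_gt0.
exact: root_clamp_continuous.
Qed.

(* With w = f^m and Q = x^n w' - beta x^(n+1) f, the equation becomes a first-order
   system that contains no derivative of f. *)
Definition flux_rhs x y := x `^ sigma * phi y `^ p - (alpha + beta * N) * phi y.

Definition sol X a w Q := picard_image n flux_rhs (fun y => beta * phi y) X w a Q w.

(** The existence result asks for bounds uniform in x; freezing x beyond [T] supplies them without
    changing the system on ]0, T[. *)
Let T_rhs T x y := flux_rhs (Num.min T `|x|) y.

Let phiK1 : exists2 K, 0 <= K & forall y t : R, `|phi y - phi t| <= K * `|y - t|.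
Proof.
have [K K0 HK] := root_clamp_lip 1; exists K => // y t.
by have := HK y t; rewrite !powRr1 ?(ltW (root_clamp_gt0 _)).
Qed.

Let trunc_bounds T : 0 <= T -> exists L, [/\ 0 < L,
  forall x y, `|T_rhs T x y| <= L /\ `|beta * phi y| <= L,
  forall x y t, `|T_rhs T x y - T_rhs T x t| <= L * `|y - t| &
  forall y t, `|beta * phi y - beta * phi t| <= L * `|y - t| ].
Proof.
move=> T0; have [K1 K10 H1] := phiK1; have [K2 K20 H2] := root_clamp_lip p.
have M0 : 0 < M := lt_le_trans d0 dM.
pose B := M `^ (1 / m); have B0 : 0 < B by rewrite powR_gt0.
have c0 : 0 < alpha + beta * N by rewrite addr_gt0// mulr_gt0.
have Tx x : 0 <= Num.min T `|x| by rewrite le_min T0 normr_ge0.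
have Ts x : 0 <= Num.min T `|x| `^ sigma <= T `^ sigma.
  rewrite powR_ge0 /=; apply: ge0_ler_powR; rewrite ?nnegrE ?(ltW sigma0) ?Tx//.
  by rewrite ge_min lexx.
have phiB y : `|phi y| <= B by rewrite gtr0_norm ?root_clamp_gt0// root_clamp_le.
have phipB y : `|phi y `^ p| <= B `^ p.
  rewrite (ger0_norm (powR_ge0 _ _)); apply: ge0_ler_powR.
  - by move: p1; lra.
  - by rewrite nnegrE ltW// root_clamp_gt0.
  - by rewrite nnegrE ltW.
  - exact: root_clamp_le.
have TB : 0 <= T `^ sigma by exact: powR_ge0.
exists (T `^ sigma * B `^ p + (alpha + beta * N) * B + beta * B
  + T `^ sigma * K2 + (alpha + beta * N) * K1 + beta * K1 + 1).
have P1 : 0 <= T `^ sigma * B `^ p by rewrite mulr_ge0// powR_ge0.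
have P2 : 0 <= (alpha + beta * N) * B by rewrite mulr_ge0// ltW.
have P3 : 0 <= beta * B by rewrite mulr_ge0// ltW.
have P4 : 0 <= T `^ sigma * K2 by rewrite mulr_ge0.
have P5 : 0 <= (alpha + beta * N) * K1 by rewrite mulr_ge0// ltW.
have P6 : 0 <= beta * K1 by rewrite mulr_ge0// ltW.
split.
- lra.
- move=> x y; have /andP[t1 t2] := Ts x; split.
    apply: le_trans (ler_normB _ _) _.
    have : `|Num.min T `|x| `^ sigma * phi y `^ p| <= T `^ sigma * B `^ p.
      by rewrite normrM ler_pM// ger0_norm.
    have : `|(alpha + beta * N) * phi y| <= (alpha + beta * N) * B.
      by rewrite normrM (gtr0_norm c0) ler_pM2l.
    lra.
  have : `|beta * phi y| <= beta * B by rewrite normrM (gtr0_norm be0) ler_pM2l.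
  lra.
- move=> x y t; have /andP[t1 t2] := Ts x.
  have -> : T_rhs T x y - T_rhs T x t = Num.min T `|x| `^ sigma * (phi y `^ p - phi t `^ p)
     - (alpha + beta * N) * (phi y - phi t).
    have aux (u a b c d e : R) : u * a - c * b - (u * d - c * e) = u * (a - d) - c * (b - e).
      by ring.
    exact: aux.
  apply: le_trans (ler_normB _ _) _.
  have Q1 : `|Num.min T `|x| `^ sigma * (phi y `^ p - phi t `^ p)| <= T `^ sigma * (K2 * `|y - t|).
    by rewrite normrM ler_pM// ger0_norm.
  have Q2 : `|(alpha + beta * N) * (phi y - phi t)| <= (alpha + beta * N) * (K1 * `|y - t|).
    by rewrite normrM (gtr0_norm c0) ler_pM2l.
  apply: le_trans (lerD Q1 Q2) _; rewrite !mulrA -mulrDl ler_wpM2r//; lra.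
- move=> y t; rewrite -mulrBr normrM (gtr0_norm be0).
  apply: (@le_trans _ _ (beta * (K1 * `|y - t|))); first by rewrite ler_pM2l.
  by rewrite mulrA ler_wpM2r//; lra.
Qed.

(** Meant for x^sigma at the origin, where the power need not be differentiable. *)
Lemma powR_continuous0 (g : R -> R) q : 0 < q -> (forall x, 0 <= g x) -> continuous g ->
  continuous (fun x => g x `^ q).
Proof.
move=> q0 g0 cg x; have := g0 x; rewrite le_eqVlt => /predU1P[gx|gx]; last first.
  apply: (@continuous_comp _ _ _ g (fun y => y `^ q)); first exact: cg.
  exact: is_derive_continuous (is_derive1_powR q gx).
apply/cvgrPdist_lt => e e0.
have e1 : 0 < e `^ (1 / q) by rewrite powR_gt0.
have /cvgrPdist_lt /(_ _ e1) := cg x; apply: filterS => t.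
rewrite -gx powR0 ?lt0r_neq0// !sub0r !normrN !ger0_norm ?powR_ge0// => gt.
have <- : (e `^ (1 / q)) `^ q = e by rewrite -powRrM divfK ?powRr1 ?(ltW e0)// lt0r_neq0.
by apply: gt0_ltr_powR; rewrite ?nnegrE ?g0 ?(ltW e1).
Qed.

Lemma sol_ex X a : 0 <= X -> exists w Q, continuous w /\ sol X a w Q.
Proof.
move=> X0; have [L [L0 HL hlip blip]] := trunc_bounds X0.
have [|Q [w [cw Hw]]] := @picard_fixpoint_ex _ n L (T_rhs X) (fun y => beta * phi y) L0
   (fun x y => (HL x y).1) (fun y => (HL 0 y).2) hlip blip _ a.
  move=> u cu x; apply: cvgB.
    apply: cvgM.
      apply: (@powR_continuous0 (fun x => Num.min X `|x|)) => //.
        by move=> t; rewrite le_min X0 normr_ge0.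
      move=> t; apply: continuous_min; [exact: cvg_cst|exact: norm_continuous].
    apply: (@continuous_comp _ _ _ u (fun y => phi y `^ p)); first exact: cu.
    exact: root_clamp_continuous.
  apply: cvgM; first exact: cvg_cst.
  apply: (@continuous_comp _ _ _ u phi); first exact: cu.
  exact: root_clamp_cont.
exists w, Q; split=> //; have [Q0 w0 cQ dQ] := Hw X; split=> // x xX.
have [d1 d2] := dQ _ xX; split=> //; move: d1; rewrite /T_rhs.
by case/andP: xX => x0 xX; rewrite (gtr0_norm x0) (min_r (ltW xX)).
Qed.

Lemma sol_stable X : 0 <= X -> exists2 K, 0 <= K & forall a1 w1 Q1 a2 w2 Q2,
  sol X a1 w1 Q1 -> sol X a2 w2 Q2 -> forall x, 0 <= x <= X ->
  `|w1 x - w2 x| <= K * `|a1 - a2| /\ `|Q1 x - Q2 x| <= K * `|a1 - a2|.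
Proof.
move=> X0; have [L [L0 HL hlip blip]] := trunc_bounds X0.
have lip x y t : 0 < x < X -> `|flux_rhs x y - flux_rhs x t| <= L * `|y - t|.
  by case/andP=> x0 xX; have := hlip x y t; rewrite /T_rhs (gtr0_norm x0) (min_r (ltW xX)).
pose E := volterra_weight L X.
have E0 : 0 <= E by exact: expR_ge0.
exists (2 * E + L * 2 * X ^+ n.+1 * E).
  have L00 := ltW L0.
  by apply: addr_ge0; rewrite !mulr_ge0 ?exprn_ge0.
move=> a1 w1 Q1 a2 w2 Q2 s1 s2 x xX.
have [||h1 h2] := picard_stable L0 X0 _ _ s1 s2 xX.
- by move=> t tX; exact: lip.
- by move=> t tX; exact: blip.
have a0 := normr_ge0 (a1 - a2).
have /andP[x0 xX'] := xX.
have Ex : volterra_weight L x <= E.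
  by rewrite /E /volterra_weight ler_expR ler_pM2l ?mulr_gt0// lerXn2r// nnegrE.
have Ex0 : 0 <= volterra_weight L x by exact: expR_ge0.
have L00 := ltW L0.
have K1 : 0 <= 2 * E by rewrite mulr_ge0.
have K2 : 0 <= L * 2 * X ^+ n.+1 * E by rewrite !mulr_ge0 ?exprn_ge0.
split.
  apply: le_trans h2 _; rewrite mulrAC ler_wpM2r//.
  by apply: (@le_trans _ _ (2 * E)); [rewrite ler_wpM2l|rewrite lerDl].
apply: le_trans h1 _.
have aux (u c d e : R) : u * (2 * c) * d * e = u * 2 * d * e * c by ring.
rewrite aux ler_wpM2r//; apply: (@le_trans _ _ (L * 2 * X ^+ n.+1 * E)); last by rewrite lerDr.
apply: ler_pM => //; first by rewrite !mulr_ge0 ?exprn_ge0.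
by rewrite ler_wpM2l ?mulr_ge0// lerXn2r// nnegrE.
Qed.

Lemma sol_sub X X' a w Q : X' <= X -> sol X a w Q -> sol X' a w Q.
Proof.
move=> X'X [Q0 w0 c d]; split=> // x /andP[x0 xX'].
  by apply: c; rewrite x0 (le_trans xX').
by apply: d; rewrite x0 (lt_le_trans xX').
Qed.

End fixed_clamp.

Lemma root_clamp_delta delta delta' M y : delta' <= delta -> delta <= y -> delta <= M ->
  root_clamp delta M y = root_clamp delta' M y.
Proof.
by move=> dd dy dM; rewrite /root_clamp !clamp_lower// (le_trans dd).
Qed.

(** Above [delta] the lower cut-off does nothing, so it may be lowered; this makes solutions with
    different cut-offs comparable. *)
Lemma sol_delta delta delta' M X a w Q : delta' <= delta -> delta <= M ->
  (forall x, 0 <= x <= X -> delta <= w x) ->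
  sol delta M X a w Q -> sol delta' M X a w Q.
Proof.
move=> dd dM dw [Q0 w0 c d]; split=> // x xX; have [d1 d2] := d _ xX.
have wx : delta <= w x by apply: dw; case/andP: xX => /ltW -> /ltW ->.
by move: d1 d2; rewrite /flux_rhs (root_clamp_delta dd wx dM).
Qed.

End truncation.

Section sign_bounds.
Context {R : realDomainType}.
Implicit Types al b c d f g u : R.

(** Used with f and g two values of the root, b = beta, c = N and u = x^sigma f^(p-1): it compares
    Q' with -beta g N x^n, whose primitive is -beta g x^(n+1). *)
Lemma rhs_ge al b c f g u : al <= u -> 0 <= f -> b * c * f <= b * c * g ->
  - (b * g) * c <= f * (u - (al + b * c)).
Proof.
move=> au f0; rewrite -subr_ge0 => h.
have h' : 0 <= f * (u - al) by rewrite mulr_ge0 ?subr_ge0.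
lra.
Qed.

Lemma rhs_le al b c f g u : u <= al -> 0 <= f -> b * c * g <= b * c * f ->
  f * (u - (al + b * c)) <= - (b * g) * c.
Proof.
move=> au f0 h.
have h' : 0 <= f * (al - u) by rewrite mulr_ge0 ?subr_ge0.
lra.
Qed.

End sign_bounds.

(** * Monotonicity and persistence for the truncated system *)

Section truncated_solution.
Context {R : realType}.
Variables (n : nat) (m p sigma : R).
Implicit Types (x y t : R).
Hypotheses (p1 : 1 < p) (pm : p < m) (sigma0 : 0 < sigma).

Local Notation N := (n.+1%:R : R).
Local Notation alpha := (ss_alpha m p sigma).
Local Notation beta := (ss_beta m p sigma).

Let p10 : 0 < p - 1. Proof. by move: p1; lra. Qed.
Let al0 : 0 < alpha. Proof. exact: ss_alpha_gt0. Qed.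
Let be0 : 0 < beta. Proof. exact: ss_beta_gt0. Qed.
Let bN0 : 0 < beta * N. Proof. exact: mulr_gt0. Qed.
Let ab0 : 0 < alpha + beta * N. Proof. exact: addr_gt0. Qed.

Variables (delta M X a : R) (w Q : R -> R).
Hypotheses (d0 : 0 < delta) (dM : delta <= M).
Hypothesis Hsol : sol n m p sigma delta M X a w Q.

Local Notation phi := (root_clamp m delta M).

(* Equal to x^n w'(x) for a solution w. *)
Definition wflux (delta M : R) (w Q : R -> R) x :=
  Q x + beta * x ^+ n.+1 * root_clamp m delta M (w x).
Local Notation P := (wflux delta M w Q).
Local Notation rhs t := (phi (w t) * (t `^ sigma * phi (w t) `^ (p - 1) - (alpha + beta * N))).

Let phi0 y : 0 < phi y. Proof. exact: root_clamp_gt0. Qed.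
Lemma sol_cw x : 0 <= x <= X -> {for x, continuous w}.
Proof. by case: Hsol => _ _ c _ /c[]. Qed.
Lemma sol_cQ x : 0 <= x <= X -> {for x, continuous Q}.
Proof. by case: Hsol => _ _ c _ /c[]. Qed.

Lemma sol_dQ x : 0 < x < X -> is_derive x 1 Q (x ^+ n * rhs x).
Proof.
move=> xX; case: Hsol => _ _ _ /(_ _ xX)[d _]; apply: (is_derive_eq d).
by rewrite /flux_rhs -(mulr_powRB1 (ltW (phi0 (w x)))) ?(lt_trans _ p1)//; ring.
Qed.

Lemma sol_dw x : 0 < x < X -> is_derive x 1 w (P x / x ^+ n).
Proof.
move=> xX; case: Hsol => _ _ _ /(_ _ xX)[_ d]; apply: (is_derive_eq d).
case/andP: xX => x0 _; rewrite /wflux exprS; field.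
by rewrite lt0r_neq0// exprn_gt0.
Qed.

Let cP x : 0 <= x <= X -> {for x, continuous P}.
Proof.
move=> xX; apply: cvgD; first exact: sol_cQ.
apply: cvgM.
  by apply: cvgM; [exact: cvg_cst|exact: is_derive_continuous (is_deriveXn n.+1 x)].
apply: (@continuous_comp _ _ _ w phi); first exact: sol_cw.
exact: (@root_clamp_cont _ m delta M d0 dM).
Qed.

Lemma wflux0 : P 0 = 0.
Proof. by case: Hsol => Q0 _ _ _; rewrite /wflux Q0 expr0n mulr0 mul0r addr0. Qed.

Let inX x1 x2 t : 0 <= x1 -> x2 <= X -> x1 <= t <= x2 -> 0 <= t <= X.
Proof. by move=> h1 h2 /andP[t1 t2]; rewrite (le_trans h1)// (le_trans t2). Qed.
Let inX' x1 x2 t : 0 <= x1 -> x2 <= X -> x1 < t < x2 -> 0 < t < X.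
Proof. by move=> h1 h2 /andP[t1 t2]; rewrite (le_lt_trans h1)// (lt_le_trans t2). Qed.
Let xn_gt0 t : 0 < t < X -> 0 < t ^+ n.
Proof. by move=> /andP[t0 _]; rewrite exprn_gt0. Qed.

Lemma sol_nondecr x1 x2 : 0 <= x1 -> x1 <= x2 -> x2 <= X ->
  (forall t, x1 < t < x2 -> 0 <= P t) -> w x1 <= w x2.
Proof.
move=> h1 h12 h2 HP; apply: (@nondecr_seg _ w _ _ h12) => [t tx|t tx].
  exact/sol_cw/(inX h1 h2 tx).
have tX := inX' h1 h2 tx.
by eexists; [exact: sol_dw tX|rewrite divr_ge0 ?HP ?(ltW (xn_gt0 tX))].
Qed.

Lemma sol_incr x1 x2 : 0 <= x1 -> x1 < x2 -> x2 <= X ->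
  (forall t, x1 < t < x2 -> 0 < P t) -> w x1 < w x2.
Proof.
move=> h1 h12 h2 HP; apply: (@incr_seg _ w _ _ h12) => [t tx|t tx].
  exact/sol_cw/(inX h1 h2 tx).
have tX := inX' h1 h2 tx.
by eexists; [exact: sol_dw tX|rewrite divr_gt0 ?HP ?(xn_gt0 tX)].
Qed.

Lemma sol_nonincr x1 x2 : 0 <= x1 -> x1 <= x2 -> x2 <= X ->
  (forall t, x1 < t < x2 -> P t <= 0) -> w x2 <= w x1.
Proof.
move=> h1 h12 h2 HP; rewrite -lerN2.
apply: (@nondecr_seg _ (fun t => - w t) _ _ h12) => [t tx|t tx].
  by apply: cvgN; exact/sol_cw/(inX h1 h2 tx).
have tX := inX' h1 h2 tx.
eexists; first exact: is_deriveN1 (sol_dw tX).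
by rewrite oppr_ge0 mulr_le0_ge0 ?HP ?invr_ge0 ?(ltW (xn_gt0 tX)).
Qed.

Lemma Q_lower x1 x2 c : 0 <= x1 -> x1 <= x2 -> x2 <= X ->
  (forall t, x1 < t < x2 -> c * N <= rhs t) ->
  Q x1 + c * (x2 ^+ n.+1 - x1 ^+ n.+1) <= Q x2.
Proof.
move=> h1 h12 h2 Hc.
suff : Q x1 - c * x1 ^+ n.+1 <= Q x2 - c * x2 ^+ n.+1 by lra.
apply: (@nondecr_seg _ (fun t => Q t - c * t ^+ n.+1) _ _ h12) => [t tx|t tx].
  apply: cvgB; first exact/sol_cQ/(inX h1 h2 tx).
  exact: is_derive_continuous (is_deriveMl c (is_deriveXn n.+1 t)).
have tX := inX' h1 h2 tx.
eexists; first exact: is_deriveB1 (sol_dQ tX) (is_deriveMl c (is_deriveXn n.+1 t)).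
have -> : c * (N * t ^+ n.+1.-1) = t ^+ n * (c * N) by rewrite /=; ring.
rewrite -mulrBr mulr_ge0 ?subr_ge0 ?Hc//.
exact/ltW/xn_gt0.
Qed.

Lemma Q_upper x1 x2 c : 0 <= x1 -> x1 <= x2 -> x2 <= X ->
  (forall t, x1 < t < x2 -> rhs t <= c * N) ->
  Q x2 <= Q x1 + c * (x2 ^+ n.+1 - x1 ^+ n.+1).
Proof.
move=> h1 h12 h2 Hc.
suff : c * x1 ^+ n.+1 - Q x1 <= c * x2 ^+ n.+1 - Q x2 by lra.
apply: (@nondecr_seg _ (fun t => c * t ^+ n.+1 - Q t) _ _ h12) => [t tx|t tx].
  apply: cvgB; last exact/sol_cQ/(inX h1 h2 tx).
  exact: is_derive_continuous (is_deriveMl c (is_deriveXn n.+1 t)).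
have tX := inX' h1 h2 tx.
eexists; first exact: is_deriveB1 (is_deriveMl c (is_deriveXn n.+1 t)) (sol_dQ tX).
have -> : c * (N * t ^+ n.+1.-1) = t ^+ n * (c * N) by rewrite /=; ring.
rewrite -mulrBr mulr_ge0 ?subr_ge0 ?Hc//.
exact/ltW/xn_gt0.
Qed.

Let phi_mono y t : y <= t -> phi y <= phi t.
Proof. by move=> yt; exact: (root_clamp_mono p1 pm M d0 yt). Qed.

Let phiq_mono y t : y <= t -> phi y `^ (p - 1) <= phi t `^ (p - 1).
Proof.
by move=> yt; apply: ge0_ler_powR; rewrite ?nnegrE ?(ltW p10) ?(ltW (phi0 _)) ?phi_mono.
Qed.

Let sig_mono x y : 0 <= x -> x <= y -> x `^ sigma <= y `^ sigma.
Proof.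
by move=> x0 xy; apply: ge0_ler_powR; rewrite ?nnegrE ?(ltW sigma0) ?x0 ?(le_trans x0).
Qed.

(* x^sigma phi(w)^(p-1) increases as long as w does. *)
Lemma rising_persists x1 x2 : 0 <= x1 -> x1 <= x2 -> x2 <= X ->
  0 < P x1 -> alpha <= x1 `^ sigma * phi (w x1) `^ (p - 1) -> 0 < P x2.
Proof.
move=> h1 h12 h2 P1 al1; rewrite ltNge; apply/negP => P2.
have cP' t : x1 <= t <= x2 -> {for t, continuous P}.
  by move=> tx; exact/cP/(inX h1 h2 tx).
have [c [/andP[x1c cx2] Pc pos]] := first_zero h12 cP' P1 P2.
have cX := le_trans cx2 h2.
have up t : x1 <= t <= c -> w x1 <= w t /\ w t <= w c.
  move=> /andP[x1t tc]; split; apply: sol_nondecr => //.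
  - exact: le_trans tc cX.
  - by move=> r /andP[r1 r2]; apply/ltW/pos; rewrite (ltW r1) (lt_le_trans r2).
  - exact: le_trans h1 x1t.
  - by move=> r /andP[r1 r2]; apply/ltW/pos; rewrite r2 (le_trans x1t)// ltW.
(* P c = 0 fixes Q c, and Q' >= -beta phi(w c) N x^n on [x1, c] then gives Q x1 + beta x1^(n+1)
   phi(w c) <= 0, hence P x1 <= 0. *)
have := @Q_lower x1 c (- (beta * phi (w c))) h1 (ltW x1c) cX.
have Pc' : Q c = - (beta * c ^+ n.+1 * phi (w c)) by move: Pc; rewrite /wflux; lra.
rewrite Pc' => H.
have {}H : Q x1 + - (beta * phi (w c)) * (c ^+ n.+1 - x1 ^+ n.+1) <= - (beta * c ^+ n.+1 * phi (w c)).
  apply: H => t /andP[x1t tc]; have [|u1 u2] := up t; first by rewrite !ltW.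
  have k1 : alpha <= t `^ sigma * phi (w t) `^ (p - 1).
    apply: le_trans al1 _.
    apply: ler_pM; [exact: powR_ge0|exact: powR_ge0|apply: sig_mono|exact: phiq_mono] => //.
    exact: ltW.
  have k3 : beta * N * phi (w t) <= beta * N * phi (w c).
    by rewrite (ler_pM2l bN0) phi_mono.
  exact: (rhs_ge k1 (ltW (phi0 _)) k3).
have k4 : beta * x1 ^+ n.+1 * phi (w x1) <= beta * x1 ^+ n.+1 * phi (w c).
  have [|u1 _] := up c; first by rewrite (ltW x1c) lexx.
  by rewrite ler_wpM2l ?phi_mono// mulr_ge0 ?exprn_ge0 ?(ltW be0).
by move: P1; rewrite /wflux; lra.
Qed.

(** While P <= 0, w decreases, so absorption stays below alpha + beta N and Q decreases too; with x
    <= x1 + 1 the certificate then bounds P by a negative constant, so P cannot reach 0. The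
    constant is the one that makes w' < -w x1. *)
Lemma falling_persists x1 x2 : 0 <= x1 -> x1 <= x2 -> x2 <= X -> x2 <= x1 + 1 ->
  0 < w x1 -> (x1 + 1) `^ sigma * phi (w x1) `^ (p - 1) < alpha + beta * N ->
  Q x1 + beta * (x1 + 1) ^+ n.+1 * phi (w x1) + (x1 + 1) ^+ n * w x1 < 0 ->
  P x2 < - ((x1 + 1) ^+ n * w x1).
Proof.
move=> h1 h12 h2 x2x1 w1 small cert.
have x110 : 0 <= x1 + 1 by rewrite addr_ge0.
have key c : x1 <= c <= x2 -> (forall t, x1 < t < c -> P t <= 0) ->
    P c < - ((x1 + 1) ^+ n * w x1).
  move=> /andP[x1c cx2] neg; have cX := le_trans cx2 h2.
  have dn t : x1 <= t <= c -> w t <= w x1.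
    move=> /andP[x1t tc]; apply: sol_nonincr => //; first exact: le_trans tc cX.
    by move=> r /andP[r1 r2]; apply: neg; rewrite r1 (lt_le_trans r2).
  have := @Q_upper x1 c 0 h1 x1c cX; rewrite !mul0r addr0 => H.
  have {}H : Q c <= Q x1.
    apply: H => t /andP[x1t tc].
    have k1 : t `^ sigma * phi (w t) `^ (p - 1) <= (x1 + 1) `^ sigma * phi (w x1) `^ (p - 1).
      apply: ler_pM; [exact: powR_ge0|exact: powR_ge0|apply: sig_mono|apply/phiq_mono/dn].
      - exact: le_trans h1 (ltW x1t).
      - exact: le_trans (ltW tc) (le_trans cx2 x2x1).
      - by rewrite (ltW x1t) (ltW tc).
    rewrite mulr_ge0_le0 ?(ltW (phi0 _))// subr_le0; exact: le_trans k1 (ltW small).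
  have k2 : beta * c ^+ n.+1 * phi (w c) <= beta * (x1 + 1) ^+ n.+1 * phi (w x1).
    have c0 : 0 <= c := le_trans h1 x1c.
    apply: ler_pM; rewrite ?(ltW (phi0 _))//.
    - by rewrite mulr_ge0 ?exprn_ge0// ltW.
    - by rewrite ler_pM2l// lerXn2r// ?nnegrE// (le_trans cx2).
    by apply: phi_mono; apply: dn; rewrite x1c lexx.
  by rewrite /wflux; lra.
apply: (key x2); first by rewrite h12 lexx.
move=> t /andP[x1t tx2]; rewrite leNgt; apply/negP => Pt.
have x1n : 0 <= (x1 + 1) ^+ n * w x1 by rewrite mulr_ge0 ?exprn_ge0// ltW.
have tX : t <= X by rewrite (le_trans (ltW tx2)).
have [|||c [/andP[x1c ct] Pc pos]] := @first_zero _ (fun r => - P r) x1 t (ltW x1t).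
- by move=> r rx; apply: cvgN; exact/cP/(inX h1 tX rx).
- have := key x1; rewrite lexx h12 => /(_ isT) H; rewrite oppr_gt0.
  apply: lt_le_trans (H _) _; last by rewrite oppr_le0.
  by move=> r /andP[r1 r2]; have := lt_trans r1 r2; rewrite ltxx.
- by rewrite oppr_le0 ltW.
have := key c; rewrite (ltW x1c) (le_trans ct (ltW tx2)) => /(_ isT) H.
have : P c < - ((x1 + 1) ^+ n * w x1).
  by apply: H => r /andP[r1 r2]; rewrite -oppr_ge0 ltW// pos// (ltW r1).
by move/eqP: Pc; rewrite oppr_eq0 => /eqP ->; rewrite ltNge oppr_le0 x1n.
Qed.

(* w'(x) < - w(x1) on [x1, x1 + 1]: the solution dies before x1 + 1. *)
Lemma falling_short x1 : 0 <= x1 -> x1 + 1 <= X ->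
  0 < w x1 -> (x1 + 1) `^ sigma * phi (w x1) `^ (p - 1) < alpha + beta * N ->
  Q x1 + beta * (x1 + 1) ^+ n.+1 * phi (w x1) + (x1 + 1) ^+ n * w x1 < 0 ->
  w (x1 + 1) <= 0.
Proof.
move=> h1 h2 w1 small cert; have h12 : x1 <= x1 + 1 by rewrite lerDl.
have : - (w x1 + w x1 * (x1 - x1)) <= - (w (x1 + 1) + w x1 * (x1 + 1 - x1)).
  apply: (@nondecr_seg _ (fun t => - (w t + w x1 * (t - x1))) _ _ h12) => [t tx|t tx].
    apply: cvgN; apply: cvgD; first exact/sol_cw/(inX h1 h2 tx).
    exact: is_derive_continuous (is_deriveMl (w x1) (is_deriveB1 (is_derive_idn t) (is_derive_cstn x1 t))).
  have tX := inX' h1 h2 tx; have tn := xn_gt0 tX.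
  eexists; first exact: is_deriveN1 (is_deriveD1 (sol_dw tX)
     (is_deriveMl (w x1) (is_deriveB1 (is_derive_idn t) (is_derive_cstn x1 t)))).
  case/andP: tx => x1t tx1.
  have Pt := falling_persists h1 (ltW x1t) (le_trans (ltW tx1) h2) (ltW tx1) w1 small cert.
  rewrite subr0 mulr1 oppr_ge0 -lerBrDr sub0r ler_pdivrMr//.
  apply: (le_trans (ltW Pt)); rewrite mulNr lerN2 mulrC ler_wpM2r ?(ltW w1)//.
  by rewrite lerXn2r// ?nnegrE ?(le_trans h1) ?addr_ge0// ltW// (le_lt_trans h1).
by rewrite subrr mulr0 addrAC subrr add0r mulr1; lra.
Qed.

(** Otherwise absorption is at most alpha after the last zero c of P, and P <= beta x^(n+1) (phi(w)
    - phi(w c)). As the truncated root is Lipschitz, w' <= q (w - w c), so w stays equal to w c,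
    although P > 0 makes it increase strictly. *)
Lemma rising_absorption x : 0 < x -> x <= X -> 0 < P x ->
  exists t, [/\ 0 < t <= x, 0 < P t & alpha < t `^ sigma * phi (w t) `^ (p - 1)].
Proof.
move=> x0 xX Px.
have cP' t : 0 <= t <= x -> {for t, continuous P}.
  by move=> tx; exact/cP/(inX (lexx 0) xX tx).
have P00 : P 0 <= 0 by rewrite wflux0.
have [c [/andP[c0 cx] Pc pos]] := last_zero (ltW x0) cP' P00 Px.
apply: contrapT => no.
have small t : c < t <= x -> t `^ sigma * phi (w t) `^ (p - 1) <= alpha.
  move=> tcx; rewrite leNgt; apply/negP => H; apply: no; exists t; split=> //.
    by case/andP: tcx => ct ->; rewrite (le_lt_trans c0).
  exact: pos.
have up t : c <= t <= x -> w c <= w t.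
  move=> /andP[ct tx]; apply: sol_nondecr => //; first exact: le_trans xX.
  by move=> r /andP[cr rt]; apply/ltW/pos; rewrite cr (ltW (lt_le_trans rt tx)).
have Pup t : c < t <= x -> P t <= beta * t ^+ n.+1 * (phi (w t) - phi (w c)).
  move=> /andP[ct tx].
  have := @Q_upper c t (- (beta * phi (w c))) c0 (ltW ct) (le_trans tx xX).
  have Pc' : Q c = - (beta * c ^+ n.+1 * phi (w c)) by move: Pc; rewrite /wflux; lra.
  rewrite Pc' /wflux => H; suff K : Q t <= - (beta * c ^+ n.+1 * phi (w c)) +
     - (beta * phi (w c)) * (t ^+ n.+1 - c ^+ n.+1) by lra.
  apply: H => r /andP[cr rt]; have rx : c < r <= x by rewrite cr (ltW (lt_le_trans rt tx)).
  have k2 : beta * N * phi (w c) <= beta * N * phi (w r).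
    by rewrite (ler_pM2l bN0) phi_mono// up//; case/andP: rx => /ltW -> ->.
  exact: (rhs_le (small r rx) (ltW (phi0 _)) k2).
have [K K0 HK] := @root_clamp_lip _ m delta M d0 dM 1.
have lip t : c <= t <= x -> phi (w t) - phi (w c) <= K * (w t - w c).
  move=> tcx; have := HK (w t) (w c); rewrite !powRr1 ?(ltW (phi0 _))//.
  rewrite [`|w t - w c|]ger0_norm ?subr_ge0 ?up//; apply: le_trans; exact: ler_norm.
pose q := beta * x * K.
have q0 : 0 <= q by apply: mulr_ge0 => //; exact: ltW (mulr_gt0 be0 x0).
have dE t : is_derive t 1 (fun t => expR (- (q * t))) (expR (- (q * t)) * - (q * 1)).
  exact: is_derive_expR_comp (is_deriveN1 (is_deriveMl q (is_derive_idn t))).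
have : - ((w c - w c) * expR (- (q * c))) <= - ((w x - w c) * expR (- (q * x))).
  apply: (@nondecr_seg _ (fun t => - ((w t - w c) * expR (- (q * t)))) _ _ (ltW cx)) => [t tx|t tx].
    apply: cvgN; apply: cvgM; last exact: is_derive_continuous (dE t).
    by apply: cvgB; [exact/sol_cw/(inX c0 xX tx)|exact: cvg_cst].
  have tX := inX' c0 xX tx; have tn := xn_gt0 tX.
  eexists; first exact: is_deriveN1 (is_deriveM1 (is_deriveB1 (sol_dw tX) (is_derive_cstn (w c) t)) (dE t)).
  case/andP: tx => ct tx; have t0 : 0 < t by case/andP: tX.
  have tcx : c < t <= x by rewrite ct ltW.
  have tcx' : c <= t <= x by rewrite !ltW.
  have k1 : P t / t ^+ n <= q * (w t - w c).
    rewrite ler_pdivrMr//; apply: le_trans (Pup _ tcx) _; rewrite exprS.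
    have -> : beta * (t * t ^+ n) * (phi (w t) - phi (w c)) =
      beta * t * (phi (w t) - phi (w c)) * t ^+ n by ring.
    rewrite ler_pM2r//; have wtc : 0 <= w t - w c by rewrite subr_ge0 up.
    apply: (@le_trans _ _ (beta * t * (K * (w t - w c)))).
      by rewrite (ler_pM2l (mulr_gt0 be0 t0)) lip.
    by rewrite /q mulrA ler_wpM2r// ler_wpM2r// (ler_pM2l be0) ltW.
  have E0 : 0 < expR (- (q * t)) by exact: expR_gt0.
  rewrite subr0; set E := expR _ in E0 *.
  have -> : - (P t / t ^+ n * E + (w t - w c) * (E * - (q * 1))) =
     E * (q * (w t - w c) - P t / t ^+ n) by ring.
  by rewrite mulr_ge0 ?subr_ge0// ltW.
rewrite subrr mul0r oppr0 oppr_ge0 pmulr_lle0 ?expR_gt0// subr_le0 leNgt => /negP; apply.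
by apply: sol_incr => // t /andP[ct tx]; apply: pos; rewrite ct ltW.
Qed.

(** Dropping the nonnegative absorption and convection terms leaves w' >= -C x, where C comes from
    phi <= M^(1/m). *)
Lemma sol_lower x : 0 <= x <= X ->
  a - (alpha + beta * N) * M `^ (1 / m) / N * x ^+ 2 / 2 <= w x.
Proof.
move=> /andP[x0 xX]; pose C := (alpha + beta * N) * M `^ (1 / m) / N.
have w0 : w 0 = a by case: Hsol.
have Q00 : Q 0 = 0 by case: Hsol.
have : w 0 + C / 2 * 0 ^+ 2 <= w x + C / 2 * x ^+ 2.
  apply: (@nondecr_seg _ (fun t => w t + C / 2 * t ^+ 2) _ _ x0) => [t tx|t tx].
    apply: cvgD; first exact/sol_cw/(inX (lexx 0) xX tx).
    exact: is_derive_continuous (is_deriveMl (C / 2) (is_deriveXn 2 t)).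
  have tX := inX' (lexx 0) xX tx; have tn := xn_gt0 tX.
  eexists; first exact: is_deriveD1 (sol_dw tX) (is_deriveMl (C / 2) (is_deriveXn 2 t)).
  have t0 : 0 < t by case/andP: tX.
  have := @Q_lower 0 t (- C) (lexx 0) (ltW t0).
  rewrite Q00 expr0n subr0 add0r => H.
  have {}H : - C * t ^+ n.+1 <= Q t.
    apply: H; first by case/andP: tX => _ /ltW.
    move=> r _; have -> : - C * N = - ((alpha + beta * N) * M `^ (1 / m)).
      by rewrite /C; field; rewrite lt0r_neq0.
    have k1 : (alpha + beta * N) * phi (w r) <= (alpha + beta * N) * M `^ (1 / m).
      by rewrite (ler_pM2l ab0); exact: (root_clamp_le p1 pm d0 dM).
    have k2 : 0 <= phi (w r) * (r `^ sigma * phi (w r) `^ (p - 1)).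
      by rewrite mulr_ge0 ?mulr_ge0 ?powR_ge0// ltW.
    by rewrite mulrBr; move: k1 k2; set u := phi _ * (_ * _); lra.
  have k3 : 0 <= beta * t ^+ n.+1 * phi (w t).
    by rewrite mulr_ge0 ?(ltW (phi0 _))// mulr_ge0 ?exprn_ge0 ?(ltW be0) ?(ltW t0).
  have k4 : - C * t <= P t / t ^+ n.
    rewrite ler_pdivlMr// -mulrA -exprS /wflux; lra.
  by move: k4; rewrite /= expr1; lra.
rewrite w0 expr0n mulr0 addr0 -/C; lra.
Qed.

End truncated_solution.

(** * Shooting *)

Section shooting.
Context {R : realType}.
Variables (n : nat) (m p sigma : R).
Implicit Types (x y t M a delta X : R).
Hypotheses (p1 : 1 < p) (pm : p < m) (sigma0 : 0 < sigma).

Local Notation N := (n.+1%:R : R).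
Local Notation alpha := (ss_alpha m p sigma).
Local Notation beta := (ss_beta m p sigma).
Local Notation sol := (sol n m p sigma).
Local Notation phi := (root_clamp m).
Local Notation P := (wflux n m p sigma).

Let m0 : 0 < m. Proof. by move: p1 pm; lra. Qed.
Let p10 : 0 < p - 1. Proof. by move: p1; lra. Qed.
Let al0 : 0 < alpha. Proof. exact: ss_alpha_gt0. Qed.
Let be0 : 0 < beta. Proof. exact: ss_beta_gt0. Qed.
Let N0 : 0 < N. Proof. by rewrite ltr0n. Qed.
Let ab0 : 0 < alpha + beta * N. Proof. by apply: addr_gt0 => //; exact: mulr_gt0. Qed.

(* On such an interval the lower truncation of the root is inactive. *)
Record solution_on M delta X a w Q : Prop := SolutionOn {
  so_d0 : 0 < delta ; so_dM : delta <= M ; so_X0 : 0 < X ;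
  so_sol : sol delta M X a w Q ;
  so_low : forall x, 0 <= x <= X -> 2 * delta <= w x }.

(* The certificates are open conditions on y = w X and q = Q X: the first forces w to
   increase forever, the second forces it to vanish before X + 1. *)
Definition rise_cert delta M X y q :=
  0 < q + beta * X ^+ n.+1 * phi delta M y /\
  alpha < X `^ sigma * phi delta M y `^ (p - 1).

Definition fall_cert delta M X y q :=
  (X + 1) `^ sigma * phi delta M y `^ (p - 1) < alpha + beta * N /\
  q + beta * (X + 1) ^+ n.+1 * phi delta M y + (X + 1) ^+ n * y < 0.

Definition rises M a := exists delta X w Q,
  solution_on M delta X a w Q /\ rise_cert delta M X (w X) (Q X).

Definition falls M a := exists delta X w Q,
  solution_on M delta X a w Q /\ fall_cert delta M X (w X) (Q X).

Lemma solution_on_sub M delta X Y a w Q : 0 < Y -> Y <= X ->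
  solution_on M delta X a w Q -> solution_on M delta Y a w Q.
Proof.
move=> Y0 YX [d0 dM X0 s low]; split => //; first exact: sol_sub s.
by move=> x /andP[x0 xY]; apply: low; rewrite x0 (le_trans xY).
Qed.

Lemma solution_on_delta M delta delta' X a w Q : 0 < delta' -> delta' <= delta ->
  solution_on M delta X a w Q -> solution_on M delta' X a w Q.
Proof.
move=> d'0 dd [d0 dM X0 s low]; split => //; first exact: le_trans dM.
  apply: (sol_delta dd dM) s => x /low; apply: le_trans; lra.
by move=> x /low; apply: le_trans; lra.
Qed.

Lemma solution_on_unique M d1 d2 X a w1 Q1 w2 Q2 :
  solution_on M d1 X a w1 Q1 -> solution_on M d2 X a w2 Q2 ->
  forall x, 0 <= x <= X -> w1 x = w2 x /\ Q1 x = Q2 x.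
Proof.
move=> s1 s2 x xX; pose d := Num.min d1 d2.
have d0 : 0 < d by rewrite lt_min (so_d0 s1) (so_d0 s2).
have dd1 : d <= d1 by rewrite ge_min lexx.
have dd2 : d <= d2 by rewrite ge_min lexx orbT.
have dM : d <= M := le_trans dd1 (so_dM s1).
have [K K0 HK] := sol_stable n p1 pm sigma0 d0 dM (ltW (so_X0 s1)).
have := HK _ _ _ _ _ _ (so_sol (solution_on_delta d0 dd1 s1))
  (so_sol (solution_on_delta d0 dd2 s2)) x xX.
by rewrite subrr normr0 mulr0 !normr_le0 !subr_eq0 => -[/eqP -> /eqP ->].
Qed.

Let phi_delta M d1 d2 y : 2 * d1 <= y -> 2 * d2 <= y -> 0 < d1 -> 0 < d2 ->
  d1 <= M -> d2 <= M -> phi d1 M y = phi d2 M y.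
Proof.
move=> h1 h2 d10 d20 d1M d2M.
rewrite (@root_clamp_delta _ m d1 (Num.min d1 d2)) ?ge_min ?lexx//; last by lra.
by rewrite (@root_clamp_delta _ m d2 (Num.min d1 d2)) ?ge_min ?lexx ?orbT//; lra.
Qed.

(** By uniqueness both certificates concern one solution. A rise certified first keeps P > 0,
    against P < 0 in the later falling certificate. A fall certified first either kills w within
    unit length or keeps P < 0 up to the point of the rising certificate. *)
Lemma rises_falls_disjoint M a : rises M a -> falls M a -> False.
Proof.
move=> [d1 [X1 [w1 [Q1 [s1 [P1 A1]]]]]] [d2 [X2 [w2 [Q2 [s2 [A2 P2]]]]]].
have X10 := so_X0 s1; have X20 := so_X0 s2.
have low1 := so_low s1; have low2 := so_low s2.
have d10 := so_d0 s1; have d20 := so_d0 s2; have dM1 := so_dM s1; have dM2 := so_dM s2.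
have [X12|/ltW X21] := leP X1 X2.
  have [|ew eQ] := solution_on_unique s1 (solution_on_sub X10 X12 s2) (x := X1).
    by rewrite (ltW X10) lexx.
  have l1 : 2 * d1 <= w2 X1 by rewrite -ew low1// (ltW X10) lexx.
  have l2 : 2 * d2 <= w2 X1 by rewrite low2// (ltW X10) X12.
  rewrite ew eQ (phi_delta l1 l2)// in P1 A1.
  have := rising_persists p1 pm sigma0 d20 dM2 (so_sol s2) (ltW X10) X12 (lexx _) P1 (ltW A1).
  apply/negP; rewrite -leNgt; apply: le_trans (ltW P2).
  rewrite /wflux -addrA lerD2l -[X in X <= _]addr0; apply: lerD.
    rewrite ler_wpM2r ?(ltW (root_clamp_gt0 _ _ d20 _))// ler_wpM2l ?(ltW be0)//.
    by rewrite lerXn2r// ?nnegrE ?(ltW X20) ?addr_ge0 ?(ltW X20)// lerDl.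
  rewrite mulr_ge0 ?exprn_ge0 ?addr_ge0 ?(ltW X20)//.
  by apply: le_trans (low2 X2 _); rewrite ?mulr_ge0 ?(ltW d20) ?(ltW X20) ?lexx.
have [|ew eQ] := solution_on_unique (solution_on_sub X20 X21 s1) s2 (x := X2).
  by rewrite (ltW X20) lexx.
have l1 : 2 * d1 <= w1 X2 by rewrite low1// (ltW X20).
have l2 : 2 * d2 <= w1 X2 by rewrite ew low2// (ltW X20) lexx.
rewrite -ew -eQ (phi_delta l2 l1)// in P2 A2.
have w10 x : 0 <= x <= X1 -> 0 < w1 x.
  by move=> /low1; apply: lt_le_trans; rewrite mulr_gt0.
have wX2 : 0 < w1 X2 by rewrite w10// (ltW X20).
have [X1X2|X1X2] := leP (X2 + 1) X1.
  have := falling_short p1 pm sigma0 d10 dM1 (so_sol s1) (ltW X20) X1X2 wX2 A2 P2.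
  by apply/negP; rewrite -ltNge w10// X1X2 addr_ge0// ltW.
have := falling_persists p1 pm sigma0 d10 dM1 (so_sol s1) (ltW X20) X21 (lexx _) (ltW X1X2) wX2 A2 P2.
apply/negP; rewrite -leNgt; apply: (le_trans _ (ltW P1)); rewrite oppr_le0.
by rewrite mulr_ge0 ?exprn_ge0 ?addr_ge0 ?(ltW X20) ?(ltW wX2).
Qed.

(** The margin in w >= 2 delta is spent here: solutions starting nearby stay above delta, hence
    satisfy the same condition with delta / 2. *)
Let cert_open M delta X a w Q (C : R * R -> Prop) :
  solution_on M delta X a w Q -> (\forall q \near (w X, Q X), C q) ->
  exists2 e, 0 < e & forall a', `|a' - a| < e ->
    exists w' Q', [/\ solution_on M (delta / 2) X a' w' Q', delta <= w' X & C (w' X, Q' X)].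
Proof.
move=> s [[A B] /= [[eA /= eA0 HA] [eB /= eB0 HB]] HC].
have d0 := so_d0 s; have dM := so_dM s; have X0 := so_X0 s.
have [K K0 HK] := sol_stable n p1 pm sigma0 d0 dM (ltW X0).
pose e := Num.min delta (Num.min eA eB) / (K + 1).
have K1 : 0 < K + 1 by lra.
exists e; first by rewrite divr_gt0// !lt_min d0 eA0.
move=> a' aa'; have [w' [Q' [_ s']]] := sol_ex n p1 pm sigma0 d0 dM a' (ltW X0).
have close x : 0 <= x <= X ->
    `|w x - w' x| < Num.min delta (Num.min eA eB) /\ `|Q x - Q' x| < Num.min delta (Num.min eA eB).
  move=> xX; have [h1 h2] := HK _ _ _ _ _ _ (so_sol s) s' x xX.
  have h3 : K * `|a - a'| < Num.min delta (Num.min eA eB).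
    rewrite distrC; apply: (@le_lt_trans _ _ ((K + 1) * `|a' - a|)).
      by rewrite ler_wpM2r// lerDl.
    by rewrite mulrC -ltr_pdivlMr.
  by split; [exact: le_lt_trans h1 h3|exact: le_lt_trans h2 h3].
have low' x : 0 <= x <= X -> delta <= w' x.
  move=> xX; have [+ _] := close x xX; rewrite lt_min => /andP[+ _].
  by rewrite ltr_norml => /andP[_]; have := so_low s xX; lra.
have XX : 0 <= X <= X by rewrite lexx ltW.
exists w', Q'; split.
- split => //; first by rewrite divr_gt0.
  + by apply: le_trans dM; lra.
  + by apply: (@sol_delta _ n m p sigma delta); rewrite ?dM//; lra.
  + by move=> x /low'; rewrite mulrC divfK.
- exact: low'.
apply: HC; have [] := close X XX; rewrite !lt_min => /and3P[_ h1 _] /and3P[_ _ h2].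
by split; [exact: HA|exact: HB].
Qed.

Let near_lt (T : topologicalType) (f g : T -> R) (q : T) :
  {for q, continuous f} -> {for q, continuous g} -> f q < g q -> \forall r \near q, f r < g r.
Proof.
move=> cf cg fg; have d : 0 < g q - f q by rewrite subr_gt0.
have : (g r - f r) @[r --> q] --> g q - f q by exact: cvgB.
move=> /cvgrPdist_lt /(_ _ d); apply: filterS => r.
by rewrite ltr_norml => /andP[_] /=; lra.
Qed.

Section certificate_continuity.
Variables (delta M : R).
Hypotheses (d0 : 0 < delta) (dM : delta <= M).
Let cfst (q : R * R) : {for q, continuous (@fst R R)}. Proof. exact: cvg_fst. Qed.
Let csnd (q : R * R) : {for q, continuous (@snd R R)}. Proof. exact: cvg_snd. Qed.
Let cphi (q : R * R) : {for q, continuous (fun q => phi delta M q.1)}.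
Proof.
apply: (@continuous_comp _ _ _ (@fst R R) (phi delta M)); first exact: cfst.
exact: (@root_clamp_cont _ m delta M d0 dM).
Qed.
Let cphip (q : R * R) : {for q, continuous (fun q => phi delta M q.1 `^ (p - 1))}.
Proof.
apply: (@continuous_comp _ _ _ (@fst R R) (fun y => phi delta M y `^ (p - 1))); first exact: cfst.
exact: (@root_clamp_continuous _ m delta M d0 dM).
Qed.

Lemma rise_cert_near X y q : rise_cert delta M X y q ->
  \forall r \near (y, q), rise_cert delta M X r.1 r.2.
Proof.
move=> [h1 h2]; apply: filterI.
  apply: (near_lt (f := fun=> 0) (g := fun r => r.2 + beta * X ^+ n.+1 * phi delta M r.1)) => //.
    exact: cvg_cst.
  by apply: cvgD; [exact: csnd|apply: cvgM; [exact: cvg_cst|exact: cphi]].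
apply: (near_lt (f := fun=> alpha) (g := fun r => X `^ sigma * phi delta M r.1 `^ (p - 1))) => //.
  exact: cvg_cst.
by apply: cvgM; [exact: cvg_cst|exact: cphip].
Qed.

Lemma fall_cert_near X y q : fall_cert delta M X y q ->
  \forall r \near (y, q), fall_cert delta M X r.1 r.2.
Proof.
move=> [h1 h2]; apply: filterI.
  apply: (near_lt (f := fun r => (X + 1) `^ sigma * phi delta M r.1 `^ (p - 1))
    (g := fun=> alpha + beta * N)) => //; last exact: cvg_cst.
  by apply: cvgM; [exact: cvg_cst|exact: cphip].
apply: (near_lt (f := fun r => r.2 + beta * (X + 1) ^+ n.+1 * phi delta M r.1 + (X + 1) ^+ n * r.1)
    (g := fun=> 0)) => //; last exact: cvg_cst.
apply: cvgD; last by apply: cvgM; [exact: cvg_cst|exact: cfst].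
by apply: cvgD; [exact: csnd|apply: cvgM; [exact: cvg_cst|exact: cphi]].
Qed.

End certificate_continuity.

Let phi_half M delta y : 0 < delta -> delta <= M -> delta <= y ->
  phi delta M y = phi (delta / 2) M y.
Proof. by move=> d0 dM dy; apply: root_clamp_delta => //; lra. Qed.

Lemma rises_open M a : rises M a -> exists2 e, 0 < e & forall a', `|a' - a| < e -> rises M a'.
Proof.
move=> [d [X [w [Q [s cert]]]]]; have d0 := so_d0 s; have dM := so_dM s.
have [e e0 He] := cert_open s (rise_cert_near d0 dM cert).
exists e => // a' /He[w' [Q' [s' low]]].
by rewrite /rise_cert /= (phi_half d0 dM low) => c; exists (d / 2), X, w', Q'.
Qed.

Lemma falls_open M a : falls M a -> exists2 e, 0 < e & forall a', `|a' - a| < e -> falls M a'.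
Proof.
move=> [d [X [w [Q [s cert]]]]]; have d0 := so_d0 s; have dM := so_dM s.
have [e e0 He] := cert_open s (fall_cert_near d0 dM cert).
exists e => // a' /He[w' [Q' [s' low]]].
by rewrite /fall_cert /= (phi_half d0 dM low) => c; exists (d / 2), X, w', Q'.
Qed.

(** A positive value of P would produce, by [rising_absorption], a point where both halves of the
    rising certificate hold. *)
Lemma not_rises_flux M delta X a w Q : ~ rises M a -> solution_on M delta X a w Q ->
  forall x, 0 <= x <= X -> P delta M w Q x <= 0.
Proof.
move=> nr s x /andP[x0 xX]; rewrite leNgt; apply/negP => Px.
have {}x0 : 0 < x.
  rewrite lt_neqAle x0 andbT; apply/eqP => E; move: Px.
  by rewrite -E (wflux0 (so_sol s)) ltxx.
have [t [/andP[t0 tx] Pt At]] :=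
  rising_absorption p1 pm sigma0 (so_d0 s) (so_dM s) (so_sol s) x0 xX Px.
apply: nr; exists delta, t, w, Q; split; last by split.
by apply: solution_on_sub s => //; exact: le_trans xX.
Qed.

Lemma not_rises_nonincr M delta X a w Q : ~ rises M a -> solution_on M delta X a w Q ->
  forall x y, 0 <= x -> x <= y -> y <= X -> w y <= w x.
Proof.
move=> nr s x y x0 xy yX.
apply: (sol_nonincr (so_sol s)) => // t /andP[xt ty].
by apply: (not_rises_flux nr s); rewrite (le_trans x0 (ltW xt)) (le_trans (ltW ty)).
Qed.

Let powR_small q e : 0 < q -> 0 < e ->
  exists2 y, 0 < y & forall t, 0 <= t -> t <= y -> t `^ q <= e.
Proof.
move=> q0 e0; exists (e `^ (1 / q)); first exact: powR_gt0.
move=> t t0 ty.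
have <- : (e `^ (1 / q)) `^ q = e by rewrite -powRrM divfK ?powRr1 ?(ltW e0)// lt0r_neq0.
by apply: ge0_ler_powR => //; rewrite ?nnegrE ?powR_ge0 ?(ltW q0).
Qed.

Let powR_large q B : 0 < q -> exists2 y, 0 < y & forall t, y <= t -> B < t `^ q.
Proof.
move=> q0; pose b := `|B| + 1; have b0 : 0 < b by rewrite ltr_wpDl.
exists (b `^ (1 / q)); first exact: powR_gt0.
move=> t yt; apply: (@lt_le_trans _ _ b); first by apply: le_lt_trans (ler_norm B) _; rewrite ltrDl.
have <- : (b `^ (1 / q)) `^ q = b by rewrite -powRrM divfK ?powRr1 ?(ltW b0)// lt0r_neq0.
apply: ge0_ler_powR => //; rewrite ?nnegrE ?powR_ge0 ?(ltW q0)//.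
by apply: le_trans yt; exact: powR_ge0.
Qed.

Let sig_mono x y : 0 <= x -> x <= y -> x `^ sigma <= y `^ sigma.
Proof.
by move=> x0 xy; apply: ge0_ler_powR => //; rewrite ?nnegrE ?(ltW sigma0) ?(le_trans x0).
Qed.

Let phi_id M delta y : delta <= y -> y <= M -> phi delta M y = y `^ (1 / m).
Proof. by move=> dy yM; rewrite /root_clamp clamp_id. Qed.

Let phip_le M delta y b : 0 < delta -> delta <= y -> delta <= M -> y <= b ->
  phi delta M y `^ (p - 1) <= b `^ ((p - 1) / m).
Proof.
move=> d0 dy dM yb; rewrite root_clamp_powR clamp_lower//.
have y0 := lt_le_trans d0 dy; have M0 := lt_le_trans d0 dM.
apply: ge0_ler_powR.
- by rewrite divr_ge0// ltW.
- by rewrite nnegrE le_min !ltW.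
- by rewrite nnegrE (le_trans (ltW y0)).
- by rewrite ge_min yb.
Qed.

Let half_lt (y : R) : 0 < y -> y / 2 < y.
Proof. lra. Qed.

Let fall_arith (q u v z : R) : 0 < q -> z <= - q -> u <= q / 4 -> v <= q / 4 -> z + u + v < 0.
Proof. lra. Qed.

(* If w ever came close to 0, then Q would stay below a fixed negative number while w
   and phi(w) are as small as we like, so that w would satisfy the falling certificate. *)
Lemma neither_extends M a X : 0 < a -> a <= M -> ~ rises M a -> ~ falls M a -> 0 < X ->
  exists delta w Q, solution_on M delta X a w Q.
Proof.
move=> a0 aM nr nf X0.
have M0 := lt_le_trans a0 aM.
have X1 : 0 < X + 1 by rewrite addr_gt0.
pose T := (X + 1) `^ sigma; have T0 : 0 < T by rewrite powR_gt0.
(* Below the level [eta], absorption is less than alpha + beta N up to x = X + 1, so Q decreases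
   from then on. *)
have [eta [eta0 eta_a eta_small]] : exists eta, [/\ 0 < eta, eta <= a / 2 &
    T * eta `^ ((p - 1) / m) < alpha + beta * N].
  have e0 : 0 < (alpha + beta * N) / 2 / T by rewrite !divr_gt0.
  have q0 : 0 < (p - 1) / m by rewrite divr_gt0.
  have [y y0 Hy] := powR_small q0 e0.
  have mn : 0 < Num.min (a / 2) y by rewrite lt_min divr_gt0.
  exists (Num.min (a / 2) y); split; [by []|by rewrite ge_min lexx|].
  apply: (@le_lt_trans _ _ ((alpha + beta * N) / 2)).
    rewrite mulrC -ler_pdivlMr//; apply: Hy; first exact: ltW.
    by rewrite ge_min lexx orbT.
  exact: half_lt.
pose e := eta `^ (1 / m); have e0 : 0 < e by rewrite powR_gt0.
pose C := (alpha + beta * N) * M `^ (1 / m) / N.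
have C0 : 0 < C by rewrite divr_gt0// (mulr_gt0 ab0)// powR_gt0.
(* By the quadratic lower bound, w cannot fall from a to eta <= a / 2 before [xl]. *)
pose xl := Num.min 1 (a / C).
have xl0 : 0 < xl by rewrite lt_min ltr01 divr_gt0.
have xl1 : xl <= 1 by rewrite ge_min lexx.
have xlC : xl <= a / C by rewrite ge_min lexx orbT.
(* When w reaches eta, at some xe >= xl, P <= 0 gives Q <= -beta xe^(n+1) eta^(1/m) <= -q. *)
pose q := beta * xl ^+ n.+1 * e.
have q0 : 0 < q by rewrite /q mulr_gt0// (mulr_gt0 be0)// exprn_gt0.
have q40 : 0 < q / 4 by rewrite divr_gt0.
have bX0 : 0 < beta * (X + 1) ^+ n.+1 by rewrite (mulr_gt0 be0)// exprn_gt0.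
have Xn0 : 0 < (X + 1) ^+ n by rewrite exprn_gt0.
(* At the level [D] each of the two positive terms of the falling certificate is at most q / 4, so
   that Q <= -q decides the sign. *)
have [D [D0 D_eta D_phi D_w]] : exists D, [/\ 0 < D, D < eta,
    beta * (X + 1) ^+ n.+1 * D `^ (1 / m) <= q / 4 & (X + 1) ^+ n * D <= q / 4].
  have m10 : 0 < 1 / m by rewrite divr_gt0.
  have [y y0 Hy] := powR_small m10 (divr_gt0 q40 bX0).
  pose D := Num.min (eta / 2) (Num.min y (q / 4 / (X + 1) ^+ n)).
  have [D1 D2 D3] : [/\ D <= eta / 2, D <= y & D <= q / 4 / (X + 1) ^+ n].
    by rewrite /D !ge_min !lexx !orbT.
  have D0 : 0 < D by rewrite /D !lt_min !divr_gt0// y0.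
  exists D; split=> //.
  - exact: le_lt_trans D1 (half_lt eta0).
  - by rewrite mulrC -ler_pdivlMr// Hy// ltW.
  - by rewrite mulrC -ler_pdivlMr.
pose delta := D / 2.
have d0 : 0 < delta by rewrite divr_gt0.
have dD : 2 * delta = D by rewrite mulrC divfK.
have d_D : delta <= D by rewrite -dD mulr_natl mulr2n lerDl ltW.
have etaM : eta <= M.
  exact: le_trans eta_a (le_trans (ltW (half_lt a0)) aM).
have DM : D <= M := le_trans (ltW D_eta) etaM.
have dM : delta <= M := le_trans d_D DM.
have [w [Q [_ s]]] := sol_ex n p1 pm sigma0 d0 dM a (ltW X0).
have [low|nlow] := pselect (forall x, 0 <= x <= X -> 2 * delta <= w x).
  by exists delta, w, Q.
exfalso; apply: nlow => x xX; rewrite leNgt; apply/negP => wx.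
have cw t : 0 <= t <= X -> {for t, continuous w} by move=> tX; exact: sol_cw s _ tX.
have w0 : w 0 = a by case: s.
have a_eta : eta < a := le_lt_trans eta_a (half_lt a0).
have /andP[x0 xX'] := xX.
have [|||Y [/andP[Y0 Yx] wY above]] := @first_zero _ (fun t => w t - D) 0 x x0.
- move=> t /andP[t0 tx]; apply: cvgB; last exact: cvg_cst.
  by apply: cw; rewrite t0 (le_trans tx).
- by rewrite w0 subr_gt0 (lt_trans D_eta).
- by rewrite subr_le0 -dD ltW.
have YX : Y <= X := le_trans Yx xX'.
have {}wY : w Y = D by apply/eqP; rewrite -subr_eq0 wY.
have sY : solution_on M delta Y a w Q.
  split=> //; first exact: sol_sub s.
  move=> t /andP[t0]; rewrite le_eqVlt dD => /predU1P[->|tY]; first by rewrite wY.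
  by rewrite -subr_ge0 ltW// above// t0.
have anti := not_rises_nonincr nr sY.
have [|||xe [/andP[xe0 xeY] wxe _]] := @first_zero _ (fun t => w t - eta) 0 Y (ltW Y0).
- move=> t /andP[t0 tY]; apply: cvgB; last exact: cvg_cst.
  by apply: cw; rewrite t0 (le_trans tY).
- by rewrite w0 subr_gt0.
- by rewrite wY subr_le0 ltW.
have {}wxe : w xe = eta by apply/eqP; rewrite -subr_eq0 wxe.
have xl_xe : xl <= xe.
  rewrite leNgt; apply/negP => xe_xl.
  have xe_in : 0 <= xe <= X by rewrite (ltW xe0) (le_trans xeY).
  have := sol_lower p1 pm sigma0 d0 dM s xe_in; rewrite wxe -/C => h1.
  have h2 : xe ^+ 2 <= xe.
    by rewrite expr2 ler_piMl ?(ltW xe0)// (le_trans (ltW xe_xl)).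
  have h3 : C * xe ^+ 2 < a.
    apply: (@lt_le_trans _ _ (C * xl)); last by rewrite mulrC -ler_pdivlMr.
    by rewrite ltr_pM2l//; exact: le_lt_trans xe_xl.
  have h4 : a - a / 2 <= C * xe ^+ 2 / 2.
    rewrite lerBlDr; move: h1; rewrite lerBlDr => h1; apply: (le_trans h1).
    by rewrite addrC lerD2l.
  move: h4; rewrite ler_pdivlMr// mulrBl divfK// mulr_natr mulr2n addrK leNgt => /negP; apply.
  exact: h3.
have Qxe : Q xe <= - q.
  have := not_rises_flux nr sY (x := xe); rewrite (ltW xe0) xeY => /(_ isT).
  rewrite /wflux wxe phi_id ?(le_trans d_D (ltW D_eta))// -/e -lerBrDr sub0r => h.
  apply: (le_trans h); rewrite lerN2 /q ler_wpM2r ?(ltW e0)// (ler_wpM2l (ltW be0))//.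
  by rewrite lerXn2r// nnegrE ltW.
have QY : Q Y <= - q.
  have := Q_upper p1 d0 (so_sol sY) (ltW xe0) xeY (lexx Y) (c := 0).
  rewrite !mul0r addr0 => h; apply: le_trans Qxe; apply: h => t /andP[xet tY].
  have t0 := lt_trans xe0 xet.
  have tY' : 0 <= t <= Y by rewrite !ltW.
  have wt : w t <= eta by rewrite -wxe anti ?(ltW xe0) ?(ltW xet) ?(ltW tY).
  have dwt : delta <= w t by apply: le_trans (so_low sY tY'); rewrite dD.
  rewrite mulr_ge0_le0 ?(ltW (root_clamp_gt0 _ _ d0 _))// subr_le0.
  apply: le_trans (ltW eta_small).
  apply: ler_pM; [exact: powR_ge0|exact: powR_ge0| |exact: phip_le].
  apply: sig_mono; first exact: ltW.
  by rewrite (le_trans (ltW tY))// (le_trans YX)// lerDl.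
apply: nf; exists delta, Y, w, Q; split=> //; split; rewrite wY.
  apply: (le_lt_trans _ eta_small).
  apply: ler_pM; [exact: powR_ge0|exact: powR_ge0| |].
    by apply: sig_mono; [rewrite addr_ge0// ltW|rewrite lerD2r].
  by apply: phip_le => //; exact: ltW.
have Y1 : 0 <= Y + 1 by rewrite addr_ge0// ltW.
have YX1 : Y + 1 <= X + 1 by rewrite lerD2r.
apply: (fall_arith q0 QY).
  rewrite phi_id//; apply: le_trans D_phi; rewrite ler_wpM2r ?powR_ge0//.
  by rewrite (ler_wpM2l (ltW be0))// lerXn2r// nnegrE// ltW.
apply: le_trans D_w; rewrite ler_wpM2r ?(ltW D0)//.
by rewrite lerXn2r// nnegrE// ltW.
Qed.

Let large_arith (a A c x : R) : 0 <= c * A -> c * A <= a -> 0 <= x ^+ 2 <= 1 ->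
  a / 2 <= a - c * A * x ^+ 2 / 2.
Proof. move=> h1 h2 /andP[h3 h4]; have : c * A * x ^+ 2 <= c * A * 1 by rewrite ler_wpM2l. lra. Qed.

Let large_arith2 (c A l h Q1 Q2 : R) : 0 < c * A -> 0 <= h <= 1 / 2 -> 3 * (c * A) < l ->
  - (c * A) * h <= Q1 -> Q1 + (l - c * A) * (1 - h) <= Q2 -> 0 < Q2.
Proof.
move=> cA /andP[h0 h1] l3 k1 k2.
have : 2 * (c * A) * (1 - h) <= (l - c * A) * (1 - h) by rewrite ler_wpM2r; lra.
have : c * A * h <= c * A * (1 / 2) by rewrite ler_wpM2l// ltW.
lra.
Qed.

Let rhs_low (f u b B : R) : 0 <= f -> f <= B -> 0 <= b -> 0 <= u -> - (b * B) <= f * (u - b).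
Proof.
move=> f0 fB b0 u0; have h1 : 0 <= f * u by rewrite mulr_ge0.
have h2 : b * f <= b * B by rewrite ler_wpM2l.
by rewrite mulrBr; lra.
Qed.

(** With a = A^m and A large, w >= a / 2 on all of [0, 1] because m > 1. On [1/2, 1] absorption is
    then of order A^p and beats the linear terms of order A because p > 1, which makes Q 1
    positive. *)
Lemma rises_large : exists2 a, 0 < a & rises a a.
Proof.
pose c := (alpha + beta * N) / N; have c0 : 0 < c by rewrite divr_gt0.
have cN : c * N = alpha + beta * N by rewrite /c divfK// lt0r_neq0.
pose g := (1 / 2 : R) `^ (1 / m); have g0 : 0 < g by rewrite powR_gt0// divr_gt0.
pose h := (1 / 2 : R) `^ sigma; have h0 : 0 < h by rewrite powR_gt0// divr_gt0.
pose K := g `^ p * h; have K0 : 0 < K by rewrite mulr_gt0// powR_gt0.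
have m10 : 0 < m - 1 by move: p1 pm; lra.
(* [A1] gives c A <= A^m, hence w >= a / 2; [A2] gives K A^p / N > 3 c A, hence Q 1 > 0; [A3] gives
   absorption above alpha at x = 1. *)
have [A1 A10 H1] := powR_large c m10.
have [A2 A20 H2] := powR_large (3 * c * N / K) p10.
have [A3 A30 H3] := powR_large (alpha / g `^ (p - 1)) p10.
pose A := Num.max A1 (Num.max A2 A3).
have {}H1 := H1 A; have {}H2 := H2 A; have {}H3 := H3 A.
rewrite /A !le_max !lexx !orbT -/A in H1 H2 H3.
have A0 : 0 < A by rewrite lt_max A10.
pose a := A `^ m; have a0 : 0 < a by rewrite powR_gt0.
have aE : a = A * A `^ (m - 1) by rewrite mulr_powRB1 ?(ltW A0).
have am : a `^ (1 / m) = A by rewrite -powRrM mulrC divfK ?powRr1 ?(ltW A0)// lt0r_neq0.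
have d0 : 0 < a / 4 by rewrite divr_gt0.
have da : a / 4 <= a by lra.
exists a => //; have [w [Q [_ s]]] := sol_ex n p1 pm sigma0 d0 da a (@ler01 R).
have cA : c * A <= a by rewrite aE mulrC ler_pM2l// ltW// H1.
have cA0 : 0 < c * A by rewrite mulr_gt0.
have low x : 0 <= x <= 1 -> a / 2 <= w x.
  move=> x01; apply: le_trans (sol_lower p1 pm sigma0 d0 da s x01).
  have -> : (alpha + beta * N) * a `^ (1 / m) / N = c * A by rewrite am /c mulrAC.
  apply: large_arith => //; first exact: ltW.
  by case/andP: x01 => x0 x1; rewrite sqr_ge0 expr_le1.
have phi_up y : phi (a / 4) a y <= A by rewrite -am; exact: (root_clamp_le p1 pm d0 da).
have phi_low x : 0 <= x <= 1 -> g * A <= phi (a / 4) a (w x).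
  move=> x01; have -> : g * A = phi (a / 4) a (a / 2).
    rewrite phi_id; [|by lra|by lra].
    have -> : a / 2 = a * (1 / 2) by rewrite div1r.
    by rewrite powRM ?(ltW a0) ?divr_ge0// am mulrC.
  exact: (root_clamp_mono p1 pm a d0 (low x x01)).
have phi0 y : 0 <= phi (a / 4) a y by exact/ltW/root_clamp_gt0.
have Q0 : Q 0 = 0 by case: s.
exists (a / 4), 1, w, Q; split.
  by split=> // x /low; apply: le_trans; lra.
have Q_half : - (c * A) * (1 / 2) ^+ n.+1 <= Q (1 / 2).
  have := @Q_lower _ n m p sigma p1 _ _ _ _ w Q d0 s 0 (1 / 2) (- (c * A)) (lexx 0).
  rewrite Q0 add0r expr0n subr0; apply; [lra|lra|].
  move=> t _; have -> : - (c * A) * N = - ((alpha + beta * N) * A) by rewrite -cN; ring.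
  by apply: rhs_low => //; [exact: ltW|rewrite mulr_ge0 ?powR_ge0].
pose l := K * A `^ p / N.
have Q_one : Q (1 / 2) + (l - c * A) * (1 - (1 / 2) ^+ n.+1) <= Q 1.
  have := @Q_lower _ n m p sigma p1 _ _ _ _ w Q d0 s (1 / 2) 1 (l - c * A).
  rewrite expr1n; apply; [lra|lra|lra|].
  move=> t /andP[t1 t2]; have t01 : 0 <= t <= 1 by apply/andP; split; lra.
  have gA0 : 0 <= g * A by rewrite mulr_ge0// ltW.
  have k1 : h * (g * A) `^ (p - 1) <= t `^ sigma * phi (a / 4) a (w t) `^ (p - 1).
    apply: ler_pM; [exact: ltW|exact: powR_ge0|apply: sig_mono; lra|].
    by apply: ge0_ler_powR; rewrite ?nnegrE ?(ltW p10) ?phi_low.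
  have k2 : K * A `^ p <= phi (a / 4) a (w t) * (t `^ sigma * phi (a / 4) a (w t) `^ (p - 1)).
    have -> : K * A `^ p = (g * A) * (h * (g * A) `^ (p - 1)).
      rewrite mulrCA mulr_powRB1// ?(lt_trans _ p1)// powRM ?(ltW g0) ?(ltW A0)//.
      by rewrite /K [g `^ p * h]mulrC mulrA.
    by apply: ler_pM => //; [rewrite mulr_ge0 ?powR_ge0 ?ltW|exact: phi_low].
  have k3 : (alpha + beta * N) * phi (a / 4) a (w t) <= (alpha + beta * N) * A.
    by rewrite ler_pM2l.
  rewrite mulrBl /l divfK ?lt0r_neq0// [c * A * N]mulrAC cN mulrBr lerB//.
  by rewrite mulrC.
have Q1_gt0 : 0 < Q 1.
  apply: (large_arith2 cA0 _ _ Q_half Q_one).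
    rewrite exprn_ge0 /=; last by lra.
    by rewrite exprS ler_piMr ?exprn_ile1//; lra.
  rewrite /l -(mulr_powRB1 (ltW A0)) ?(lt_trans _ p1)// ltr_pdivlMr//.
  have := H2 isT; rewrite ltr_pdivrMr// -(ltr_pM2l A0) => k; apply: le_lt_trans _ (lt_le_trans k _).
    by rewrite le_eqVlt; apply/orP; left; apply/eqP; ring.
  by rewrite le_eqVlt; apply/orP; left; apply/eqP; ring.
split.
  by rewrite expr1n mulr1 ltr_wpDr// mulr_ge0// ltW.
rewrite powR1 mul1r; apply: (@lt_le_trans _ _ ((g * A) `^ (p - 1))).
  rewrite powRM ?(ltW g0) ?(ltW A0)// mulrC -ltr_pdivrMr ?powR_gt0//; exact: H3.
apply: ge0_ler_powR; rewrite ?nnegrE ?(ltW p10) ?phi_low ?ler01 ?lexx//.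
by rewrite mulr_ge0// ltW.
Qed.

(** For small a, absorption stays below alpha / 2 on [0, 1], so P <= 0 there and a rising
    certificate would need X >= 1. But w' <= -(alpha / (2N)) x w^(1/m) makes w^(1-1/m) + k x^2
    nonincreasing, so w cannot stay positive up to x = 1. *)
Lemma not_rises_small M : 0 < M -> exists a, [/\ 0 < a, a <= M & ~ rises M a].
Proof.
move=> M0.
have al20 : 0 < alpha / 2 by rewrite divr_gt0.
have mm : 0 < 1 - 1 / m by rewrite subr_gt0 ltr_pdivrMr// mul1r; move: p1 pm; lra.
pose k := (1 - 1 / m) * (alpha / (4 * N)).
have k0 : 0 < k by rewrite mulr_gt0// divr_gt0// mulr_gt0.
have [y1 y10 H1] := powR_small (divr_gt0 p10 m0) al20.
have [y2 y20 H2] := powR_small mm (divr_gt0 k0 (ltr0n R 2)).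
pose a := Num.min M (Num.min (y1 / 2) y2).
have [aM a1 a2] : [/\ a <= M, a <= y1 / 2 & a <= y2] by rewrite /a !ge_min !lexx !orbT.
have a0 : 0 < a by rewrite /a !lt_min M0 y20 divr_gt0.
have {}H1 : (2 * a) `^ ((p - 1) / m) <= alpha / 2.
  by apply: H1; [rewrite mulr_ge0// ltW|rewrite mulrC -ler_pdivlMr].
have {}H2 : a `^ (1 - 1 / m) < k.
  by apply: le_lt_trans (H2 a (ltW a0) a2) _; rewrite ltr_pdivrMr// mulr_natr mulr2n ltrDl.
exists a; split=> // -[d [X [w [Q [s [PX _]]]]]].
have d0 := so_d0 s; have dM := so_dM s; have ss := so_sol s.
have w0 : w 0 = a by case: ss.
have dw x : 0 <= x <= X -> d <= w x.
  by move=> /(so_low s); apply: le_trans; lra.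
have big x : 0 < x -> x <= 1 -> x <= X -> 0 < P d M w Q x -> exists t, 0 < t <= x /\ 2 * a < w t.
  move=> x0 x1 xX Px.
  have [t [/andP[t0 tx] Pt At]] := rising_absorption p1 pm sigma0 d0 dM ss x0 xX Px.
  exists t; split; first by rewrite t0.
  rewrite ltNge; apply/negP => wt; move: At; apply/negP; rewrite -leNgt.
  have tX : 0 <= t <= X by rewrite (ltW t0) (le_trans tx).
  apply: (@le_trans _ _ (1 * (alpha / 2))); last by rewrite mul1r ltW// half_lt.
  apply: ler_pM; [exact: powR_ge0|exact: powR_ge0| |].
    apply: (@le_trans _ _ (1 `^ sigma)); last by rewrite powR1.
    by apply: sig_mono; [exact: ltW|exact: le_trans x1].
  by apply: le_trans (phip_le d0 (dw _ tX) dM wt) _.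
have noP x : 0 <= x -> x <= 1 -> x <= X -> P d M w Q x <= 0.
  move=> x_ge0 x1 xX; rewrite leNgt; apply/negP => Px.
  have x0 : 0 < x.
    rewrite lt_neqAle x_ge0 andbT; apply/eqP => E; move: Px.
    by rewrite -E (wflux0 ss) ltxx.
  have [t [/andP[t0 tx] wt]] := big x x0 x1 xX Px.
  (* Continuation argument: until w first reaches 2 a, P <= 0, so w <= a and the level 2 a is never
     reached. *)
  have [|||Y [/andP[Y0 Yt] wY below]] := @first_zero _ (fun r => 2 * a - w r) 0 t (ltW t0).
  - move=> r /andP[r0 rt]; apply: cvgB; first exact: cvg_cst.
    by apply: (sol_cw ss); rewrite r0 (le_trans rt)// (le_trans tx).
  - by rewrite w0 mulr_natl mulr2n addrK.
  - by rewrite subr_le0 ltW.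
  have Yx := le_trans Yt tx.
  have : w Y <= w 0.
    apply: (sol_nonincr ss) => //; [exact: ltW|exact: le_trans xX|].
    move=> r /andP[r0 rY]; rewrite leNgt; apply/negP => Pr.
    have [||r' [/andP[r'0 r'r] wr']] := big r r0 _ _ Pr.
    - by rewrite (le_trans (ltW rY))// (le_trans Yx).
    - by rewrite (le_trans (ltW rY))// (le_trans Yx).
    have := below r'; rewrite (ltW r'0) (le_lt_trans r'r rY) => /(_ isT).
    by rewrite subr_gt0 ltNge (ltW wr').
  move/eqP: wY; rewrite subr_eq0 => /eqP <-; rewrite w0 mulr_natl mulr2n gerDl leNgt a0//.
have X1 : 1 <= X.
  rewrite leNgt; apply/negP => X1; have := noP X (ltW (so_X0 s)) (ltW X1) (lexx _).
  by rewrite leNgt PX.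
have in1 t : 0 < t < 1 -> 0 <= t <= X by move=> /andP[t0 t1]; rewrite (ltW t0) (le_trans (ltW t1)).
have anti x y : 0 <= x -> x <= y -> y <= 1 -> w y <= w x.
  move=> x0 xy y1'; apply: (sol_nonincr ss) => //; first exact: le_trans X1.
  move=> t /andP[xt ty]; have t0 := le_trans x0 (ltW xt).
  have t1 : t <= 1 by rewrite (le_trans (ltW ty)).
  by apply: noP => //; exact: le_trans X1.
have wa x : 0 <= x -> x <= 1 -> w x <= a by move=> x0 x1; rewrite -w0 anti.
have Pneg x : 0 < x < 1 -> P d M w Q x <= - (alpha / (2 * N) * x ^+ n.+1 * phi d M (w x)).
  move=> x01; have /andP[x0 x1] := x01; have xX : x <= X := le_trans (ltW x1) X1.
  have := Q_upper p1 d0 ss (lexx 0) (ltW x0) xX (c := - ((alpha / (2 * N) + beta) * phi d M (w x))).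
  have -> : Q 0 = 0 by case: ss.
  rewrite add0r expr0n subr0 => H; rewrite /wflux.
  have {}H : Q x <= - ((alpha / (2 * N) + beta) * phi d M (w x)) * x ^+ n.+1.
    apply: H => t /andP[t0 tx]; have t1 := lt_trans tx x1.
    have tX : 0 <= t <= X by rewrite (ltW t0) (le_trans (ltW tx)).
    have -> : alpha + beta * N = alpha / 2 + (alpha / (2 * N) + beta) * N.
      by field; rewrite lt0r_neq0.
    apply: rhs_le.
    - apply: (@le_trans _ _ (1 * (alpha / 2))); last by rewrite mul1r.
      apply: ler_pM; [exact: powR_ge0|exact: powR_ge0| |].
        apply: (@le_trans _ _ (1 `^ sigma)); last by rewrite powR1.
        by apply: sig_mono; exact: ltW.
      apply: le_trans (phip_le d0 (dw _ tX) dM _) H1.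
      by rewrite (le_trans (wa _ (ltW t0) (ltW t1)))// mulr_natl mulr2n lerDl ltW.
    - exact/ltW/root_clamp_gt0.
    rewrite ler_wpM2l//.
      by rewrite mulr_ge0 ?(ltW N0)// addr_ge0 ?(ltW be0)// divr_ge0 ?(ltW al0)// mulr_ge0 ?(ltW N0).
    by apply: (root_clamp_mono p1 pm M d0); apply: anti => //; exact: ltW.
  apply: (le_trans (lerD H (lexx _))).
  by rewrite le_eqVlt; apply/orP; left; apply/eqP; ring.
have wpos x : 0 <= x <= X -> 0 < w x by move=> /dw; exact: lt_le_trans.
have in1' t : 0 <= t <= 1 -> 0 <= t <= X by move=> /andP[t0 t1]; rewrite t0 (le_trans t1).
have D t : 0 < t < 1 -> is_derive t 1 (fun t => - (w t `^ (1 - 1 / m) + k * t ^+ 2))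
   (- ((1 - 1 / m) * w t `^ (1 - 1 / m - 1) * (P d M w Q t / t ^+ n) + k * (2 * t ^+ 1))).
  move=> t01; apply: is_deriveN1; apply: is_deriveD1.
    apply: (is_derive_powR _ (wpos _ (in1 _ t01))); apply: (sol_dw ss).
    by case/andP: t01 => -> t1; exact: lt_le_trans X1.
  exact: is_deriveMl (is_deriveXn 2 t).
have : - (w 0 `^ (1 - 1 / m) + k * 0 ^+ 2) <= - (w 1 `^ (1 - 1 / m) + k * 1 ^+ 2).
  apply: (@nondecr_seg _ (fun t => - (w t `^ (1 - 1 / m) + k * t ^+ 2)) _ _ ler01) => [t t01|t t01].
    apply: cvgN; apply: cvgD; last exact: is_derive_continuous (is_deriveMl k (is_deriveXn 2 t)).
    apply: (@continuous_comp _ _ _ w (fun y => y `^ (1 - 1 / m))); first exact/(sol_cw ss)/in1'.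
    exact: is_derive_continuous (is_derive1_powR _ (wpos _ (in1' _ t01))).
  eexists; first exact: D.
  have /andP[t0 t1] := t01; have tn : 0 < t ^+ n by rewrite exprn_gt0.
  have wt := wpos _ (in1 _ t01).
  have k1 : P d M w Q t / t ^+ n <= - (alpha / (2 * N) * t * w t `^ (1 / m)).
    rewrite ler_pdivrMr//; apply: (le_trans (Pneg _ t01)).
    rewrite phi_id; last first.
    - exact: le_trans (wa _ (ltW t0) (ltW t1)) aM.
    - exact/dw/in1.
    by rewrite exprS le_eqVlt; apply/orP; left; apply/eqP; ring.
  have k2 : w t `^ (1 - 1 / m - 1) * w t `^ (1 / m) = 1.
    rewrite -powRD; last by apply/implyP; rewrite (lt0r_neq0 wt).
    by rewrite addrAC subrK subrr powRr0.
  have k3 : 0 < (1 - 1 / m) * w t `^ (1 - 1 / m - 1) by rewrite mulr_gt0// powR_gt0.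
  rewrite oppr_ge0; move/(ler_wpM2l (ltW k3)): k1 => k1.
  apply: (@le_trans _ _ ((1 - 1 / m) * w t `^ (1 - 1 / m - 1) *
    - (alpha / (2 * N) * t * w t `^ (1 / m)) + k * (2 * t ^+ 1))); first by rewrite lerD2r.
  have -> : (1 - 1 / m) * w t `^ (1 - 1 / m - 1) * - (alpha / (2 * N) * t * w t `^ (1 / m)) =
    - ((1 - 1 / m) * (alpha / (2 * N) * t) * (w t `^ (1 - 1 / m - 1) * w t `^ (1 / m))) by ring.
  rewrite k2 /k le_eqVlt; apply/orP; left; apply/eqP; field.
  by rewrite !lt0r_neq0.
rewrite w0 lerN2 expr0n mulr0 addr0 expr1n mulr1 leNgt => /negP; apply.
by apply: (lt_le_trans H2); rewrite lerDr powR_ge0.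
Qed.

(** One [M] is both the truncation level and the right end of the shooting interval. A solution that
    does not rise never exceeds its initial value a <= M, so the upper cut-off is inactive as well.
    If every value in the interval rose or fell, the supremum of the falling ones would contradict
    openness. *)
Lemma shooting : exists M a, [/\ 0 < a, a <= M, ~ rises M a &
  forall X, 0 < X -> exists delta w Q, solution_on M delta X a w Q].
Proof.
have [M M0 rM] := rises_large.
have [a0 [a00 a0M nr0]] := not_rises_small M0.
have [[a [a0a aM nr nf]]|all] := pselect (exists a, [/\ a0 <= a, a <= M, ~ rises M a & ~ falls M a]).
  exists M, a; split=> // [|X X0]; first exact: lt_le_trans a0a.
  by apply: neither_extends => //; exact: lt_le_trans a0a.
exfalso.
have rf a : a0 <= a -> a <= M -> rises M a \/ falls M a.
  move=> h1 h2; apply: contrapT => h; apply: all; exists a; split=> // ha; apply: h;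
    by [left|right].
pose S := [set a | [/\ a0 <= a, a <= M & falls M a]].
have S0 : S a0 by split=> //; case: (rf a0 (lexx _) a0M).
have supS : has_sup S by split; [exists a0|exists M => a []].
pose c := sup S.
have a0c : a0 <= c by apply: ub_le_sup => //; case: supS.
have cM : c <= M by apply: ge_sup; [exists a0|move=> a []].
have [rc|fc] := rf c a0c cM.
  have [e e0 He] := rises_open rc.
  have [a Sa ca] := sup_adherent e0 supS.
  have ac : a <= c by apply: ub_le_sup => //; case: supS.
  have [_ _ fa] := Sa.
  apply: (rises_falls_disjoint _ fa); apply: He.
  by rewrite ler0_norm ?subr_le0// opprB ltrBlDl -ltrBlDr.
have [e e0 He] := falls_open fc.
have cM' : c < M.
  rewrite lt_neqAle cM andbT; apply/eqP => E; apply: (rises_falls_disjoint rM).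
  by rewrite -[X in falls _ X]E.
pose a := Num.min M (c + e / 2).
have ca : c < a by rewrite lt_min cM' ltrDl divr_gt0.
have : a <= c.
  apply: ub_le_sup; first by case: supS.
  split; first by rewrite (le_trans a0c)// ltW.
    by rewrite ge_min lexx.
  apply: He; rewrite gtr0_norm ?subr_gt0// ltrBlDl.
  apply: (@le_lt_trans _ _ (c + e / 2)); first by rewrite ge_min lexx orbT.
  by rewrite ltrD2l half_lt.
by rewrite leNgt ca.
Qed.

End shooting.

(** * The decreasing profile *)

Section global_profile.
Context {R : realType}.
Variables (n : nat) (m p sigma : R).
Implicit Types (x y t M a delta X : R).
Hypotheses (p1 : 1 < p) (pm : p < m) (sigma0 : 0 < sigma).

Local Notation N := (n.+1%:R : R).
Local Notation alpha := (ss_alpha m p sigma).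
Local Notation beta := (ss_beta m p sigma).
Local Notation ode_at := (ode_at n m p sigma).

Let m0 : 0 < m. Proof. by move: p1 pm; lra. Qed.
Let al0 : 0 < alpha. Proof. exact: ss_alpha_gt0. Qed.
Let be0 : 0 < beta. Proof. exact: ss_beta_gt0. Qed.
Let ab0 : 0 < alpha + beta * N. Proof. by apply: addr_gt0 => //; exact: mulr_gt0. Qed.

Let continuous_near (F G : R -> R) x : (\near x, F x = G x) ->
  {for x, continuous F} -> {for x, continuous G}.
Proof.
move=> FG cF; rewrite /prop_for /continuous_at -(nbhs_singleton FG).
by apply: cvg_trans cF; exact: near_eq_cvg.
Qed.

(** The cut-off delta depends on the interval, so the solutions on [0, j+1] solve different
    truncated systems; uniqueness across cut-offs glues them, and the limit equation contains the
    plain root. *)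
Lemma global_solution : exists a W Q, [/\ 0 < a, continuous W, W 0 = a,
  forall x, W x = W `|x| /\ 0 < W x &
  [/\ forall x y, 0 <= x -> x <= y -> W y <= W x,
      forall x, 0 < x -> is_derive x 1 W (Q x / x ^+ n + x * (beta * W x `^ (1 / m))),
      forall x, 0 < x -> is_derive x 1 Q (x ^+ n *
        (x `^ sigma * W x `^ (1 / m) `^ p - (alpha + beta * N) * W x `^ (1 / m))),
      forall x, 0 < x -> Q x + beta * x ^+ n.+1 * W x `^ (1 / m) <= 0 &
      exists C, forall x, 0 < x -> - (C * x ^+ n.+1) <= Q x] ].
Proof.
have [M [a [a0 aM nr ext]]] := shooting n p1 pm sigma0.
have : forall j : nat, exists s : R * ((R -> R) * (R -> R)),
    solution_on n m p sigma M s.1 j.+1%:R a s.2.1 s.2.2.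
  by move=> j; have [d [w [Q s]]] := ext _ (ltr0Sn R j); exists (d, (w, Q)).
move=> /choice[F HF].
(* By uniqueness any large enough index gives the same value; since |x| is strictly below the end of
   the chosen interval, that index also serves a neighbourhood of x. *)
pose k x := Num.bound `|x|.
have kP x : `|x| < (k x)%:R by exact: archi_boundP.
pose W x := (F (k x)).2.1 `|x|; pose Q x := (F (k x)).2.2 `|x|.
have agree j x : 0 <= x -> x <= j.+1%:R -> W x = (F j).2.1 x /\ Q x = (F j).2.2 x.
  move=> x0 xj; have xk := kP x; rewrite ger0_norm// in xk.
  have xk' : x <= (k x).+1%:R by rewrite (le_trans (ltW xk))// ler_nat.
  rewrite /W /Q ger0_norm//.
  have [jk|kj] := leqP j (k x).
    have jk' : j.+1%:R <= (k x).+1%:R :> R by rewrite ler_nat ltnS.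
    have sk := solution_on_sub (ltr0Sn R j) jk' (HF (k x)).
    by apply: (solution_on_unique p1 pm sigma0 sk (HF j)); rewrite x0 xj.
  have kj' : (k x).+1%:R <= j.+1%:R :> R by rewrite ler_nat ltnS ltnW.
  have sj := solution_on_sub (ltr0Sn R (k x)) kj' (HF j).
  by apply: (solution_on_unique p1 pm sigma0 (HF (k x)) sj); rewrite x0 xk'.
have Weven x : W x = W `|x| by rewrite /W /k normr_id.
have kS x : `|x| < (k x).+1%:R by rewrite (lt_trans (kP x))// ltr_nat.
have anti x y : 0 <= x -> x <= y -> W y <= W x.
  move=> x0 xy; have y0 := le_trans x0 xy; have := kS y; rewrite ger0_norm// => /ltW yk.
  have [-> _] := agree (k y) y y0 yk; have [-> _] := agree (k y) x x0 (le_trans xy yk).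
  exact: (not_rises_nonincr p1 pm sigma0 nr (HF (k y))).
have Wpos x : 0 < W x.
  have xk : 0 <= `|x| <= (k x).+1%:R by rewrite normr_ge0 (ltW (kS x)).
  apply: lt_le_trans (so_low (HF (k x)) xk).
  by rewrite mulr_gt0// (so_d0 (HF (k x))).
have W0 : W 0 = a.
  have [-> _] := agree 0%N 0 (lexx 0) (ler01).
  by case: (so_sol (HF 0%N)).
have Wa x : 0 <= x -> W x <= a by move=> x0; rewrite -W0 anti.
have phiE j x : 0 <= x -> x <= j.+1%:R -> root_clamp m (F j).1 M (W x) = W x `^ (1 / m).
  move=> x0 xj; rewrite /root_clamp clamp_id//; last exact: le_trans (Wa x x0) aM.
  have [-> _] := agree j x x0 xj.
  have xx : 0 <= x <= j.+1%:R by rewrite x0.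
  by apply: le_trans (so_low (HF j) xx); have := so_d0 (HF j); lra.
have near_agree x : 0 < x -> \forall t \near x, 0 < t < (k x).+1%:R.
  move=> x0; have xk : x < (k x).+1%:R by have := kS x; rewrite gtr0_norm.
  by apply: filterS2 (near_gt x0) (lt_nbhsl xk) => t -> ->.
have dWQ x : 0 < x -> let j := k x in 0 < x < j.+1%:R.
  by move=> x0; have := kS x; rewrite gtr0_norm// x0.
exists a, W, Q; split=> //.
  move=> x; apply: (@continuous_near (fun t => (F (k x)).2.1 `|t|)).
    have : \forall t \near x, `|t| < (k x).+1%:R.
      exact: (@norm_continuous R R x _ (lt_nbhsl (kS x))).
    apply: filterS => t tk; rewrite Weven.
    by have [-> _] := agree (k x) `|t| (normr_ge0 t) (ltW tk).
  apply: (@continuous_comp _ _ _ (fun t : R => `|t|) (F (k x)).2.1); first exact: norm_continuous.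
  by apply: (sol_cw (so_sol (HF (k x)))); rewrite normr_ge0 (ltW (kS x)).
split=> //.
- move=> x x0; have xj := dWQ x x0.
  have := sol_dw (so_sol (HF (k x))) xj.
  have /andP[_ /ltW xj'] := xj; have [w_ q_] := agree (k x) x (ltW x0) xj'.
  rewrite /wflux -w_ -q_ phiE ?(ltW x0)// => d.
  apply: (@is_derive_eq _ _ _ _ _ _ _ _ (is_derive_near _ d)).
    apply: filterS (near_agree x x0) => t /andP[t0 tk].
    by have [-> _] := agree (k x) t (ltW t0) (ltW tk).
  by rewrite exprS; field; rewrite lt0r_neq0// exprn_gt0.
- move=> x x0; have xj := dWQ x x0.
  have d := sol_dQ p1 (so_d0 (HF (k x))) (so_sol (HF (k x))) xj.
  have /andP[_ /ltW xj'] := xj; have [w_ q_] := agree (k x) x (ltW x0) xj'.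
  move: d; rewrite -w_ phiE ?(ltW x0)// => d.
  apply: (@is_derive_eq _ _ _ _ _ _ _ _ (is_derive_near _ d)).
    apply: filterS (near_agree x x0) => t /andP[t0 tk].
    by have [_ ->] := agree (k x) t (ltW t0) (ltW tk).
  rewrite -[in RHS](@mulr_powRB1 _ (W x `^ (1 / m)) p) ?powR_ge0 ?(lt_trans _ p1)//.
  ring.
- move=> x x0; have /andP[_ /ltW xj] := dWQ x x0.
  have := not_rises_flux p1 pm sigma0 nr (HF (k x)) (x := x).
  rewrite (ltW x0) xj => /(_ isT); rewrite /wflux.
  by have [<- <-] := agree (k x) x (ltW x0) xj; rewrite phiE ?(ltW x0).
exists ((alpha + beta * N) * M `^ (1 / m) / N) => x x0.
have /andP[_ /ltW xj] := dWQ x x0; have [_ ->] := agree (k x) x (ltW x0) xj.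
set C := _ / N; have ss := so_sol (HF (k x)).
have Q0 : (F (k x)).2.2 0 = 0 by case: ss.
have -> : - (C * x ^+ n.+1) = (F (k x)).2.2 0 + - C * (x ^+ n.+1 - 0 ^+ n.+1).
  by rewrite Q0 expr0n /= subr0 add0r mulNr.
apply: (Q_lower p1 (so_d0 (HF (k x))) ss (lexx 0) (ltW x0) xj) => t _.
have -> : - C * N = - ((alpha + beta * N) * M `^ (1 / m)).
  by rewrite /C mulNr divfK// lt0r_neq0.
set g := root_clamp _ _ _ _.
have g0 : 0 < g by exact: root_clamp_gt0 (so_d0 (HF (k x))) _.
rewrite mulrBr; apply: (@le_trans _ _ (- (g * (alpha + beta * N)))).
  rewrite lerN2 mulrC ler_pM2l//.
  exact: (root_clamp_le p1 pm (so_d0 (HF (k x))) (so_dM (HF (k x)))).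
rewrite lerDr mulr_ge0 ?(ltW g0)// mulr_ge0 ?powR_ge0//.
Qed.

Lemma is_right_derive_of (F : R -> R) x d : is_derive x 1 F d -> is_right_derive F x d.
Proof.
move=> dF; apply/cvgrPdist_lt => e e0.
have : h^-1 *: ((F \o shift x) h - F x) @[h --> 0^'] --> d.
  have [dv <-] := dF.
  have := dv; rewrite /derivable /derive.
  by under eq_fun do rewrite /= /GRing.scale /= mulr1.
move=> /cvgrPdist_lt /(_ _ e0) [r /= r0 H].
exists r => // h hr h0; have := H h hr; rewrite gt_eqF// => /(_ isT).
by rewrite /= /GRing.scale /= [h + x]addrC.
Qed.

Lemma profile_of_ode (g z : R -> R) : continuous g -> continuous z -> z 0 = 0 ->
  (forall x, 0 <= x -> 0 < g x) -> (forall x, 0 < x -> ode_at 1 g z x) ->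
  is_derive (0 : R) 1 (fun x => g x `^ m) 0 ->
  self_similar_profile n.+1 m p sigma g /\ is_right_derive g 0 0.
Proof.
move=> cg cz z0 gpos og dg0.
have dw x : 0 < x -> is_derive x 1 (fun t => g t `^ m) (z x).
  by move=> x0; exact: (ode_dw p1 pm (og x x0)).
have g00 := gpos 0 (lexx 0).
split; last first.
  (* Near 0, where g is positive, g is the root of g^m, and the chain rule transfers the zero
     derivative. *)
  have d0 : is_derive (0 : R) 1 (fun x => (g x `^ m) `^ (1 / m)) 0.
    apply: (is_derive_eq (is_derive_powR (1 / m) _ dg0)); first exact: powR_gt0.
    by rewrite mulr0.
  apply: is_right_derive_of; apply: is_derive_near d0.
  have /cvgrPdist_lt /(_ _ g00) := cg 0; apply: filterS => t.
  rewrite ltr_norml => /andP[_ h]; have gt : 0 < g t by move: h; lra.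
  by rewrite -powRrM mulrC divfK ?powRr1 ?(ltW gt)// lt0r_neq0.
split.
- by move=> x /gpos/ltW.
- exact: continuous_subspaceT.
- exists z; split=> //; last by move=> x /gpos g0 E; move: g0; rewrite E ltxx.
    by split=> //; rewrite z0; exact: is_right_derive_of.
  exact: continuous_subspaceT.
move=> x x0 gx.
have dz := ode_dz (og x x0).
have fmE t : 0 < t -> (fun r => g r `^ m)^`()%classic t = z t.
  by move=> t0; rewrite derive1E; have [_] := dw t t0.
have dfm : is_derive x 1 ((fun r => g r `^ m)^`()%classic) (beta * x * (g x * z x / (m * g x `^ m)) -
    alpha * g x + 1 * x `^ sigma * g x `^ p - (N - 1) / x * z x).
  apply: is_derive_near dz; near=> t; apply/esym/fmE; near: t; exact: near_gt.
split.
- by case: (ode_df (og x x0)).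
- by case: (dw x x0).
- by case: dfm.
rewrite /profile_ode.
have -> : (fun r => g r `^ m)^`()%classic^`()%classic x = beta * x * (g x * z x / (m * g x `^ m)) -
    alpha * g x + 1 * x `^ sigma * g x `^ p - (N - 1) / x * z x.
  by rewrite derive1E; case: dfm.
have -> : g^`()%classic x = g x * z x / (m * g x `^ m).
  by rewrite derive1E; case: (ode_df (og x x0)).
rewrite (fmE x x0) mul1r.
by move: (x `^ sigma * _) ((N - 1) / x * _) (beta * x * _) (alpha * _) => A B C D; lra.
Unshelve. all: by end_near. Qed.

Let is_derive0_of_quadratic (F : R -> R) C :
  (forall h : R, `|F h - F 0| <= C * h ^+ 2) -> is_derive (0 : R) 1 F 0.
Proof.
move=> HF.
have lim0 : h^-1 *: ((F \o shift 0) (h *: (1 : R)) - F 0) @[h --> 0^'] --> (0 : R).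
  apply/cvgrPdist_lt => e e0.
  exists (e / (`|C| + 1)); first by rewrite /= divr_gt0// ltr_wpDl.
  move=> h /=; rewrite sub0r normrN => hr h0.
  rewrite /GRing.scale /= mulr1 addr0 sub0r normrN normrM normfV mulrC.
  rewrite ltr_pdivrMr ?normr_gt0//; apply: (le_lt_trans (HF h)).
  have h_gt0 : 0 < `|h| by rewrite normr_gt0.
  apply: (@le_lt_trans _ _ (`|C| * `|h| * `|h|)).
    by rewrite -[h ^+ 2]real_normK ?num_real// expr2 mulrA ler_wpM2r// ler_wpM2r// ler_norm.
  rewrite ltr_pM2r//; move: hr; rewrite ltr_pdivlMr ?ltr_wpDl// mulrDr mulr1 mulrC => hr.
  by apply: le_lt_trans hr; rewrite lerDl.
by apply: DeriveDef; [exact: cvgP lim0|exact: cvg_lim lim0].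
Qed.

Lemma decreasing_solution : exists g z : R -> R, [/\ continuous g, continuous z, z 0 = 0,
  is_derive (0 : R) 1 (fun x => g x `^ m) 0 &
  [/\ forall x, 0 < g x, forall x, 0 < x -> ode_at 1 g z x &
      forall x y, 0 <= x -> x <= y -> g y <= g x] ].
Proof.
have [a [W [Q [a0 cW W0 HW [anti dW dQ Pneg [C Qlow]]]]]] := global_solution.
have Weven x : W x = W `|x| by case: (HW x).
have Wpos x : 0 < W x by case: (HW x).
pose g x := W x `^ (1 / m).
have g0 x : 0 < g x by exact: powR_gt0.
have gm x : g x `^ m = W x by rewrite /g -powRrM divfK ?powRr1 ?(ltW (Wpos x))// lt0r_neq0.
have gmE : (fun x => g x `^ m) = W by apply/funext.
(* The value at 0 is the limit, since -C x <= z x <= 0 for x > 0. *)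
pose z x := if x == 0 then 0 else Q `|x| / `|x| ^+ n + `|x| * (beta * g x).
have zE x : 0 < x -> z x = Q x / x ^+ n + x * (beta * g x).
  by move=> x0; rewrite /z gt_eqF// gtr0_norm.
have dWz x : 0 < x -> is_derive x 1 W (z x) by move=> x0; rewrite zE//; exact: dW.
have z_bounds x : 0 < x -> - (C * x) <= z x <= 0.
  move=> x0; have xn : 0 < x ^+ n by rewrite exprn_gt0.
  have -> : z x = (Q x + beta * x ^+ n.+1 * g x) / x ^+ n.
    by rewrite zE// exprS; field; rewrite lt0r_neq0.
  apply/andP; split; last by rewrite ler_pdivrMr// mul0r Pneg.
  rewrite ler_pdivlMr//.
  have -> : - (C * x) * x ^+ n = - (C * x ^+ n.+1) by rewrite exprS; ring.
  apply: (le_trans (Qlow x x0)).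
  by rewrite lerDl mulr_ge0 ?(ltW (g0 x))// mulr_ge0 ?exprn_ge0 ?(ltW be0) ?(ltW x0).
have og x : 0 < x -> ode_at 1 g z x.
  move=> x0; have dgx : is_derive x 1 g (g x * z x / (m * g x `^ m)).
    apply: (is_derive_eq (is_derive_powR (1 / m) (Wpos x) (dWz x x0))).
    have -> : W x `^ (1 / m - 1) = g x / W x.
      by rewrite powRB ?powRr1 ?(ltW (Wpos x))//; apply/implyP; rewrite (lt0r_neq0 (Wpos x)).
    rewrite gm; field; rewrite (lt0r_neq0 (Wpos x)) lt0r_neq0//.
  split=> //.
  have xn : 0 < x ^+ n by rewrite exprn_gt0.
  have dV : is_derive x 1 (fun t : R => (t ^+ n)^-1) (- (x ^+ n) ^- 2 * (n%:R * x ^+ n.-1)).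
    apply: (is_derive_eq (is_deriveV (f := fun t => t ^+ n) (lt0r_neq0 xn) (is_deriveXn n x))).
    by [].
  have D : is_derive x 1 (fun t => Q t * (t ^+ n)^-1 + t * (beta * g t)) _ :=
    is_deriveD1 (is_deriveM1 (dQ x x0) dV) (is_deriveM1 (is_derive_idn x) (is_deriveMl beta dgx)).
  have nx : n%:R * x ^+ n.-1 = n%:R / x * x ^+ n.
    case: (n) => [|j]; first by rewrite !mul0r.
    by rewrite /= exprS; field; rewrite lt0r_neq0.
  apply: (@is_derive_eq _ _ _ _ _ _ _ _ (is_derive_near _ D)).
    by apply: filterS (near_gt x0) => t t0; rewrite zE.
  have -> : N - 1 = n%:R by rewrite -addn1 natrD addrK.
  rewrite nx [in X in _ = _ - X](zE x x0) -/(g x) gm -natr1.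
  move: (x `^ sigma) (g x `^ p) (W x) (Wpos x) (z x) => A B w w0 zz.
  by field; rewrite !lt0r_neq0.
have cz : continuous z.
  move=> x; have [->|x0] := eqVneq x 0.
    have z00 : z 0 = 0 by rewrite /z eqxx.
    apply/cvgrPdist_lt => e e0; rewrite z00.
    exists (e / (`|C| + 1)); first by rewrite /= divr_gt0// ltr_wpDl.
    move=> t; rewrite /ball_ /= !sub0r !normrN ltr_pdivlMr ?ltr_wpDl// => te.
    have [->|t0] := eqVneq t 0; first by rewrite /z eqxx normr0.
    have tt : 0 < `|t| by rewrite normr_gt0.
    have -> : z t = z `|t| by rewrite /z normr_id normr_eq0 (negPf t0) /g Weven.
    have /andP[z1 z2] := z_bounds _ tt.
    rewrite ler0_norm//; apply: le_lt_trans te.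
    apply: (@le_trans _ _ (C * `|t|)); first by move: z1; lra.
    by rewrite mulrC ler_wpM2l// (le_trans (ler_norm C))// lerDl.
  have xx : 0 < `|x| by rewrite normr_gt0.
  apply: (@continuous_near (fun t => z `|t|)).
    have [e /= e0 He] : \forall t \near x, t != 0 by exact: open_neq.
    exists e => // t /He t0; rewrite /z normr_id normr_eq0 (negPf t0) /g -Weven//.
  apply: (@continuous_comp _ _ _ (fun t : R => `|t|) z); first exact: norm_continuous.
  exact: is_derive_continuous (ode_dz (og _ xx)).
exists g, z; split=> //.
- move=> x; apply: (@continuous_comp _ _ _ W (fun y => y `^ (1 / m))); first exact: cW.
  exact: is_derive_continuous (is_derive1_powR (1 / m) (Wpos x)).
- by rewrite /z eqxx.
(* Monotonicity and z >= -C t pinch W h between W 0 - C h^2 / 2 and W 0; evenness covers negative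
   h. *)
- rewrite gmE; apply: (@is_derive0_of_quadratic _ (C / 2)) => h.
  have hh := normr_ge0 h; rewrite Weven ler0_norm ?subr_le0 ?anti//.
  have : W 0 + C / 2 * 0 ^+ 2 <= W `|h| + C / 2 * `|h| ^+ 2.
    apply: (@nondecr_seg _ (fun t => W t + C / 2 * t ^+ 2) _ _ hh) => [t _|t /andP[t0 _]].
      apply: cvgD; first exact: cW.
      exact: is_derive_continuous (is_deriveMl (C / 2) (is_deriveXn 2 t)).
    eexists; first exact: is_deriveD1 (dWz t t0) (is_deriveMl (C / 2) (is_deriveXn 2 t)).
    by have /andP[z1 _] := z_bounds t t0; rewrite /= expr1; move: z1; lra.
  by rewrite expr0n mulr0 addr0 real_normK ?num_real//; lra.
split=> // x y x0 xy; apply: ge0_ler_powR; rewrite ?nnegrE ?(ltW (Wpos _)) ?anti//.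
by rewrite divr_ge0// ltW.
Qed.

(* Constancy on an interval would force xi^sigma f^(p-1) = alpha there. *)
Lemma solution_strictly_decreasing (g z : R -> R) x y :
  (forall t, 0 < t -> ode_at 1 g z t) ->
  (forall r t, 0 <= r -> r <= t -> g t <= g r) -> 0 < x -> x < y -> g y < g x.
Proof.
move=> og anti x0 xy; rewrite ltNge; apply/negP => gxy.
have gE t : x <= t -> t <= y -> g t = g x.
  move=> xt ty; apply/eqP; rewrite eq_le anti ?(ltW x0)//= (le_trans gxy)//.
  by rewrite anti// (le_trans (ltW x0)).
have inside t : x < t -> t < y -> \forall r \near t, x < r < y.
  by move=> xt ty; apply: filterS2 (near_gt xt) (lt_nbhsl ty) => r -> ->.
have z0 t : x < t -> t < y -> z t = 0.
  move=> xt ty; have t0 := lt_trans x0 xt.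
  apply: (is_derive_unique (ode_dw p1 pm (og t t0))).
  apply: is_derive_near (is_derive_cstn (g x `^ m) t).
  by apply: filterS (inside t xt ty) => r /andP[xr ry]; rewrite gE ?ltW.
have eqn t : x < t -> t < y -> t `^ sigma * g x `^ p = alpha * g x.
  move=> xt ty; have t0 := lt_trans x0 xt.
  have dz0 : is_derive t 1 z 0.
    apply: is_derive_near (is_derive_cstn 0 t).
    by apply: filterS (inside t xt ty) => r /andP[xr ry]; rewrite z0.
  have := is_derive_unique (ode_dz (og t t0)) dz0.
  rewrite z0// gE ?ltW// !mulr0 mul0r mulr0 mul1r.
  by move: (_ * g x) (_ * g x `^ p) => A B; lra.
pose t1 := x + (y - x) / 3; pose t2 := x + (y - x) / 2.
have [x1 [t12 t2y]] : x < t1 /\ t1 < t2 /\ t2 < y by rewrite /t1 /t2; split; [|split]; lra.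
have t10 := lt_trans x0 x1.
have : t1 `^ sigma < t2 `^ sigma.
  by apply: gt0_ltr_powR; rewrite ?nnegrE ?(ltW t10) ?(ltW (lt_trans t10 t12)).
have gp : 0 < g x `^ p by rewrite powR_gt0//; exact: ode_pos (og x x0).
rewrite -(ltr_pM2r gp) eqn ?(lt_trans t12)// eqn ?(lt_trans x1)// ltxx.
by [].
Qed.

(** The comparison is applied in both directions, to the even extensions; a positive value at 0
    makes each profile positive everywhere. Equal tails thus force equal initial values. *)
Lemma decaying_profile_unique A1 A2 (f1 f2 : R -> R) : 0 < A1 -> 0 < A2 ->
  decaying_profile_from n.+1 m p sigma A1 f1 -> decaying_profile_from n.+1 m p sigma A2 f2 ->
  forall x, 0 <= x -> f1 x = f2 x.
Proof.
have data A (f : R -> R) : 0 < A -> decaying_profile_from n.+1 m p sigma A f ->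
    exists z, [/\ continuous (fun x : R => f `|x|), continuous z, z 0 = 0,
      forall t, 0 <= t -> 0 < f `|t| &
      (forall t, 0 < t -> ode_at 1 (fun x : R => f `|x|) z t) /\
      has_cstar_decay p sigma (fun x : R => f `|x|)].
  move=> A0 [prf fA _ dec].
  have [dfm [hd cd d0 _]] := profile_C1 prf.
  have fpos t : 0 <= t -> 0 < f t.
    by move=> t0; apply: (profile_pos_right p1 pm sigma0 prf (lexx 0) t0); rewrite fA.
  exists (fun x : R => dfm `|x|); split.
  - exact: half_line_abs_continuous (profile_continuous prf).
  - exact: half_line_abs_continuous cd.
  - by rewrite normr0.
  - by move=> t t0; rewrite ger0_norm// fpos.
  split.
    move=> t t0; have [h1 h2 h3] := profile_ode_at p1 pm prf hd t0 (fpos t (ltW t0)).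
    split; rewrite /= (gtr0_norm t0)//.
      by apply: is_derive_near h2; apply: filterS (near_gt t0) => r r0; rewrite gtr0_norm.
    by apply: is_derive_near h3; apply: filterS (near_gt t0) => r r0; rewrite gtr0_norm.
  have pos : \forall x \near +oo, (0 : R) <= x by apply: nbhs_pinfty_ge; exact: num_real.
  by apply: cvg_trans dec; apply: near_eq_cvg; apply: filterS pos => x x0; rewrite ger0_norm.
move=> A10 A20 prf1 prf2 x x0.
have [z1 [c1 cz1 z10 pos1 [ode1 d1]]] := data _ _ A10 prf1.
have [z2 [c2 cz2 z20 pos2 [ode2 d2]]] := data _ _ A20 prf2.
have := decaying_le p1 pm sigma0 c1 cz1 c2 cz2 z10 z20 pos1 pos2 ode1 ode2 d1 d2 x0.
have := decaying_le p1 pm sigma0 c2 cz2 c1 cz1 z20 z10 pos2 pos1 ode2 ode1 d2 d1 x0.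
by rewrite ger0_norm// => h1 h2; apply/eqP; rewrite eq_le h1 h2.
Qed.

End global_profile.

Theorem theorem1p1 (R : realType) (N : nat) (m p sigma : R)
    (hN : (1 <= N)%N) (hp : 1 < p) (hpm : p < m) (hsigma : 0 < sigma) :
  (forall f : R -> R,
     self_similar_profile N m p sigma f ->
     bounded_on_half_line f ->
     (exists2 xi : R, 0 <= xi & f xi <> 0) ->
     has_cstar_decay p sigma f)
  /\
  (exists (Astar : R) (fstar : R -> R),
     [/\ 0 < Astar,
         decaying_profile_from N m p sigma Astar fstar,
         (forall (A : R) (f : R -> R),
            0 < A -> decaying_profile_from N m p sigma A f ->
            A = Astar /\ (forall xi : R, 0 <= xi -> f xi = fstar xi)) &
         (forall x y : R, 0 < x -> x < y -> fstar y < fstar x)]).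
Proof.
case: N hN => // n _; split; first exact: bounded_profile_decay.
have [g [z [cg cz z0 dg0 [g0 og anti]]]] := decreasing_solution n hp hpm hsigma.
have [prf dg] := profile_of_ode hp hpm cg cz z0 (fun x _ => g0 x) og dg0.
have g00 := g0 0.
have gdec : decaying_profile_from n.+1 m p sigma (g 0) g.
  split=> //; apply: (bounded_profile_decay hp hpm hsigma prf).
    exists (g 0); split; first exact: num_real.
    move=> B gB x; rewrite /= in_itv /= andbT => x0.
    by rewrite ger0_norm ?(ltW (g0 x))// (le_trans (anti _ _ (lexx 0) x0))// ltW.
  by exists 0 => // E; move: g00; rewrite E ltxx.
exists (g 0), g; split=> // [A f A0 fdec|x y x0 xy].
  have fg := decaying_profile_unique hp hpm hsigma A0 g00 fdec gdec.
  by split=> //; rewrite -fg//; case: fdec.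
exact: (solution_strictly_decreasing hp hpm hsigma og anti x0 xy).
Qed.
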